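(* Consider the piecewise-smooth system $$(\dot x,\dot y)^\top=\begin{cases}(X^+(x,y),Y^+(x,y))^\top & \text{if } y>0,\\ (X^-(x,y),Y^-(x,y))^\top & \text{if } y<0,\end{cases}\qquad(\ast)$$ where $X^\pm,Y^\pm$ are real analytic functions, and suppose that the origin $O$ is a monodromic singular point around which orbits rotate counterclockwise. Let $N$ be any positive integer. Then in a neighborhood of $O$ the system $(\ast)$ can be transformed, by an admissible homeomorphism and an admissible time scaling (both defined in the context), into the following form. (FF) If $O$ is of FF type, the form is, for some constants $\gamma_1^\pm,\dots,\gamma_{N+1}^\pm\in\mathbb R$, $$(\dot x,\dot y)^\top=\begin{cases}\begin{pmatrix}\gamma_1^+&-1\\ 1&\gamma_1^+\end{pmatrix}\begin{pmatrix}x\\ y\end{pmatrix}+\sum_{i=1}^{N}\gamma_{i+1}^+y^i\begin{pmatrix}x\\ y\end{pmatrix}+\boldsymbol G^+_{N+2}(x,y)&\text{if }y>0,\\[2mm] \begin{pmatrix}\gamma_1^-&-1\\ 1&\gamma_1^-\end{pmatrix}\begin{pmatrix}x\\ y\end{pmatrix}+\sum_{i=1}^{N}\gamma_{i+1}^-y^i\begin{pmatrix}x\\ y\end{pmatrix}+\boldsymbol G^-_{N+2}(x,y)&\text{if }y<0.\end{cases}$$ (FP) If $O$ is of FP type, the form is, for some constants $\gamma_1^+,\dots,\gamma_{N+1}^+\in\mathbb R$ and some integer $\ell^-\ge1$, $$(\dot x,\dot y)^\top=\begin{cases}\begin{pmatrix}\gamma_1^+&-1\\ 1&\gamma_1^+\end{pmatrix}\begin{pmatrix}x\\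 y\end{pmatrix}+\sum_{i=1}^{N}\gamma_{i+1}^+y^i\begin{pmatrix}x\\ y\end{pmatrix}+\boldsymbol G^+_{N+2}(x,y)&\text{if }y>0,\\[2mm] \begin{pmatrix}1\\ x^{2\ell^--1}\end{pmatrix}+\boldsymbol R^-_{N}(x,y)&\text{if }y<0.\end{cases}$$ (PP) If $O$ is of PP type, the form is, for some constants $\sigma_2^+,\dots,\sigma_{N+1}^+\in\mathbb R$ and some integers $\ell^\pm\ge1$, $$(\dot x,\dot y)^\top=\begin{cases}\begin{pmatrix}-1\\ x^{2\ell^+-1}+\sum_{i=1}^{N}\sigma_{i+1}^+x^{2\ell^+-1+i}\end{pmatrix}+\boldsymbol R^+_{N}(x,y)&\text{if }y>0,\\[2mm] \begin{pmatrix}1\\ x^{2\ell^--1}\end{pmatrix}+\boldsymbol R^-_{N}(x,y)&\text{if }y<0.\end{cases}$$ Here $\boldsymbol G^\pm_{N+2}$ are (convergent) sums of homogeneous polynomial vector fields of degree greater than or equal to $N+2$, and $\boldsymbol R^\pm_N$ are (convergent) sums of quasi-homogeneous polynomial vector fields of type $(1,2\ell^\pm)$ with degree greater than or equal to $N$.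
   Context: Monodromic singular point: $O=(0,0)$ is a monodromic singular point of $(\ast)$ if no orbit approaches $O$ in a definite direction as $t\to\pm\infty$; orbits near $O$ then rotate around $O$, and are formed by concatenating orbit arcs of the upper subsystem ($y>0$) and the lower subsystem ($y<0$) across the switching line $y=0$. Types: A subsystem is of focus type at $O$ if $O$ is an equilibrium of it whose linear part has eigenvalues $\alpha\pm\beta i$ with $\beta\neq0$. It is of parabolic type at $O$ if $O$ is an invisible tangent point of some multiplicity $2\ell-1$, $\ell\ge1$: for the upper subsystem this means $X^+(0,0)\ne0$, $\partial_x^jY^+(0,0)=0$ for $0\le j\le2\ell-2$ and $X^+(0,0)\,\partial_x^{2\ell-1}Y^+(0,0)<0$; for the lower subsystem the same with $X^-,Y^-$ and the last inequality replaced by $X^-(0,0)\,\partial_x^{2\ell-1}Y^-(0,0)>0$. The monodromic singular point $O$ is of FF type if both subsystems are of focus type, of FP type if the upper one is of focus type and the lower one is of parabolic type, and of PP type if both are of parabolic type. Admissible homeomorphism: a homeomorphism near $O$ of the form $$\begin{pmatrix}x\\ y\end{pmatrix}=h(u,v)=\begin{pmatrix}1&q_2^\pm\\ 0&q_1^\pm\end{pmatrix}\begin{pmatrix}u\\ v\end{pmatrix}+\begin{pmatrix}\Phi^\pm(u,v)\\ \Psi^\pm(u,v)\end{pmatrix},$$ with sign $+$ for $v\ge0$ and $-$ for $v\le0$, where $q_1^\pm,q_2^\pm\in\mathbb R$, $q_1^+q_1^->0$, and $\Phi^\pm,\Psi^\pm=o(|(u,v)|)$ are real analytic with $\Phi^+(u,0)=\Phi^-(u,0)$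 and $\Psi^+(u,0)=\Psi^-(u,0)=0$. Admissible time scaling: $dt\to\tau^\pm\,dt$ with $\tau^+$ (for $v>0$) and $\tau^-$ (for $v<0$) positive real analytic functions near $O$. The transformed system at $(u,v)$, $v\neq0$, is the vector field $\tau^{\pm}(u,v)\,(Dh(u,v))^{-1}Z(h(u,v))$, where $Z$ is the right-hand side of $(\ast)$; the new variables are then renamed $(x,y)$. Quasi-homogeneity: a polynomial vector field $\boldsymbol f(x,y)$ is quasi-homogeneous of type $(p,q)$ and degree $k$ if for all $\lambda>0$ $$\boldsymbol f(\lambda^px,\lambda^qy)=\begin{pmatrix}\lambda^{k+p}&0\\ 0&\lambda^{k+q}\end{pmatrix}\boldsymbol f(x,y).$$ *)

(* Defs.v *)
From Stdlib Require Import Reals.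
From Coquelicot Require Import Coquelicot.
Open Scope R_scope.

(* Everything is local at O = (0,0): functions are total on R x R, and
   [locally_2d P 0 0] says that P holds on some square ]-d, d[ x ]-d, d[. *)

(* A function is real analytic near O iff it is, near O, the sum of an
   absolutely convergent double power series (grouped here by total degree). *)
Definition analytic (f : R -> R -> R) : Prop :=
  exists a : nat -> nat -> R,
    locally_2d (fun x y =>
      ex_series (fun n =>
        sum_n (fun i => Rabs (a i (n - i)%nat * x ^ i * y ^ (n - i))) n) /\
      is_series (fun n =>
        sum_n (fun i => a i (n - i)%nat * x ^ i * y ^ (n - i)) n) (f x y)) 0 0.

Definition dist0 (x y : R) : R := sqrt (x ^ 2 + y ^ 2).

Definition little_o (f : R -> R -> R) : Prop :=
  forall eps, 0 < eps ->
    locally_2d (fun u v => Rabs (f u v) <= eps * dist0 u v) 0 0.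

(* Piecewise functions.  For vector fields and time scalings the value on v = 0
   is never used; for admissible homeomorphisms the two branches agree there. *)
Definition glue (fp fm : R -> R -> R) (u v : R) : R :=
  if Rle_dec 0 v then fp u v else fm u v.

(* (vx, vy) is an admissible velocity at (x,y): the field itself off y = 0, and
   Filippov's convex combinations on y = 0. *)
Definition velocity (Xp Yp Xm Ym : R -> R -> R) (x y vx vy : R) : Prop :=
  (0 < y -> vx = Xp x y /\ vy = Yp x y) /\
  (y < 0 -> vx = Xm x y /\ vy = Ym x y) /\
  (y = 0 -> exists s, 0 <= s <= 1 /\
     vx = s * Xp x y + (1 - s) * Xm x y /\
     vy = s * Yp x y + (1 - s) * Ym x y).

(* An orbit on the open interval ]a, b[: a continuous curve that is a solution
   except at isolated times, i.e. a locally finite concatenation of orbit arcs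
   of the subsystems (and of sliding arcs, if there are any). *)
Definition orbit (Xp Yp Xm Ym : R -> R -> R) (a b : Rbar) (x y : R -> R) : Prop :=
  forall t : R, Rbar_lt a t -> Rbar_lt t b ->
    continuous x t /\ continuous y t /\
    locally' t (fun s => exists vx vy,
      is_derive x s vx /\ is_derive y s vy /\
      velocity Xp Yp Xm Ym (x s) (y s) vx vy).

(* Here T is p_infty or m_infty.  The equilibrium O itself is not an orbit
   approaching O. *)
Definition approaches_in_direction (x y : R -> R) (T : Rbar) : Prop :=
  Rbar_locally' T (fun t => (x t, y t) <> (0, 0)) /\
  is_lim x T 0 /\ is_lim y T 0 /\
  exists c s : R,
    is_lim (fun t => x t / dist0 (x t) (y t)) T c /\
    is_lim (fun t => y t / dist0 (x t) (y t)) T s.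

Definition monodromic (Xp Yp Xm Ym : R -> R -> R) : Prop :=
  forall x y : R -> R,
    (forall a : R, orbit Xp Yp Xm Ym a p_infty x y ->
       ~ approaches_in_direction x y p_infty) /\
    (forall b : R, orbit Xp Yp Xm Ym m_infty b x y ->
       ~ approaches_in_direction x y m_infty).

(* Orbits close to O make full turns around O, in the positive sense, while
   staying close to O; they consist of arcs of the two subsystems only, so y
   vanishes at isolated times.  th is a continuous polar angle along the
   orbit. *)
Definition rotates_counterclockwise (Xp Yp Xm Ym : R -> R -> R) : Prop :=
  forall eps, 0 < eps -> exists delta, 0 < delta /\
    forall x0 y0, 0 < dist0 x0 y0 < delta ->
    exists (a T b : R) (x y th : R -> R),
      a < 0 < T /\ T < b /\
      orbit Xp Yp Xm Ym a b x y /\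
      x 0 = x0 /\ y 0 = y0 /\
      (forall t, a < t < b ->
         locally' t (fun s => y s <> 0) /\
         0 < dist0 (x t) (y t) < eps /\
         continuous th t /\
         x t = dist0 (x t) (y t) * cos (th t) /\
         y t = dist0 (x t) (y t) * sin (th t)) /\
      th T = th 0 + 2 * PI.

Definition eigenvalue2 (a b c d : R) (mu : C) : Prop :=
  exists v w : C, (v, w) <> (RtoC 0, RtoC 0) /\
    (RtoC a * v + RtoC b * w = mu * v)%C /\
    (RtoC c * v + RtoC d * w = mu * w)%C.

Definition focus_type (X Y : R -> R -> R) : Prop :=
  X 0 0 = 0 /\ Y 0 0 = 0 /\
  let a := Derive (fun x => X x 0) 0 in
  let b := Derive (fun y => X 0 y) 0 in
  let c := Derive (fun x => Y x 0) 0 in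
  let d := Derive (fun y => Y 0 y) 0 in
  exists alpha beta : R, beta <> 0 /\
    eigenvalue2 a b c d (alpha, beta) /\ eigenvalue2 a b c d (alpha, - beta).

Definition tangency (X Y : R -> R -> R) (l : nat) : Prop :=
  (1 <= l)%nat /\ X 0 0 <> 0 /\
  forall j, (j <= 2 * l - 2)%nat -> Derive_n (fun x => Y x 0) j 0 = 0.

Definition upper_parabolic_type (X Y : R -> R -> R) : Prop :=
  exists l, tangency X Y l /\
    X 0 0 * Derive_n (fun x => Y x 0) (2 * l - 1) 0 < 0.

Definition lower_parabolic_type (X Y : R -> R -> R) : Prop :=
  exists l, tangency X Y l /\
    X 0 0 * Derive_n (fun x => Y x 0) (2 * l - 1) 0 > 0.

Definition FF_type (Xp Yp Xm Ym : R -> R -> R) : Prop :=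
  focus_type Xp Yp /\ focus_type Xm Ym.

Definition FP_type (Xp Yp Xm Ym : R -> R -> R) : Prop :=
  focus_type Xp Yp /\ lower_parabolic_type Xm Ym.

Definition PP_type (Xp Yp Xm Ym : R -> R -> R) : Prop :=
  upper_parabolic_type Xp Yp /\ lower_parabolic_type Xm Ym.

Definition local_homeomorphism (h : R * R -> R * R) : Prop :=
  exists (g : R * R -> R * R) (U V : R * R -> Prop),
    open U /\ open V /\ U (0, 0) /\ V (0, 0) /\
    (forall p, U p -> V (h p) /\ g (h p) = p /\ continuous h p) /\
    (forall p, V p -> U (g p) /\ h (g p) = p /\ continuous g p).

Record branch := Branch {
  q1 : R; q2 : R; Phi : R -> R -> R; Psi : R -> R -> R }.

Definition branch_x (h : branch) (u v : R) : R := u + q2 h * v + Phi h u v.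
Definition branch_y (h : branch) (u v : R) : R := q1 h * v + Psi h u v.

Definition glue_x (hp hm : branch) : R -> R -> R :=
  glue (branch_x hp) (branch_x hm).
Definition glue_y (hp hm : branch) : R -> R -> R :=
  glue (branch_y hp) (branch_y hm).

Definition regular_branch (h : branch) : Prop :=
  analytic (Phi h) /\ analytic (Psi h) /\
  little_o (Phi h) /\ little_o (Psi h).

Definition admissible_homeomorphism (hp hm : branch) : Prop :=
  0 < q1 hp * q1 hm /\
  regular_branch hp /\ regular_branch hm /\
  locally (0 : R) (fun u => Phi hp u 0 = Phi hm u 0 /\
                            Psi hp u 0 = 0 /\ Psi hm u 0 = 0) /\
  local_homeomorphism
    (fun p => (glue_x hp hm (fst p) (snd p), glue_y hp hm (fst p) (snd p))).

Definition admissible_scaling (tau : R -> R -> R) : Prop :=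
  analytic tau /\ locally_2d (fun u v => 0 < tau u v) 0 0.

(* tau * (Dh)^-1 * Z(h) at (u,v), with h = (h1,h2) and Z = (X,Y); the inverse of
   the Jacobian matrix is written out as adjugate over determinant. *)
Definition transformed_field (h1 h2 tau X Y : R -> R -> R) (u v : R) : R * R :=
  let a := Derive (fun s => h1 s v) u in
  let b := Derive (fun s => h1 u s) v in
  let c := Derive (fun s => h2 s v) u in
  let d := Derive (fun s => h2 u s) v in
  let det := a * d - b * c in
  let P := X (h1 u v) (h2 u v) in
  let Q := Y (h1 u v) (h2 u v) in
  (tau u v * ((d * P - b * Q) / det), tau u v * ((a * Q - c * P) / det)).

Definition transformable_into (Xp Yp Xm Ym : R -> R -> R)
    (Fp Fm : R -> R -> R * R) : Prop :=
  exists (hp hm : branch) (taup taum : R -> R -> R),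
    admissible_homeomorphism hp hm /\
    admissible_scaling taup /\ admissible_scaling taum /\
    let Z' := transformed_field (glue_x hp hm) (glue_y hp hm) (glue taup taum)
                (glue Xp Xm) (glue Yp Ym) in
    locally_2d (fun u v => (0 < v -> Z' u v = Fp u v) /\
                           (v < 0 -> Z' u v = Fm u v)) 0 0.

Definition polynomial2 (f : R -> R -> R) : Prop :=
  exists (n : nat) (a : nat -> nat -> R), forall x y,
    f x y = sum_n (fun i => sum_n (fun j => a i j * x ^ i * y ^ j) n) n.

Definition polynomial_field (f : R -> R -> R * R) : Prop :=
  polynomial2 (fun x y => fst (f x y)) /\ polynomial2 (fun x y => snd (f x y)).

(* Both components are homogeneous of degree k; this is quasi-homogeneity of
   type (1,1) and degree k - 1. *)
Definition homogeneous (k : nat) (f : R -> R -> R * R) : Prop :=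
  forall lam x y, 0 < lam ->
    fst (f (lam * x) (lam * y)) = lam ^ k * fst (f x y) /\
    snd (f (lam * x) (lam * y)) = lam ^ k * snd (f x y).

Definition quasi_homogeneous (p q k : nat) (f : R -> R -> R * R) : Prop :=
  forall lam x y, 0 < lam ->
    fst (f (lam ^ p * x) (lam ^ q * y)) = lam ^ (k + p) * fst (f x y) /\
    snd (f (lam ^ p * x) (lam ^ q * y)) = lam ^ (k + q) * snd (f x y).

(* F is real analytic near O and is there the sum of polynomial vector fields
   f k, k >= n, with f k of degree k in the sense of hom. *)
Definition convergent_sum (hom : nat -> (R -> R -> R * R) -> Prop) (n : nat)
    (F : R -> R -> R * R) : Prop :=
  analytic (fun x y => fst (F x y)) /\ analytic (fun x y => snd (F x y)) /\
  exists f : nat -> R -> R -> R * R,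
    (forall k, (n <= k)%nat -> polynomial_field (f k) /\ hom k (f k)) /\
    locally_2d (fun x y =>
      is_series (fun k => fst (f (n + k)%nat x y)) (fst (F x y)) /\
      is_series (fun k => snd (f (n + k)%nat x y)) (snd (F x y))) 0 0.

Definition homogeneous_remainder (n : nat) (G : R -> R -> R * R) : Prop :=
  convergent_sum homogeneous n G.

Definition quasi_homogeneous_remainder (l n : nat) (F : R -> R -> R * R) : Prop :=
  convergent_sum (quasi_homogeneous 1 (2 * l)) n F.

Definition focus_form (N : nat) (gamma : nat -> R) (G : R -> R -> R * R)
    (x y : R) : R * R :=
  (gamma 1%nat * x - y
     + sum_n_m (fun i => gamma (i + 1)%nat * y ^ i * x) 1 N + fst (G x y),
   x + gamma 1%nat * y
     + sum_n_m (fun i => gamma (i + 1)%nat * y ^ i * y) 1 N + snd (G x y)).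

Definition upper_parabolic_form (N l : nat) (sigma : nat -> R)
    (F : R -> R -> R * R) (x y : R) : R * R :=
  (- 1 + fst (F x y),
   x ^ (2 * l - 1)
     + sum_n_m (fun i => sigma (i + 1)%nat * x ^ (2 * l - 1 + i)) 1 N
     + snd (F x y)).

Definition lower_parabolic_form (l : nat) (F : R -> R -> R * R)
    (x y : R) : R * R :=
  (1 + fst (F x y), x ^ (2 * l - 1) + snd (F x y)).

(* Main.v *)
Require Import Defs.
From Stdlib Require Import Reals Lra Lia FunctionalExtensionality ClassicalEpsilon.
From Coquelicot Require Import Coquelicot.
Open Scope R_scope.

(** The remainders of the normal forms may be any analytic fields of
    sufficiently high order, so only finitely many terms have to be normalized.
    In each half plane one looks for a change [h], polynomial in [(u,v)], and an
    analytic time scaling for which the transformed field differs from the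
    target by an analytic field of the required weighted order. Such a field is
    automatically a convergent sum of (quasi-)homogeneous polynomial fields of
    the required degrees ([expansion_of_order]): lower components vanish one
    after the other because a component of weight [k] scales exactly like [l ^
    k]. The transformed field is analytic because the functions with finite
    weighted l1 norm of their coefficients form Banach algebras, which gives
    products, compositions and quotients ([pser_countable], [analytic_comp],
    [analytic_inv]).

    The terms of [h] are added degree by degree, not composed. Adding terms of
    one weight changes the defect between transformed and target field, in the
    lowest weight that matters, by a linear homological operator that depends
    only on the leading part of the field. The two half planes interact only
    through the common values of [h] on [v = 0].

    Parabolic type. As [X] does not vanish, only the slope [Y / X] matters, and
    time is chosen to make the first component constant. For the weights [(1, 2
    l)] the leading slope is [c x ^ (2 l - 1)]. Modifying the second component
    of [h] by multiples of [v] solves the homological equation in weight [w] up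
    to a multiple of [u ^ w] ([slope_homological]). In the lower half plane that
    multiple is removed by a term of [h] on [v = 0] ([slope_absorb_trace]); in
    the upper one the values of [h] on [v = 0] are then imposed, and the
    multiple becomes a coefficient of the normal form ([slope_absorb_sigma]).

    Focus type. After a linear change the field is multiplication by [g + i] on
    [u + i v] plus higher terms. A homogeneous term is a multiple of a power of
    [u - i v], modulo multiples of [u + i v] ([decomposition]). The first part
    is removed by a displacement [v (a + i b) (u - i v) ^ n]; the second is
    radial plus a multiple of the linear field, and the latter is a time
    scaling. A radial term is removed by a radial displacement up to a multiple
    of [v ^ n], the coefficient of the normal form ([radial_homological],
    [focus_homological]). All these displacements vanish on [v = 0], so that the
    values of [h] there can be imposed: those found for the other half plane in
    case FP, and [u] itself in case FF.

    The sense of rotation enters through signs only. A full turn contains a half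
    turn in each half plane, from one side of the [y] axis to the other
    ([half_turns]). Along it [x], and the cotangent [x / y], vary monotonically
    if [X], respectively the angular speed, has a constant sign, which excludes
    the wrong signs ([half_turn_speed], [half_turn_angle]). Hence the
    coefficients of [v] in the second components of both branches of [h] are
    positive, and the two branches, which agree on [v = 0], glue to a
    homeomorphism, a contraction perturbation of a piecewise linear one
    ([glue_local_homeomorphism]). *)


(** * Double series *)

(* Sums live in an abstract group; a difference of reals lets [ring] see the field. *)
Ltac ring_sum := apply Rminus_diag_uniq; ring.

Lemma sumS (u : nat -> R) n : sum_n u (S n) = sum_n u n + u (S n).
Proof. exact (sum_Sn u n). Qed.

Lemma sum0 (u : nat -> R) : sum_n u 0 = u 0%nat.
Proof. exact (sum_O u). Qed.

Lemma sum_le (u w : nat -> R) n :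
  (forall i, (i <= n)%nat -> u i <= w i) -> sum_n u n <= sum_n w n.
Proof.
  induction n as [|n IH]; intros H.
  - rewrite !sum0. apply H. lia.
  - rewrite !sumS. assert (u (S n) <= w (S n)) by (apply H; lia).
    assert (sum_n u n <= sum_n w n) by (apply IH; intros; apply H; lia). lra.
Qed.

Lemma sum_ext (u w : nat -> R) n :
  (forall i, (i <= n)%nat -> u i = w i) -> sum_n u n = sum_n w n.
Proof. intros H. apply sum_n_ext_loc. exact H. Qed.

Lemma sum_nonneg (u : nat -> R) n : (forall i, 0 <= u i) -> 0 <= sum_n u n.
Proof.
  intros H. induction n as [|n IH]; [rewrite sum0; apply H|].
  rewrite sumS. specialize (H (S n)). lra.
Qed.

Lemma sum_scal c (u : nat -> R) n : sum_n (fun i => c * u i) n = c * sum_n u n.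
Proof.
  induction n as [|n IH]; [rewrite !sum0; reflexivity|]. rewrite !sumS, IH. ring_sum.
Qed.

Lemma sum_add (u w : nat -> R) n :
  sum_n (fun i => u i + w i) n = sum_n u n + sum_n w n.
Proof.
  induction n as [|n IH]; [rewrite !sum0; reflexivity|]. rewrite !sumS, IH. ring_sum.
Qed.

Lemma sum_abs (u : nat -> R) n : Rabs (sum_n u n) <= sum_n (fun i => Rabs (u i)) n.
Proof.
  induction n as [|n IH]; [rewrite !sum0; lra|]. rewrite !sumS.
  eapply Rle_trans; [apply Rabs_triang|]. lra.
Qed.

Lemma sum_swap (a : nat -> nat -> R) n m :
  sum_n (fun i => sum_n (a i) m) n = sum_n (fun j => sum_n (fun i => a i j) n) m.
Proof. exact (sum_n_switch a n m). Qed.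

Lemma sum_mono (u : nat -> R) n m :
  (forall i, 0 <= u i) -> (n <= m)%nat -> sum_n u n <= sum_n u m.
Proof.
  intros H. induction 1 as [|m _ IH]; [lra|]. rewrite sumS. specialize (H (S m)). lra.
Qed.

Lemma term_le_sum (u : nat -> R) n i :
  (forall i, 0 <= u i) -> (i <= n)%nat -> u i <= sum_n u n.
Proof.
  intros H Hi. eapply Rle_trans; [|apply (sum_mono u i n); auto].
  destruct i; [rewrite sum0; lra|]. rewrite sumS.
  assert (0 <= sum_n u i) by (apply sum_nonneg; auto). lra.
Qed.

Lemma sum_zero (u : nat -> R) n : (forall i, (i <= n)%nat -> u i = 0) -> sum_n u n = 0.
Proof.
  induction n as [|n IH]; intros H; [rewrite sum0; apply H; lia|].
  rewrite sumS, IH, H by (intros; try apply H; lia). ring_sum.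
Qed.

Lemma series_bounded (u : nat -> R) B :
  (forall n, 0 <= u n) -> (forall n, sum_n u n <= B) -> ex_series u /\ Series u <= B.
Proof.
  intros H0 HB.
  assert (Hx : ex_finite_lim_seq (sum_n u)).
  { apply (ex_finite_lim_seq_incr _ B); auto. intros n. rewrite sumS.
    specialize (H0 (S n)). lra. }
  destruct Hx as [l Hl]. split.
  - exists l. exact Hl.
  - rewrite (is_series_unique u l Hl).
    apply (is_lim_seq_le (sum_n u) (fun _ => B) l B HB Hl (is_lim_seq_const B)).
Qed.

Lemma sum_le_series (u : nat -> R) n :
  (forall n, 0 <= u n) -> ex_series u -> sum_n u n <= Series u.
Proof.
  intros H0 [l Hl]. rewrite (is_series_unique u l Hl).
  apply (is_lim_seq_incr_compare (sum_n u) l Hl). intros k. rewrite sumS.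
  specialize (H0 (S k)). lra.
Qed.

Lemma series_of_sum (a : nat -> nat -> R) n :
  (forall i, ex_series (a i)) ->
  is_series (fun j => sum_n (fun i => a i j) n) (sum_n (fun i => Series (a i)) n).
Proof.
  intros H. induction n as [|n IH].
  - rewrite sum0. apply (is_series_ext (a 0%nat)).
    + intros j. rewrite sum0. reflexivity.
    + apply Series_correct, H.
  - rewrite sumS. apply (is_series_ext (fun j => sum_n (fun i => a i j) n + a (S n) j)).
    + intros j. rewrite sumS. reflexivity.
    + apply (is_series_plus (fun j => sum_n (fun i => a i j) n) (a (S n))); auto.
      apply Series_correct, H.
Qed.

(** Absolute summability of a double family, as a bound on rectangular partial
    sums: this form is visibly symmetric and stable under finite regrouping. *)
Definition bdd2 (a : nat -> nat -> R) (B : R) : Prop :=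
  forall n m, sum_n (fun i => sum_n (fun j => Rabs (a i j)) m) n <= B.

Lemma bdd2_swap a B : bdd2 a B -> bdd2 (fun i j => a j i) B.
Proof.
  intros H n m. rewrite (sum_swap (fun i j => Rabs (a j i))). apply H.
Qed.

Lemma bdd2_le a b B : bdd2 b B -> (forall i j, Rabs (a i j) <= Rabs (b i j)) -> bdd2 a B.
Proof.
  intros H Hab n m. eapply Rle_trans; [|apply (H n m)].
  apply sum_le; intros; apply sum_le; intros; apply Hab.
Qed.

Lemma bdd2_ge0 a B : bdd2 a B -> 0 <= B.
Proof.
  intros H. specialize (H 0%nat 0%nat). rewrite !sum0 in H.
  pose proof (Rabs_pos (a 0%nat 0%nat)). lra.
Qed.

Lemma bdd2_row a B i : bdd2 a B -> ex_series (fun j => Rabs (a i j)).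
Proof.
  intros H. apply (series_bounded _ B); [intros; apply Rabs_pos|].
  intros n. eapply Rle_trans; [|apply (H i n)].
  apply (term_le_sum (fun i => sum_n (fun j => Rabs (a i j)) n) i i); [|lia].
  intros k. apply sum_nonneg. intros; apply Rabs_pos.
Qed.

Lemma bdd2_rowsums a B : bdd2 a B ->
  ex_series (fun i => Series (fun j => Rabs (a i j))) /\
  Series (fun i => Series (fun j => Rabs (a i j))) <= B.
Proof.
  intros H. apply series_bounded.
  - intros i. rewrite <- (Rmult_0_l 0).
    eapply Rle_trans; [|apply (sum_le_series _ 0%nat);
       [intros; apply Rabs_pos | eapply bdd2_row; eauto]].
    rewrite sum0, Rmult_0_l. apply Rabs_pos.
  - intros n.
    pose proof (series_of_sum (fun i j => Rabs (a i j)) n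
                  (fun i => bdd2_row a B i H)) as Hs.
    rewrite <- (is_series_unique _ _ Hs). apply series_bounded.
    + intros j. apply sum_nonneg. intros; apply Rabs_pos.
    + intros m. rewrite <- (sum_swap (fun i j => Rabs (a i j))). apply H.
Qed.

Lemma ex_series_abs (u : nat -> R) : ex_series (fun n => Rabs (u n)) -> ex_series u.
Proof. intros H. apply ex_series_Rabs, H. Qed.

Lemma bdd2_abs_rowsums a B : bdd2 a B ->
  ex_series (fun i => Rabs (Series (a i))) /\
  Rabs (Series (fun i => Series (a i))) <= B /\
  (forall n, sum_n (fun i => Rabs (Series (a i))) n <= B).
Proof.
  intros H. destruct (bdd2_rowsums a B H) as [He Hb].
  assert (Hle : forall i, Rabs (Series (a i)) <= Series (fun j => Rabs (a i j))).
  { intros i. apply Series_Rabs. eapply bdd2_row; eauto. }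
  assert (Hx : ex_series (fun i => Rabs (Series (a i)))).
  { apply (ex_series_le (fun i => Rabs (Series (a i)))
             (fun i => Series (fun j => Rabs (a i j)))); auto.
    intros i. unfold norm; simpl. unfold abs; simpl. rewrite Rabs_Rabsolu. apply Hle. }
  assert (Hs : Series (fun i => Rabs (Series (a i))) <= B).
  { eapply Rle_trans; [|apply Hb]. apply Series_le; auto.
    intros i. split; [apply Rabs_pos|apply Hle]. }
  split; [exact Hx|]. split.
  - eapply Rle_trans; [apply Series_Rabs; exact Hx|exact Hs].
  - intros n. eapply Rle_trans; [|exact Hs]. apply sum_le_series; auto.
    intros; apply Rabs_pos.
Qed.

Lemma fubini_le a B : bdd2 a B -> (forall i j, 0 <= a i j) ->
  Series (fun i => Series (a i)) <= Series (fun j => Series (fun i => a i j)).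
Proof.
  intros H H0.
  assert (Habs : (fun i j => Rabs (a i j)) = a).
  { do 2 (apply functional_extensionality; intro). apply Rabs_pos_eq, H0. }
  assert (Hr : forall i, ex_series (a i)).
  { intros i. apply ex_series_abs. eapply bdd2_row; eauto. }
  assert (Hc : forall j, ex_series (fun i => a i j)).
  { intros j. apply ex_series_abs. apply (bdd2_row (fun j i => a i j) B j).
    apply bdd2_swap, H. }
  assert (Hp : forall (u : nat -> R), (forall n, 0 <= u n) -> ex_series u -> 0 <= Series u).
  { intros u Hu He. eapply Rle_trans; [|apply (sum_le_series u 0%nat); auto].
    rewrite sum0. apply Hu. }
  apply series_bounded; [intros; apply Hp; auto|].
  intros n.
  rewrite <- (is_series_unique _ _ (series_of_sum a n Hr)).
  apply Series_le.
  - intros j. split; [apply sum_nonneg; intros; apply H0|].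
    apply sum_le_series; auto.
  - destruct (bdd2_rowsums _ _ (bdd2_swap _ _ H)) as [He _].
    eapply ex_series_ext; [|exact He]. intros j. simpl. apply Series_ext.
    intros i. apply Rabs_pos_eq, H0.
Qed.

(** The signed case reduces to the nonnegative one by writing [a] as the difference
    of [a + |a|] and [|a|]. *)
Lemma fubini a B : bdd2 a B ->
  Series (fun i => Series (a i)) = Series (fun j => Series (fun i => a i j)).
Proof.
  assert (Hpos : forall b B, bdd2 b B -> (forall i j, 0 <= b i j) ->
     Series (fun i => Series (b i)) = Series (fun j => Series (fun i => b i j))).
  { intros b C Hb H0. apply Rle_antisym.
    - eapply fubini_le; eauto.
    - apply (fubini_le (fun i j => b j i) C); auto. apply bdd2_swap, Hb. }
  intros H.
  set (p := fun i j => a i j + Rabs (a i j)).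
  set (m := fun i j => Rabs (a i j)).
  assert (Hm : bdd2 m B).
  { apply (bdd2_le m a B H). intros. unfold m. rewrite Rabs_Rabsolu. lra. }
  assert (Hm0 : forall i j, 0 <= m i j) by (intros; apply Rabs_pos).
  assert (Hp0 : forall i j, 0 <= p i j).
  { intros. unfold p. pose proof (Rle_abs (- a i j)). rewrite Rabs_Ropp in H0. lra. }
  assert (Hp : bdd2 p (2 * B)).
  { intros n k.
    apply Rle_trans with (sum_n (fun i => 2 * sum_n (fun j => Rabs (a i j)) k) n).
    - apply sum_le. intros i _. rewrite <- sum_scal. apply sum_le. intros j _.
      unfold p. rewrite Rabs_pos_eq by apply Hp0. pose proof (Rle_abs (a i j)). lra.
    - rewrite sum_scal. specialize (H n k). lra. }
  assert (E : forall (b : nat -> nat -> R) C D,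
    bdd2 (fun i j => b i j + Rabs (b i j)) C -> bdd2 (fun i j => Rabs (b i j)) D ->
    Series (fun i => Series (b i)) =
    Series (fun i => Series (fun j => b i j + Rabs (b i j))) -
    Series (fun i => Series (fun j => Rabs (b i j)))).
  { intros b C D HC HD.
    rewrite <- Series_minus.
    - apply Series_ext. intros i. rewrite <- Series_minus.
      + apply Series_ext. intros j. ring.
      + apply ex_series_abs. apply (bdd2_row _ _ i HC).
      + apply ex_series_abs. apply (bdd2_row _ _ i HD).
    - apply ex_series_abs. apply (bdd2_abs_rowsums _ _ HC).
    - apply ex_series_abs. apply (bdd2_abs_rowsums _ _ HD). }
  rewrite (E a _ _ Hp Hm).
  rewrite (E (fun j i => a i j) _ _ (bdd2_swap _ _ Hp) (bdd2_swap _ _ Hm)).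
  pose proof (Hpos _ _ Hp Hp0) as E1. pose proof (Hpos _ _ Hm Hm0) as E2.
  unfold p in E1. unfold m in E2. rewrite E1, E2. reflexivity.
Qed.

Lemma small_radius d e C : 0 < d -> 0 < e -> 0 <= C -> exists r, 0 < r <= d /\ C * r < e.
Proof.
  intros Hd He HC. assert (Hq : 0 < e / (C + 1)) by (apply Rdiv_lt_0_compat; lra).
  assert (Hr : 0 < Rmin d (e / (C + 1))) by (apply Rmin_glb_lt; lra).
  exists (Rmin d (e / (C + 1))). split; [split; [exact Hr|apply Rmin_l]|].
  assert ((C + 1) * Rmin d (e / (C + 1)) <= e); [|lra].
  apply Rle_trans with ((C + 1) * (e / (C + 1))); [|right; field; lra].
  apply Rmult_le_compat_l; [lra|apply Rmin_r].
Qed.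

Lemma vanishing x K d : 0 < d -> (forall l, 0 < l <= d -> Rabs x <= K * l) -> x = 0.
Proof.
  intros Hd H. destruct (Req_dec x 0) as [E|E]; auto. exfalso.
  assert (Hx := Rabs_pos_lt _ E).
  destruct (small_radius d (Rabs x) (Rabs K) Hd Hx (Rabs_pos K)) as [l [Hl Hl2]].
  specialize (H l Hl). assert (K * l <= Rabs K * l) by (apply Rmult_le_compat_r; [lra|apply Rle_abs]).
  lra.
Qed.

(** * Power series as a Banach algebra *)

Lemma sum_shift1 (u : nat -> R) n : sum_n u (S n) = u 0%nat + sum_n (fun i => u (S i)) n.
Proof.
  induction n as [|n IH].
  - rewrite sumS, !sum0. reflexivity.
  - rewrite (sumS u (S n)), IH, sumS. ring_sum.
Qed.

Lemma sum_rev (u : nat -> R) n : sum_n (fun i => u (n - i)%nat) n = sum_n u n.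
Proof.
  induction n as [|n IH]; [rewrite !sum0; reflexivity|].
  rewrite sum_shift1, sumS, <- IH, Nat.sub_0_r.
  rewrite (sum_ext (fun i => u (S n - S i)%nat) (fun i => u (n - i)%nat)).
  - ring_sum.
  - intros i _. f_equal.
Qed.

Definition shift (s : nat) (u : nat -> R) (k : nat) : R :=
  if Nat.leb s k then u (k - s)%nat else 0.

Lemma shift_lt s u k : (k < s)%nat -> shift s u k = 0.
Proof. intros H. unfold shift. destruct (Nat.leb_spec s k); [lia|reflexivity]. Qed.

Lemma shift_ge s u k : shift s u (k + s) = u k.
Proof.
  unfold shift. destruct (Nat.leb_spec s (k + s)); [f_equal; lia|lia].
Qed.

Lemma sum_shift_lt s u k : (k < s)%nat -> sum_n (shift s u) k = 0.
Proof. intros H. apply sum_zero. intros i Hi. apply shift_lt. lia. Qed.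

Lemma sum_shift s u k : sum_n (shift s u) (k + s) = sum_n u k.
Proof.
  induction k as [|k IH].
  - rewrite sum0. simpl. destruct s.
    + rewrite sum0. apply (shift_ge 0 u 0).
    + rewrite sumS, sum_shift_lt by lia. rewrite <- (shift_ge (S s) u 0). simpl. ring_sum.
  - simpl. rewrite !sumS, IH. f_equal. apply (shift_ge s u (S k)).
Qed.

Lemma shift_is_series s u l : is_series u l -> is_series (shift s u) l.
Proof.
  intros H. apply (is_lim_seq_incr_n (sum_n (shift s u)) s l).
  apply (is_lim_seq_ext (sum_n u)); [|exact H].
  intros n. symmetry. apply sum_shift.
Qed.

Lemma shift_Rabs s u k : Rabs (shift s u k) = shift s (fun i => Rabs (u i)) k.
Proof. unfold shift. destruct (Nat.leb s k); [reflexivity|apply Rabs_R0]. Qed.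

Lemma shift_pos s u k : (forall i, 0 <= u i) -> 0 <= shift s u k.
Proof. intros H. unfold shift. destruct (Nat.leb s k); [apply H|lra]. Qed.

Lemma finite_series (u : nat -> R) n :
  (forall i, (n < i)%nat -> u i = 0) -> is_series u (sum_n u n).
Proof.
  intros H. change (is_lim_seq (sum_n u) (Finite (sum_n u n))).
  apply (is_lim_seq_ext_loc (fun _ => sum_n u n)).
  - exists n. intros m Hm. induction Hm as [|m Hm IH]; [reflexivity|].
    rewrite sumS, <- IH, (H (S m)) by lia. ring_sum.
  - apply is_lim_seq_const.
Qed.

(** Rearrangement by weight, [i] having weight 1 and [j] weight [q]: for [1 <= q]
    each row [k] is finitely supported, hence a polynomial of weight [k]. *)
Definition regroup (q : nat) (a : nat -> nat -> R) (k j : nat) : R :=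
  shift (q * j) (fun i => a i j) k.

Lemma regroup_bdd q a B : bdd2 a B -> bdd2 (regroup q a) B.
Proof.
  intros H n m. rewrite (sum_swap (fun k j => Rabs (regroup q a k j))).
  eapply Rle_trans; [|apply (bdd2_swap _ _ H m n)].
  apply sum_le. intros j _. simpl.
  rewrite (sum_ext _ (shift (q * j) (fun i => Rabs (a i j)))).
  2:{ intros k _. apply shift_Rabs. }
  rewrite <- (sum_shift (q * j) (fun i => Rabs (a i j)) n).
  apply sum_mono; [|lia]. intros k. apply shift_pos. intros; apply Rabs_pos.
Qed.

Lemma regroup_bdd_inv q a B : bdd2 (regroup q a) B -> bdd2 a B.
Proof.
  intros H n m. rewrite (sum_swap (fun k j => Rabs (a k j))).
  eapply Rle_trans; [|apply (bdd2_swap _ _ H m (n + q * m)%nat)].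
  apply sum_le. intros j Hj. simpl.
  rewrite (sum_ext (fun i => Rabs (regroup q a i j)) (shift (q * j) (fun i => Rabs (a i j)))).
  2:{ intros k _. apply shift_Rabs. }
  rewrite <- (sum_shift (q * j) (fun i => Rabs (a i j)) n).
  apply sum_mono; [|nia]. intros k. apply shift_pos. intros; apply Rabs_pos.
Qed.

Lemma regroup_support q a k j : (1 <= q)%nat -> (k < j)%nat -> regroup q a k j = 0.
Proof. intros Hq Hj. apply shift_lt. nia. Qed.

Lemma regroup_series q a B : (1 <= q)%nat -> bdd2 a B ->
  ex_series (fun k => sum_n (fun j => Rabs (regroup q a k j)) k) /\
  is_series (fun k => sum_n (regroup q a k) k) (Series (fun i => Series (a i))).
Proof.
  intros Hq H. pose proof (regroup_bdd q a B H) as Hb.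
  assert (Hrow : forall k, Series (regroup q a k) = sum_n (regroup q a k) k).
  { intros k. apply is_series_unique, finite_series. intros; apply regroup_support; auto. }
  split.
  - apply (series_bounded _ B).
    + intros; apply sum_nonneg; intros; apply Rabs_pos.
    + intros n. eapply Rle_trans; [|apply (Hb n n)].
      apply sum_le. intros k Hk. apply sum_mono; auto. intros; apply Rabs_pos.
  - apply (is_series_ext (fun k => Series (regroup q a k))); [exact Hrow|].
    rewrite (fubini a B H).
    replace (Series (fun j => Series (fun i => a i j)))
      with (Series (fun k => Series (regroup q a k))).
    + apply Series_correct, ex_series_abs. apply (bdd2_abs_rowsums _ _ Hb).
    + rewrite (fubini _ B Hb). apply Series_ext. intros j.
      apply is_series_unique, shift_is_series, Series_correct, ex_series_abs.
      apply (bdd2_row _ _ j (bdd2_swap _ _ H)).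
Qed.

Definition term (a : nat -> nat -> R) (x y : R) (i j : nat) : R := a i j * x ^ i * y ^ j.

Definition psum (a : nat -> nat -> R) (x y : R) : R :=
  Series (fun i => Series (term a x y i)).

(** Sum on the square of half-side [r] of a double power series whose weighted l1
    norm is at most [B]. These norms make analytic functions a Banach algebra, so
    that products, compositions and quotients all come from countable sums with
    summable norms. *)
Definition pser (r B : R) (f : R -> R -> R) : Prop :=
  0 < r /\ exists a, bdd2 (term a r r) B /\
    forall x y, Rabs x <= r -> Rabs y <= r -> f x y = psum a x y.

Lemma pow_abs_le x r i : Rabs x <= r -> Rabs (x ^ i) <= Rabs (r ^ i).
Proof.
  intros H. rewrite <- !RPow_abs. apply pow_incr. split; [apply Rabs_pos|].
  eapply Rle_trans; [exact H|apply Rle_abs].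
Qed.

Lemma term_le a x y r i j : Rabs x <= r -> Rabs y <= r ->
  Rabs (term a x y i j) <= Rabs (term a r r i j).
Proof.
  intros Hx Hy. unfold term. rewrite !Rabs_mult.
  apply Rmult_le_compat; try apply Rmult_le_pos; try apply Rabs_pos.
  - apply Rmult_le_compat_l; [apply Rabs_pos|apply pow_abs_le, Hx].
  - apply pow_abs_le, Hy.
Qed.

Lemma term_bdd a r B x y : bdd2 (term a r r) B -> Rabs x <= r -> Rabs y <= r ->
  bdd2 (term a x y) B.
Proof. intros H Hx Hy. eapply bdd2_le; [exact H|]. intros; apply term_le; auto. Qed.

Lemma pser_le r B B' f : pser r B f -> B <= B' -> pser r B' f.
Proof.
  intros [Hr [a [Ha Hf]]] HB. split; auto. exists a. split; auto.
  intros n m. eapply Rle_trans; [apply Ha|exact HB].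
Qed.

Lemma pser_ext r B f g : pser r B f ->
  (forall x y, Rabs x <= r -> Rabs y <= r -> g x y = f x y) -> pser r B g.
Proof.
  intros [Hr [a [Ha Hf]]] Hg. split; auto. exists a. split; auto.
  intros; rewrite Hg; auto.
Qed.

Lemma pser_bound r B f x y : pser r B f -> Rabs x <= r -> Rabs y <= r -> Rabs (f x y) <= B.
Proof.
  intros [Hr [a [Ha Hf]]] Hx Hy. rewrite Hf; auto.
  apply (bdd2_abs_rowsums _ B). eapply term_bdd; eauto.
Qed.

Lemma pser_pos r B f : pser r B f -> 0 <= B.
Proof. intros [Hr [a [Ha Hf]]]. eapply bdd2_ge0; eauto. Qed.

Lemma pser_swap r B f : pser r B f -> pser r B (fun x y => f y x).
Proof.
  intros [Hr [a [Ha Hf]]]. split; auto. exists (fun i j => a j i).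
  assert (E : forall x y, term (fun i j => a j i) x y = fun i j => term a y x j i).
  { intros. do 2 (apply functional_extensionality; intro). unfold term. ring. }
  split.
  - rewrite E. apply bdd2_swap, Ha.
  - intros x y Hx Hy. rewrite Hf by auto. unfold psum. rewrite E.
    apply (fubini _ B). eapply term_bdd; eauto.
Qed.

Lemma pser_scal r B c f : pser r B f -> pser r (Rabs c * B) (fun x y => c * f x y).
Proof.
  intros [Hr [a [Ha Hf]]]. split; auto. exists (fun i j => c * a i j).
  assert (E : forall x y i j, term (fun i j => c * a i j) x y i j = c * term a x y i j).
  { intros. unfold term. ring. }
  split.
  - intros n m.
    rewrite (sum_ext _ (fun i => Rabs c * sum_n (fun j => Rabs (term a r r i j)) m)).
    + rewrite sum_scal. apply Rmult_le_compat_l; [apply Rabs_pos|apply Ha].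
    + intros i _. rewrite <- sum_scal. apply sum_ext. intros j _.
      rewrite E. apply Rabs_mult.
  - intros x y Hx Hy. rewrite Hf by auto. unfold psum.
    rewrite <- Series_scal_l. apply Series_ext. intros i.
    rewrite <- Series_scal_l. apply Series_ext. intros j. symmetry. apply E.
Qed.

Lemma pser_const r c : 0 < r -> pser r (Rabs c) (fun _ _ => c).
Proof.
  intros Hr. split; auto.
  set (a := fun i j : nat => match i, j with O, O => c | _, _ => 0 end).
  assert (E0 : forall x y, term a x y 0 0 = c) by (intros; unfold term, a; simpl; ring).
  assert (E1 : forall x y i j, (0 < i \/ 0 < j)%nat -> term a x y i j = 0).
  { intros x y i j H. unfold term, a. destruct i, j; try lia; ring. }
  exists a. split.
  - intros n m.
    replace (Rabs c) with (sum_n (fun i => if Nat.eqb i 0 then Rabs c else 0) n).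
    + apply sum_le. intros i _. destruct i; simpl.
      * replace (Rabs c) with (sum_n (fun j => if Nat.eqb j 0 then Rabs c else 0) m).
        -- apply sum_le. intros j _. destruct j; simpl; [rewrite E0; lra|].
           rewrite E1 by lia. rewrite Rabs_R0. lra.
        -- induction m as [|m IH]; [apply sum0|]. rewrite sumS, IH. simpl. ring_sum.
      * right. apply sum_zero. intros j _. rewrite E1 by lia. apply Rabs_R0.
    + induction n as [|n IH]; [apply sum0|]. rewrite sumS, IH. simpl. ring_sum.
  - intros x y _ _. symmetry. unfold psum.
    replace c with (sum_n (fun i => Series (term a x y i)) 0).
    + apply is_series_unique, finite_series. intros i Hi.
      rewrite (is_series_unique _ _ (finite_series (term a x y i) 0 ltac:(intros; apply E1; lia))).
      rewrite sum0. apply E1. lia.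
    + rewrite sum0.
      rewrite (is_series_unique _ _ (finite_series (term a x y 0) 0 ltac:(intros; apply E1; lia))).
      rewrite sum0. apply E0.
Qed.

Lemma pser_mulx r B f : pser r B f -> pser r (r * B) (fun x y => x * f x y).
Proof.
  intros [Hr [a [Ha Hf]]]. split; auto.
  set (a' := fun i j : nat => match i with O => 0 | S i => a i j end).
  assert (E0 : forall x y j, term a' x y 0 j = 0) by (intros; unfold term, a'; ring).
  assert (E1 : forall x y i j, term a' x y (S i) j = x * term a x y i j).
  { intros. unfold term, a'. simpl. ring. }
  assert (HB := bdd2_ge0 _ _ Ha).
  exists a'. split.
  - intros n m. destruct n as [|n].
    + rewrite sum0. rewrite sum_zero; [nra|]. intros; rewrite E0; apply Rabs_R0.
    + rewrite sum_shift1. rewrite sum_zero, Rplus_0_l.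
      2:{ intros; rewrite E0; apply Rabs_R0. }
      rewrite (sum_ext _ (fun i => r * sum_n (fun j => Rabs (term a r r i j)) m)).
      * rewrite sum_scal. apply Rmult_le_compat_l; [lra|apply Ha].
      * intros i _. rewrite <- sum_scal. apply sum_ext. intros j _.
        rewrite E1, Rabs_mult, (Rabs_pos_eq r) by lra. reflexivity.
  - intros x y Hx Hy. rewrite Hf by auto. unfold psum.
    assert (S0 : Series (term a' x y 0) = 0).
    { rewrite (Series_ext _ (fun _ => 0 * 0)).
      - rewrite Series_scal_l. ring.
      - intros. rewrite E0. ring. }
    assert (S1 : forall i, Series (term a' x y (S i)) = x * Series (term a x y i)).
    { intros i. rewrite <- Series_scal_l. apply Series_ext, E1. }
    rewrite (Series_incr_1 (fun i => Series (term a' x y i))).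
    + cbv beta. rewrite S0, Rplus_0_l, <- Series_scal_l. apply Series_ext.
      intros i. rewrite S1. reflexivity.
    + apply ex_series_incr_1. apply (ex_series_ext (fun i => x * Series (term a x y i))).
      * intros; symmetry; apply S1.
      * apply (ex_series_scal_l x (fun i => Series (term a x y i))). apply ex_series_abs.
        apply (bdd2_abs_rowsums _ B). eapply term_bdd; eauto.
Qed.

Lemma pser_muly r B f : pser r B f -> pser r (r * B) (fun x y => y * f x y).
Proof.
  intros H. apply (pser_swap r _ (fun x y => x * f y x)). apply pser_mulx, pser_swap, H.
Qed.

Lemma series_of_sum2 (b : nat -> nat -> nat -> R) n m :
  (forall i j, ex_series (fun k => b k i j)) ->
  is_series (fun k => sum_n (fun i => sum_n (fun j => b k i j) m) n)
            (sum_n (fun i => sum_n (fun j => Series (fun k => b k i j)) m) n).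
Proof.
  intros H.
  assert (H1 : forall i, is_series (fun k => sum_n (fun j => b k i j) m)
                           (sum_n (fun j => Series (fun k => b k i j)) m)).
  { intros i. apply (series_of_sum (fun j k => b k i j) m). intros j. apply H. }
  rewrite (sum_ext _ (fun i => Series (fun k => sum_n (fun j => b k i j) m))).
  - apply (series_of_sum (fun i k => sum_n (fun j => b k i j) m) n).
    intros i. eexists. apply H1.
  - intros i _. symmetry. apply is_series_unique, H1.
Qed.

(** Completeness of the l1 norms: the coefficients are summed first, and Fubini
    moves the sum over [k] outside. *)
Lemma pser_countable r (B : nat -> R) C (f : nat -> R -> R -> R) F :
  (forall k, pser r (B k) (f k)) -> (forall n, sum_n B n <= C) ->
  (forall x y, Rabs x <= r -> Rabs y <= r -> F x y = Series (fun k => f k x y)) ->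
  pser r C F.
Proof.
  intros Hf HB HF. split; [apply (Hf 0%nat)|].
  assert (Hr : 0 < r) by apply (Hf 0%nat).
  set (a := fun k => proj1_sig (constructive_indefinite_description _ (proj2 (Hf k)))).
  assert (Ha : forall k, bdd2 (term (a k) r r) (B k) /\
     forall x y, Rabs x <= r -> Rabs y <= r -> f k x y = psum (a k) x y).
  { intros k. unfold a. apply proj2_sig. }
  clearbody a.
  assert (Hab : forall k x y n m, Rabs x <= r -> Rabs y <= r ->
     sum_n (fun i => sum_n (fun j => Rabs (term (a k) x y i j)) m) n <= B k).
  { intros k x y n m Hx Hy. apply (term_bdd (a k) r); auto. apply Ha. }
  assert (Habrow : forall k x y i m, Rabs x <= r -> Rabs y <= r ->
     sum_n (fun j => Rabs (term (a k) x y i j)) m <= B k).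
  { intros k x y i m Hx Hy. eapply Rle_trans; [|apply (Hab k x y i m Hx Hy)].
    apply (term_le_sum (fun i => sum_n (fun j => Rabs (term (a k) x y i j)) m)); auto.
    intros; apply sum_nonneg; intros; apply Rabs_pos. }
  assert (Habterm : forall k x y i j, Rabs x <= r -> Rabs y <= r ->
     Rabs (term (a k) x y i j) <= B k).
  { intros k x y i j Hx Hy. eapply Rle_trans; [|apply (Habrow k x y i j Hx Hy)].
    apply (term_le_sum (fun j => Rabs (term (a k) x y i j))); auto.
    intros; apply Rabs_pos. }
  assert (Hex : forall x y i j, Rabs x <= r -> Rabs y <= r ->
     ex_series (fun k => Rabs (term (a k) x y i j))).
  { intros x y i j Hx Hy. apply (series_bounded _ C); [intros; apply Rabs_pos|].
    intros n. eapply Rle_trans; [|apply (HB n)]. apply sum_le. intros; auto. }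
  set (A := fun i j => Series (fun k => a k i j)).
  assert (EA : forall x y i j, term A x y i j = Series (fun k => term (a k) x y i j)).
  { intros. unfold term, A. rewrite <- !Series_scal_r. reflexivity. }
  assert (Hrr : Rabs r <= r) by (rewrite Rabs_pos_eq; lra).
  exists A. split.
  - intros n m.
    apply Rle_trans with
      (sum_n (fun i => sum_n (fun j => Series (fun k => Rabs (term (a k) r r i j))) m) n).
    + apply sum_le; intros i _; apply sum_le; intros j _. rewrite EA.
      apply Series_Rabs. auto.
    + rewrite <- (is_series_unique _ _
        (series_of_sum2 (fun k i j => Rabs (term (a k) r r i j)) n m
           (fun i j => Hex r r i j Hrr Hrr))).
      apply series_bounded.
      * intros k. apply sum_nonneg; intros; apply sum_nonneg; intros; apply Rabs_pos.
      * intros K. eapply Rle_trans; [|apply (HB K)]. apply sum_le. intros; auto.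
  - intros x y Hx Hy. rewrite HF by auto.
    rewrite (Series_ext _ (fun k => Series (fun i => Series (term (a k) x y i)))).
    2:{ intros k. apply Ha; auto. }
    rewrite (fubini (fun k i => Series (term (a k) x y i)) C).
    + unfold psum. apply Series_ext. intros i.
      transitivity (Series (fun j => Series (fun k => term (a k) x y i j))).
      * apply (fubini (fun k j => term (a k) x y i j) C). intros K m. eapply Rle_trans; [|apply (HB K)]. apply sum_le. intros; auto.
      * apply Series_ext. intros j. symmetry. apply EA.
    + intros K n. eapply Rle_trans; [|apply (HB K)]. apply sum_le. intros k _.
      apply (bdd2_abs_rowsums _ (B k)). apply (term_bdd (a k) r); auto. apply Ha.
Qed.

Lemma pser_add r B C f g : pser r B f -> pser r C g ->
  pser r (B + C) (fun x y => f x y + g x y).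
Proof.
  intros Hf Hg. pose proof (pser_pos _ _ _ Hf). pose proof (pser_pos _ _ _ Hg).
  assert (Hr0 : 0 < r) by apply Hf.
  set (h := fun k : nat => match k with 0%nat => f | 1%nat => g | _ => fun _ _ => 0 end).
  set (D := fun k : nat => match k with 0%nat => B | 1%nat => C | _ => 0 end).
  apply (pser_countable r D (B + C) h).
  - intros [|[|k]]; simpl; auto. rewrite <- Rabs_R0 at 1. apply pser_const; auto.
  - intros n. destruct n as [|n]; [rewrite sum0; simpl; lra|].
    rewrite sum_shift1. destruct n as [|n]; [rewrite sum0; simpl; lra|].
    rewrite sum_shift1. rewrite sum_zero; [simpl; lra|]. intros; reflexivity.
  - intros x y _ _.
    rewrite (is_series_unique _ _ (finite_series (fun k => h k x y) 1
       ltac:(intros [|[|i]] Hi; [lia|lia|reflexivity]))).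
    rewrite sumS, sum0. reflexivity.
Qed.

Lemma pser_mul r B C f g : pser r B f -> pser r C g ->
  pser r (B * C) (fun x y => f x y * g x y).
Proof.
  intros [Hr [a [Ha Hf]]] Hg. pose proof (pser_pos _ _ _ Hg) as HC.
  set (n2 := fun i j => Rabs (term a r r i j) * C).
  assert (Hmon : forall i j, pser r (n2 i j) (fun x y => term a x y i j * g x y)).
  { intros i j. unfold n2, term. rewrite !Rabs_mult.
    rewrite (Rabs_pos_eq (r ^ i)), (Rabs_pos_eq (r ^ j)) by (apply pow_le; lra).
    assert (H1 : forall j, pser r (r ^ j * C) (fun x y => y ^ j * g x y)).
    { intros k. induction k as [|k IH]; simpl.
      - apply (pser_ext r (1 * C) g); [rewrite Rmult_1_l; auto|intros; ring].
      - rewrite Rmult_assoc. eapply pser_ext; [apply pser_muly, IH|]. intros; simpl; ring. }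
    assert (H2 : pser r (r ^ i * (r ^ j * C)) (fun x y => x ^ i * (y ^ j * g x y))).
    { induction i as [|i IH]; simpl.
      - eapply pser_ext; [rewrite Rmult_1_l; apply (H1 j)|]. intros; simpl; ring.
      - rewrite Rmult_assoc. eapply pser_ext; [apply pser_mulx, IH|]. intros; simpl; ring. }
    replace (Rabs (a i j) * r ^ i * r ^ j * C)
      with (Rabs (a i j) * (r ^ i * (r ^ j * C))) by ring.
    eapply pser_ext; [apply pser_scal, H2|]. intros; simpl; ring. }
  assert (Hrow : forall i, pser r (Series (fun j => Rabs (term a r r i j)) * C)
                              (fun x y => Series (term a x y i) * g x y)).
  { intros i. apply (pser_countable r (n2 i) _ (fun j x y => term a x y i j * g x y)).
    - intros j. apply Hmon.
    - intros n. unfold n2.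
      rewrite (sum_ext _ (fun j => C * Rabs (term a r r i j))) by (intros; ring).
      rewrite sum_scal, Rmult_comm. apply Rmult_le_compat_r; auto.
      apply sum_le_series; [intros; apply Rabs_pos|]. eapply bdd2_row; eauto.
    - intros x y _ _. rewrite Series_scal_r. reflexivity. }
  apply (pser_countable r (fun i => Series (fun j => Rabs (term a r r i j)) * C) (B * C)
           (fun i x y => Series (term a x y i) * g x y)).
  - exact Hrow.
  - intros n.
    rewrite (sum_ext _ (fun i => C * Series (fun j => Rabs (term a r r i j))))
      by (intros; ring).
    rewrite sum_scal, Rmult_comm. apply Rmult_le_compat_r; auto.
    destruct (bdd2_rowsums _ _ Ha) as [He Hb].
    eapply Rle_trans; [|exact Hb]. apply sum_le_series; auto.
    intros i. eapply Rle_trans; [|apply (sum_le_series _ 0%nat)].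
    + rewrite sum0. apply Rabs_pos.
    + intros; apply Rabs_pos.
    + eapply bdd2_row; eauto.
  - intros x y Hx Hy. rewrite Hf by auto. rewrite Series_scal_r. reflexivity.
Qed.

Lemma pser_pow r B f n : pser r B f -> pser r (B ^ n) (fun x y => f x y ^ n).
Proof.
  intros H. induction n as [|n IH]; simpl.
  - rewrite <- Rabs_R1 at 1. apply pser_const. apply H.
  - apply pser_mul; auto.
Qed.

Lemma pser_comp r s B f g1 g2 : pser s B f -> pser r s g1 -> pser r s g2 ->
  pser r B (fun x y => f (g1 x y) (g2 x y)).
Proof.
  intros [Hs [a [Ha Hf]]] H1 H2.
  assert (Hmon : forall i j, pser r (Rabs (term a s s i j))
                    (fun x y => term a (g1 x y) (g2 x y) i j)).
  { intros i j. unfold term. rewrite !Rabs_mult.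
    rewrite (Rabs_pos_eq (s ^ i)), (Rabs_pos_eq (s ^ j)) by (apply pow_le; lra).
    apply pser_mul; [|apply pser_pow; auto].
    apply (pser_scal r _ (a i j) (fun x y => g1 x y ^ i)). apply pser_pow; auto. }
  apply (pser_countable r (fun i => Series (fun j => Rabs (term a s s i j))) B
           (fun i x y => Series (term a (g1 x y) (g2 x y) i))).
  - intros i. apply (pser_countable r (fun j => Rabs (term a s s i j)) _
                       (fun j x y => term a (g1 x y) (g2 x y) i j)); auto.
    intros n. apply sum_le_series; [intros; apply Rabs_pos|]. eapply bdd2_row; eauto.
  - intros n. destruct (bdd2_rowsums _ _ Ha) as [He Hb].
    eapply Rle_trans; [|exact Hb]. apply sum_le_series; auto.
    intros i. eapply Rle_trans; [|apply (sum_le_series _ 0%nat)].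
    + rewrite sum0. apply Rabs_pos.
    + intros; apply Rabs_pos.
    + eapply bdd2_row; eauto.
  - intros x y Hx Hy. apply Hf; eapply pser_bound; eauto.
Qed.

(** Without constant term, the norm tends to 0 with the radius; this is what
    makes a composition converge. *)
Lemma pser_shrink r B f : pser r B f -> forall t, 0 < t <= 1 ->
  pser (t * r) (Rabs (f 0 0) + t * B) f.
Proof.
  intros [Hr [a [Ha Hf]]] t Ht.
  assert (Ht0 : 0 < t * r) by nra.
  assert (Htr : t * r <= r) by nra.
  assert (H00 : f 0 0 = a 0%nat 0%nat).
  { rewrite Hf by (rewrite Rabs_R0; lra). unfold psum.
    assert (E : forall i j, (0 < i \/ 0 < j)%nat -> term a 0 0 i j = 0).
    { intros i j H. unfold term. destruct i, j; try lia; simpl; ring. }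
    assert (E0 : forall i, Series (term a 0 0 i) = term a 0 0 i 0).
    { intros i. rewrite (is_series_unique _ _ (finite_series (term a 0 0 i) 0
        ltac:(intros; apply E; lia))). apply sum0. }
    rewrite (is_series_unique _ _ (finite_series (fun i => Series (term a 0 0 i)) 0
        ltac:(intros; cbv beta; rewrite E0; apply E; lia))).
    rewrite sum0, E0. unfold term. simpl. ring. }
  split; auto. exists a. split.
  2:{ intros x y Hx Hy. apply Hf; lra. }
  intros n m.
  set (d := fun i j : nat => match i, j with O, O => Rabs (a 0%nat 0%nat) | _, _ => 0 end).
  assert (Hd0 : forall i j, 0 <= d i j) by (intros [|i] [|j]; simpl; try lra; apply Rabs_pos).
  apply Rle_trans with (sum_n (fun i => sum_n (fun j => d i j + t * Rabs (term a r r i j)) m) n).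
  - apply sum_le; intros i _; apply sum_le; intros j _.
    destruct (Nat.eq_dec (i + j) 0) as [E|E].
    + assert (i = 0%nat) by lia. assert (j = 0%nat) by lia. subst. unfold term; simpl.
      rewrite !Rmult_1_r. pose proof (Rabs_pos (a 0%nat 0%nat)). nra.
    + apply Rle_trans with (t * Rabs (term a r r i j)); [|specialize (Hd0 i j); lra].
      unfold term. rewrite !Rabs_mult, !Rpow_mult_distr, !Rabs_mult.
      rewrite (Rabs_pos_eq (t ^ i)), (Rabs_pos_eq (t ^ j)) by (apply pow_le; lra).
      replace (Rabs (a i j) * (t ^ i * Rabs (r ^ i)) * (t ^ j * Rabs (r ^ j)))
        with (t ^ (i + j) * (Rabs (a i j) * Rabs (r ^ i) * Rabs (r ^ j)))
        by (rewrite pow_add; ring).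
      apply Rmult_le_compat_r.
      * repeat apply Rmult_le_pos; apply Rabs_pos.
      * destruct (i + j)%nat as [|k]; [lia|]. simpl.
        assert (t ^ k <= 1) by (rewrite <- (pow1 k); apply pow_incr; lra). nra.
  - rewrite (sum_ext _ (fun i => sum_n (d i) m +
               t * sum_n (fun j => Rabs (term a r r i j)) m)).
    2:{ intros i _. rewrite sum_add, sum_scal. reflexivity. }
    rewrite sum_add, sum_scal. apply Rplus_le_compat.
    + rewrite H00.
      assert (Hz : forall k, sum_n (d 0%nat) k = Rabs (a 0%nat 0%nat)).
      { intros k. induction k as [|k IH]; [apply sum0|]. rewrite sumS, IH. simpl. ring_sum. }
      assert (Hy : forall k, sum_n (fun i => sum_n (d i) m) k = Rabs (a 0%nat 0%nat)).
      { intros k. induction k as [|k IH]; [rewrite sum0; apply Hz|].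
        rewrite sumS, IH, sum_zero by (intros; reflexivity). ring_sum. }
      rewrite Hy. lra.
    + apply Rmult_le_compat_l; [lra|apply Ha].
Qed.

(** * Analytic functions and orders of vanishing *)

Lemma regroup1 (t : nat -> nat -> R) k j : (j <= k)%nat -> regroup 1 t k j = t (k - j)%nat j.
Proof.
  intros H. unfold regroup. rewrite Nat.mul_1_l. unfold shift.
  destruct (Nat.leb_spec j k); [reflexivity|lia].
Qed.

Lemma diagonal_sum (g : R -> R) (t : nat -> nat -> R) k :
  sum_n (fun j => g (regroup 1 t k j)) k = sum_n (fun i => g (t i (k - i)%nat)) k.
Proof.
  rewrite <- (sum_rev (fun i => g (t i (k - i)%nat))). apply sum_ext. intros j Hj.
  rewrite regroup1 by auto. do 2 f_equal. lia.
Qed.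

Lemma analytic_pser f : analytic f -> exists r B, pser r B f.
Proof.
  intros [a [d Hd]].
  assert (Hd0 := cond_pos d).
  set (r := d / 2). assert (Hr : 0 < r < d) by (unfold r; lra).
  assert (Hin : forall x, Rabs x <= r -> Rabs (x - 0) < d) by (intros; rewrite Rminus_0_r; lra).
  destruct (Hd r r) as [He _]; try (apply Hin; rewrite Rabs_pos_eq; lra).
  set (B := Series (fun n => sum_n (fun i => Rabs (a i (n - i)%nat * r ^ i * r ^ (n - i))) n)).
  assert (Hb : bdd2 (term a r r) B).
  { apply (regroup_bdd_inv 1). intros n m. unfold B.
    eapply Rle_trans; [|apply (sum_le_series _ n); [|exact He]].
    - apply sum_le. intros k _.
      change (sum_n (fun i => Rabs (a i (k - i)%nat * r ^ i * r ^ (k - i))) k)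
        with (sum_n (fun i => Rabs (term a r r i (k - i))) k).
      rewrite <- (diagonal_sum Rabs (term a r r) k).
      assert (P0 : forall i, 0 <= Rabs (regroup 1 (term a r r) k i)) by (intros; apply Rabs_pos).
      eapply Rle_trans; [apply (sum_mono _ m (m + k) P0); lia|].
      induction m as [|m IH]; [apply Rle_refl|]. simpl. rewrite sumS.
      rewrite (regroup_support 1 _ k (S (m + k))) by lia. rewrite Rabs_R0. lra.
    - intros k. apply sum_nonneg. intros; apply Rabs_pos. }
  exists r, B. split; [lra|]. exists a. split; auto.
  intros x y Hx Hy. destruct (Hd x y (Hin x Hx) (Hin y Hy)) as [_ Hs].
  rewrite <- (is_series_unique _ _ Hs). apply is_series_unique.
  destruct (regroup_series 1 (term a x y) B) as [_ H2]; auto.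
  { eapply term_bdd; eauto. }
  eapply is_series_ext; [|exact H2]. intros n. simpl.
  apply (diagonal_sum (fun z => z) (term a x y) n).
Qed.

Lemma pser_analytic r B f : pser r B f -> analytic f.
Proof.
  intros [Hr [a [Ha Hf]]]. exists a. exists (mkposreal r Hr). simpl.
  intros x y Hx Hy. rewrite Rminus_0_r in Hx, Hy.
  destruct (regroup_series 1 (term a x y) B) as [H1 H2]; auto.
  { apply (term_bdd a r); auto; lra. }
  rewrite Hf by lra. split.
  - eapply ex_series_ext; [|exact H1]. intros n. apply (diagonal_sum Rabs (term a x y) n).
  - eapply is_series_ext; [|exact H2]. intros n.
    apply (diagonal_sum (fun z => z) (term a x y) n).
Qed.

Lemma pser_radius r r' B f : pser r B f -> 0 < r' <= r -> pser r' B f.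
Proof.
  intros [Hr [a [Ha Hf]]] Hr'. split; [lra|]. exists a. split.
  - apply (term_bdd a r); auto; rewrite Rabs_pos_eq; lra.
  - intros; apply Hf; lra.
Qed.

Lemma analytic_pser2 f g : analytic f -> analytic g ->
  exists r B, pser r B f /\ pser r B g.
Proof.
  intros Hf Hg. destruct (analytic_pser f Hf) as [r [B H]].
  destruct (analytic_pser g Hg) as [r' [B' H']].
  assert (0 < Rmin r r') by (apply Rmin_glb_lt; [apply H|apply H']).
  exists (Rmin r r'), (Rmax B B'). split.
  - apply (pser_le _ B); [|apply Rmax_l]. apply (pser_radius r); auto.
    split; auto. apply Rmin_l.
  - apply (pser_le _ B'); [|apply Rmax_r]. apply (pser_radius r'); auto.
    split; auto. apply Rmin_r.
Qed.

Lemma analytic_const c : analytic (fun _ _ => c).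
Proof. apply (pser_analytic 1 (Rabs c)), pser_const. lra. Qed.

Lemma analytic_x : analytic (fun x _ => x).
Proof.
  apply (pser_analytic 1 (1 * Rabs 1)). eapply pser_ext.
  - apply pser_mulx, pser_const. lra.
  - intros; simpl; ring.
Qed.

Lemma analytic_y : analytic (fun _ y => y).
Proof.
  apply (pser_analytic 1 (1 * Rabs 1)). eapply pser_ext.
  - apply pser_muly, pser_const. lra.
  - intros; simpl; ring.
Qed.

Lemma analytic_add f g : analytic f -> analytic g -> analytic (fun x y => f x y + g x y).
Proof.
  intros Hf Hg. destruct (analytic_pser2 f g Hf Hg) as [r [B [H1 H2]]].
  eapply pser_analytic, pser_add; eauto.
Qed.

Lemma analytic_mul f g : analytic f -> analytic g -> analytic (fun x y => f x y * g x y).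
Proof.
  intros Hf Hg. destruct (analytic_pser2 f g Hf Hg) as [r [B [H1 H2]]].
  eapply pser_analytic, pser_mul; eauto.
Qed.

Lemma analytic_ext f g : analytic f -> (forall x y, g x y = f x y) -> analytic g.
Proof.
  intros Hf H. replace g with f; auto.
  do 2 (apply functional_extensionality; intro). auto.
Qed.

Lemma analytic_opp f : analytic f -> analytic (fun x y => - f x y).
Proof.
  intros Hf. apply (analytic_ext (fun x y => (-1) * f x y)); [|intros; ring].
  apply (analytic_mul (fun _ _ => -1)); auto. apply analytic_const.
Qed.

Lemma analytic_sub f g : analytic f -> analytic g -> analytic (fun x y => f x y - g x y).
Proof. intros Hf Hg. apply analytic_add; auto. apply (analytic_opp g), Hg. Qed.

Lemma analytic_pow f n : analytic f -> analytic (fun x y => f x y ^ n).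
Proof.
  intros Hf. induction n as [|n IH]; simpl; [apply analytic_const|].
  apply analytic_mul; auto.
Qed.

Lemma analytic_comp f g1 g2 : analytic f -> analytic g1 -> analytic g2 ->
  g1 0 0 = 0 -> g2 0 0 = 0 -> analytic (fun x y => f (g1 x y) (g2 x y)).
Proof.
  intros Hf H1 H2 E1 E2. destruct (analytic_pser f Hf) as [s [B Hs]].
  destruct (analytic_pser2 g1 g2 H1 H2) as [r [D [P1 P2]]].
  assert (HD := pser_pos _ _ _ P1). assert (Hs0 : 0 < s) by apply Hs.
  destruct (small_radius 1 s D Rlt_0_1 Hs0 HD) as [t [Ht HtD]].
  assert (Hg : forall g, pser r D g -> g 0 0 = 0 -> pser (t * r) s g).
  { intros g Hg E. apply (pser_le _ (Rabs (g 0 0) + t * D)).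
    - apply pser_shrink; auto.
    - rewrite E, Rabs_R0. lra. }
  eapply pser_analytic, pser_comp; [exact Hs| |]; auto.
Qed.

(** Geometric series in [z = 1 - f / f(0,0)], whose norm is small on small squares. *)
Lemma analytic_inv f : analytic f -> f 0 0 <> 0 -> analytic (fun x y => / f x y).
Proof.
  intros Hf H0.
  set (z := fun x y => 1 - / f 0 0 * f x y).
  assert (Hz : analytic z).
  { unfold z. apply (analytic_sub (fun _ _ => 1)); [apply analytic_const|].
    apply (analytic_mul (fun _ _ => / f 0 0)); [apply analytic_const|apply Hf]. }
  assert (Hz0 : z 0 0 = 0) by (unfold z; field; auto).
  destruct (analytic_pser z Hz) as [r [B P]]. assert (HB := pser_pos _ _ _ P).
  destruct (small_radius 1 (/ 2) B Rlt_0_1 ltac:(lra) HB) as [t [Ht HtB]].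
  assert (P' : pser (t * r) (/ 2) z).
  { apply (pser_le _ (Rabs (z 0 0) + t * B)); [apply pser_shrink; auto|].
    rewrite Hz0, Rabs_R0. lra. }
  assert (Hg : pser (t * r) 2 (fun x y => / (1 - z x y))).
  { apply (pser_countable (t * r) (fun k => (/ 2) ^ k) 2 (fun k x y => z x y ^ k)).
    - intros k. apply pser_pow, P'.
    - intros n.
      assert (Hh : Rabs (/ 2) < 1) by (rewrite Rabs_pos_eq; lra).
      pose proof (Series_geom (/ 2) Hh) as E. pose proof (ex_series_geom (/ 2) Hh) as Ex.
      assert (E2 : Series (fun n => (/ 2) ^ n) = 2) by (rewrite E; field).
      eapply Rle_trans; [|right; exact E2]. apply sum_le_series; auto. intros; apply pow_le; lra.
    - intros x y Hx Hy. symmetry. apply Series_geom.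
      pose proof (pser_bound _ _ _ x y P' Hx Hy). lra. }
  apply (analytic_ext (fun x y => / f 0 0 * / (1 - z x y))).
  - apply (analytic_mul (fun _ _ => / f 0 0)); [apply analytic_const|].
    eapply pser_analytic, Hg.
  - intros x y. unfold z. rewrite <- Rinv_mult. f_equal. field. auto.
Qed.

Lemma analytic_div f g : analytic f -> analytic g -> g 0 0 <> 0 ->
  analytic (fun x y => f x y / g x y).
Proof. intros Hf Hg H0. apply analytic_mul; auto. apply analytic_inv; auto. Qed.

(** Order of vanishing at O for the weights [(1,q)] of [(u,v)]: the parameter [r]
    plays the part of a quasi-homogeneous norm and avoids [q]-th roots. Jets are
    compared through these estimates only, never through coefficients of composed
    series. *)
Definition bigO (q M : nat) (F : R -> R -> R) : Prop :=
  exists C d, 0 <= C /\ 0 < d <= 1 /\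
    forall r u v, 0 < r <= d -> Rabs u <= r -> Rabs v <= r ^ q -> Rabs (F u v) <= C * r ^ M.

Lemma pow_le_1 r n : 0 <= r <= 1 -> 0 <= r ^ n <= 1.
Proof.
  intros H. split; [apply pow_le; lra|]. rewrite <- (pow1 n). apply pow_incr; lra.
Qed.

Lemma pow_antitone r n m : 0 <= r <= 1 -> (n <= m)%nat -> r ^ m <= r ^ n.
Proof.
  intros Hr H. replace m with (n + (m - n))%nat by lia. rewrite pow_add.
  pose proof (pow_le_1 r n Hr). pose proof (pow_le_1 r (m - n) Hr). nra.
Qed.

Lemma bigO_two q M N F G : bigO q M F -> bigO q N G ->
  exists C d, 0 <= C /\ 0 < d <= 1 /\
    forall r u v, 0 < r <= d -> Rabs u <= r -> Rabs v <= r ^ q ->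
      Rabs (F u v) <= C * r ^ M /\ Rabs (G u v) <= C * r ^ N.
Proof.
  intros [C [d [HC [Hd H]]]] [C' [d' [HC' [Hd' H']]]].
  exists (C + C'), (Rmin d d'). split; [lra|]. split.
  { split; [apply Rmin_glb_lt; lra|]. eapply Rle_trans; [apply Rmin_l|lra]. }
  intros r u v Hr Hu Hv.
  assert (Rmin d d' <= d) by apply Rmin_l. assert (Rmin d d' <= d') by apply Rmin_r.
  assert (0 <= r ^ M) by (apply pow_le; lra). assert (0 <= r ^ N) by (apply pow_le; lra).
  split.
  - eapply Rle_trans; [apply (H r u v); try split; try assumption; lra|]. nra.
  - eapply Rle_trans; [apply (H' r u v); try split; try assumption; lra|]. nra.
Qed.

Lemma bigO_add q M F G : bigO q M F -> bigO q M G -> bigO q M (fun u v => F u v + G u v).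
Proof.
  intros HF HG. destruct (bigO_two _ _ _ _ _ HF HG) as [C [d [HC [Hd H]]]].
  exists (2 * C), d. split; [lra|]. split; auto. intros r u v Hr Hu Hv.
  destruct (H r u v Hr Hu Hv). eapply Rle_trans; [apply Rabs_triang|]. lra.
Qed.

Lemma bigO_mul q M N F G : bigO q M F -> bigO q N G ->
  bigO q (M + N) (fun u v => F u v * G u v).
Proof.
  intros HF HG. destruct (bigO_two _ _ _ _ _ HF HG) as [C [d [HC [Hd H]]]].
  exists (C * C), d. split; [nra|]. split; auto. intros r u v Hr Hu Hv.
  destruct (H r u v Hr Hu Hv). rewrite Rabs_mult, pow_add.
  replace (C * C * (r ^ M * r ^ N)) with ((C * r ^ M) * (C * r ^ N)) by ring.
  apply Rmult_le_compat; auto; apply Rabs_pos.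
Qed.

Lemma bigO_weaken q M N F : bigO q M F -> (N <= M)%nat -> bigO q N F.
Proof.
  intros [C [d [HC [Hd H]]]] HN. exists C, d. split; auto. split; auto.
  intros r u v Hr Hu Hv. eapply Rle_trans; [apply (H r u v); auto|].
  apply Rmult_le_compat_l; auto. apply pow_antitone; auto; lra.
Qed.

Lemma bigO_ext q M F G : bigO q M F -> (forall u v, G u v = F u v) -> bigO q M G.
Proof.
  intros HF H. replace G with F; auto.
  do 2 (apply functional_extensionality; intro). auto.
Qed.

Lemma bigO_const q c : bigO q 0 (fun _ _ => c).
Proof.
  exists (Rabs c), 1. split; [apply Rabs_pos|]. split; [lra|]. intros; simpl; lra.
Qed.

Lemma bigO_u q : bigO q 1 (fun u _ => u).
Proof. exists 1, 1. split; [lra|]. split; [lra|]. intros; simpl; lra. Qed.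

Lemma bigO_v q : bigO q q (fun _ v => v).
Proof. exists 1, 1. split; [lra|]. split; [lra|]. intros; lra. Qed.

Lemma bigO_zero q M : bigO q M (fun _ _ => 0).
Proof.
  exists 0, 1. split; [lra|]. split; [lra|]. intros. rewrite Rabs_R0. lra.
Qed.

Lemma bigO_scal q M c F : bigO q M F -> bigO q M (fun u v => c * F u v).
Proof. intros H. apply (bigO_mul q 0 M (fun _ _ => c)); auto. apply bigO_const. Qed.

Lemma bigO_opp q M F : bigO q M F -> bigO q M (fun u v => - F u v).
Proof.
  intros H. apply (bigO_ext q M (fun u v => (-1) * F u v)); [|intros; ring].
  apply bigO_scal, H.
Qed.

Lemma bigO_sub q M F G : bigO q M F -> bigO q M G -> bigO q M (fun u v => F u v - G u v).
Proof. intros HF HG. apply bigO_add; auto. apply (bigO_opp q M G), HG. Qed.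

Lemma bigO_pow q M F n : bigO q M F -> bigO q (n * M) (fun u v => F u v ^ n).
Proof.
  intros H. induction n as [|n IH]; simpl; [apply bigO_const|]. apply bigO_mul; auto.
Qed.

Lemma bigO_analytic q F : (1 <= q)%nat -> analytic F -> bigO q 0 F.
Proof.
  intros Hq HF. destruct (analytic_pser F HF) as [r [B P]].
  assert (Hr : 0 < r) by apply P.
  exists B, (Rmin r 1). split; [eapply pser_pos; eauto|]. split.
  { split; [apply Rmin_glb_lt; lra|apply Rmin_r]. }
  intros s u v Hs Hu Hv.
  assert (Rmin r 1 <= r) by apply Rmin_l. assert (Rmin r 1 <= 1) by apply Rmin_r.
  assert (s ^ q <= s ^ 1) by (apply pow_antitone; auto; lra).
  simpl in *. rewrite Rmult_1_r in *. eapply pser_bound; eauto; lra.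
Qed.

Lemma bigO_comp q M F h1 h2 : (1 <= q)%nat -> bigO q M F -> bigO q 1 h1 -> bigO q q h2 ->
  bigO q M (fun u v => F (h1 u v) (h2 u v)).
Proof.
  intros Hq [C [d [HC [Hd H]]]] H1 H2.
  destruct (bigO_two _ _ _ _ _ H1 H2) as [D [e [HD [He Hh]]]].
  set (K := D + 1). assert (HK : 1 <= K) by (unfold K; lra).
  assert (HKq : K <= K ^ q).
  { rewrite <- (pow_1 K) at 1. apply Rle_pow; auto. }
  exists (C * K ^ M), (Rmin e (d / K)).
  assert (Hdk : 0 < d / K) by (apply Rdiv_lt_0_compat; lra).
  assert (0 <= K ^ M) by (apply pow_le; lra).
  split; [nra|]. split.
  { split; [apply Rmin_glb_lt; lra|]. eapply Rle_trans; [apply Rmin_l|lra]. }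
  intros r u v Hr Hu Hv.
  assert (Rmin e (d / K) <= e) by apply Rmin_l.
  assert (Hm : Rmin e (d / K) <= d / K) by apply Rmin_r.
  destruct (Hh r u v) as [B1 B2]; auto; [lra|].
  assert (0 <= r ^ q) by (apply pow_le; lra).
  assert (HrK : K * r <= d).
  { apply Rle_trans with (K * (d / K)); [|right; field; lra].
    apply Rmult_le_compat_l; lra. }
  rewrite Rmult_assoc, <- Rpow_mult_distr. apply H.
  - split; [nra|auto].
  - eapply Rle_trans; [exact B1|]. unfold K. simpl. nra.
  - eapply Rle_trans; [exact B2|]. rewrite Rpow_mult_distr.
    apply Rmult_le_compat_r; auto. unfold K in *; lra.
Qed.

(** Quasi-homogeneous polynomials of weight [k]. The partial derivatives are carried
    along because the homological equations are identities between them. *)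
Inductive wpoly (q : nat) : nat -> (R -> R -> R) -> (R -> R -> R) -> (R -> R -> R) -> Prop :=
| wp_mono c i j k : (i + q * j = k)%nat ->
    wpoly q k (fun u v => c * u ^ i * v ^ j)
              (fun u v => c * (INR i * u ^ (i - 1)) * v ^ j)
              (fun u v => c * u ^ i * (INR j * v ^ (j - 1)))
| wp_add k f fu fv g gu gv : wpoly q k f fu fv -> wpoly q k g gu gv ->
    wpoly q k (fun u v => f u v + g u v) (fun u v => fu u v + gu u v)
              (fun u v => fv u v + gv u v).

Definition qhom (q k : nat) (f : R -> R -> R) : Prop :=
  exists fu fv, wpoly q k f fu fv.

Lemma fun2_ext (f g : R -> R -> R) : (forall u v, f u v = g u v) -> f = g.
Proof. intros H. do 2 (apply functional_extensionality; intro). apply H. Qed.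

Lemma wpoly_scale q k f fu fv : wpoly q k f fu fv ->
  forall l u v, f (l * u) (l ^ q * v) = l ^ k * f u v.
Proof.
  induction 1 as [c i j k Hk|k f fu fv g gu gv _ IHf _ IHg]; intros l u v.
  - subst k. rewrite !Rpow_mult_distr, pow_add, pow_mult. ring.
  - rewrite IHf, IHg. ring.
Qed.

Lemma wpoly_bigO q k f fu fv : wpoly q k f fu fv -> bigO q k f.
Proof.
  induction 1 as [c i j k Hk|]; [|apply bigO_add; auto].
  replace k with (0 + (i * 1) + (j * q))%nat by lia.
  apply (bigO_mul q (0 + i * 1) (j * q) (fun u v => c * u ^ i)).
  - apply (bigO_mul q 0 (i * 1) (fun _ _ => c)); [apply bigO_const|].
    apply (bigO_pow q 1 (fun u _ => u)), bigO_u.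
  - apply (bigO_pow q q (fun _ v => v)), bigO_v.
Qed.

Lemma wpoly_bigO_u q k f fu fv : wpoly q k f fu fv -> bigO q (k - 1) fu.
Proof.
  induction 1 as [c i j k Hk|]; [|apply bigO_add; auto].
  apply (bigO_ext q _ (fun u v => INR i * (c * u ^ (i - 1) * v ^ j))); [|intros; ring].
  destruct i as [|i].
  - simpl. eapply bigO_ext; [apply bigO_zero|]. intros; simpl; ring.
  - apply bigO_scal. apply (wpoly_bigO q _ _ _ _ (wp_mono q c (S i - 1) j (k - 1) ltac:(lia))).
Qed.

Lemma wpoly_bigO_v q k f fu fv : wpoly q k f fu fv -> bigO q (k - q) fv.
Proof.
  induction 1 as [c i j k Hk|]; [|apply bigO_add; auto].
  apply (bigO_ext q _ (fun u v => INR j * (c * u ^ i * v ^ (j - 1)))); [|intros; ring].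
  destruct j as [|j].
  - simpl. eapply bigO_ext; [apply bigO_zero|]. intros; simpl; ring.
  - apply bigO_scal. apply (wpoly_bigO q _ _ _ _ (wp_mono q c i (S j - 1) (k - q) ltac:(nia))).
Qed.

Lemma wpoly_derive_u q k f fu fv : wpoly q k f fu fv ->
  forall u v, is_derive (fun s => f s v) u (fu u v).
Proof.
  induction 1 as [c i j k Hk|k f fu fv g gu gv _ IHf _ IHg]; intros u v.
  - auto_derive; auto. replace (Nat.pred i) with (i - 1)%nat by lia. ring.
  - apply (is_derive_plus (fun s => f s v) (fun s => g s v)); auto.
Qed.

Lemma wpoly_derive_v q k f fu fv : wpoly q k f fu fv ->
  forall u v, is_derive (fun s => f u s) v (fv u v).
Proof.
  induction 1 as [c i j k Hk|k f fu fv g gu gv _ IHf _ IHg]; intros u v.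
  - auto_derive; auto. replace (Nat.pred j) with (j - 1)%nat by lia. ring.
  - apply (is_derive_plus (fun s => f u s) (fun s => g u s)); auto.
Qed.

Lemma analytic_mono c i j : analytic (fun u v => c * u ^ i * v ^ j).
Proof.
  apply (analytic_mul (fun u v => c * u ^ i)).
  - apply (analytic_mul (fun _ _ => c)); [apply analytic_const|].
    apply (analytic_pow (fun u _ => u)), analytic_x.
  - apply (analytic_pow (fun _ v => v)), analytic_y.
Qed.

Lemma wpoly_analytic q k f fu fv : wpoly q k f fu fv ->
  analytic f /\ analytic fu /\ analytic fv.
Proof.
  induction 1 as [c i j k Hk|k f fu fv g gu gv _ IHf _ IHg].
  - split; [|split].
    + apply analytic_mono.
    + eapply analytic_ext; [apply (analytic_mono (c * INR i) (i - 1) j)|].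
      intros; simpl; ring.
    + eapply analytic_ext; [apply (analytic_mono (c * INR j) i (j - 1))|].
      intros; simpl; ring.
  - destruct IHf as [? []], IHg as [? []]. repeat split; apply analytic_add; auto.
Qed.

Lemma qhom_sum q k (f : nat -> R -> R -> R) n : (forall j, (j <= n)%nat -> qhom q k (f j)) ->
  qhom q k (fun u v => sum_n (fun j => f j u v) n).
Proof.
  induction n as [|n IH]; intros H.
  - destruct (H 0%nat) as [fu [fv Hf]]; [lia|]. exists fu, fv.
    replace (fun u v : R => sum_n (fun j : nat => f j u v) 0) with (f 0%nat); auto.
    apply fun2_ext; intros. rewrite sum0. reflexivity.
  - destruct (H (S n)) as [fu [fv Hf]]; [lia|]. destruct IH as [gu [gv Hg]]; [auto|].
    eexists _, _.
    replace (fun u v : R => sum_n (fun j : nat => f j u v) (S n))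
      with (fun u v => sum_n (fun j : nat => f j u v) n + f (S n) u v).
    + apply wp_add; eauto.
    + apply fun2_ext; intros. rewrite sumS. reflexivity.
Qed.

(** The remainder estimates turn orders of vanishing into statements about the
    components [p k]. *)
Lemma weighted_expansion q F : (1 <= q)%nat -> analytic F ->
  exists (p : nat -> R -> R -> R) (r : R), 0 < r <= 1 /\
    (forall k, qhom q k (p k)) /\
    (forall u v, Rabs u <= r -> Rabs v <= r -> is_series (fun k => p k u v) (F u v)) /\
    (forall n, bigO q (S n) (fun u v => F u v - sum_n (fun k => p k u v) n)).
Proof.
  intros Hq HF. destruct (analytic_pser F HF) as [r0 [B P0]].
  assert (Hr0 : 0 < r0) by apply P0.
  set (r := Rmin r0 1).
  assert (Hr : 0 < r <= 1) by (split; [apply Rmin_glb_lt; lra|apply Rmin_r]).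
  assert (P := pser_radius r0 r B F P0 (conj (proj1 Hr) (Rmin_l r0 1))).
  assert (HB := pser_pos _ _ _ P).
  destruct P as [_ [a [Ha Hf]]].
  exists (fun k u v => sum_n (regroup q (term a u v) k) k), r.
  split; [exact Hr|]. split; [|].
  { intros k. apply (qhom_sum q k (fun j u v => regroup q (term a u v) k j)).
    intros j _. unfold regroup, shift.
    destruct (Nat.leb_spec (q * j) k).
    - unfold term. eexists _, _.
      apply (wp_mono q (a (k - q * j)%nat j) (k - q * j) j k). lia.
    - exists (fun u v => 0 * (INR k * u ^ (k - 1)) * v ^ 0),
             (fun u v => 0 * u ^ k * (INR 0 * v ^ (0 - 1))).
      replace (fun _ _ : R => 0) with (fun u v : R => 0 * u ^ k * v ^ 0).
      + apply wp_mono. lia.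
      + apply fun2_ext; intros; ring. }
  assert (Hser : forall u v, Rabs u <= r -> Rabs v <= r ->
     is_series (fun k => sum_n (regroup q (term a u v) k) k) (F u v)).
  { intros u v Hu Hv. rewrite Hf by auto. apply (regroup_series q _ B); auto.
    eapply term_bdd; eauto. }
  split; [exact Hser|].
  intros n. exists (B * / r ^ S n), r.
  assert (Hrn : 0 < r ^ S n) by (apply pow_lt; lra).
  assert (0 < / r ^ S n) by (apply Rinv_0_lt_compat; auto).
  split; [nra|]. split; [auto|].
  intros s u v Hs Hu Hv.
  assert (Hsq : s ^ q <= s).
  { rewrite <- (pow_1 s) at 2. apply pow_antitone; auto; lra. }
  assert (Hv' : Rabs v <= r) by lra. assert (Hu' : Rabs u <= r) by lra.
  pose proof (Hser u v Hu' Hv') as H1.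
  set (p := fun k => sum_n (regroup q (term a u v) k) k) in *.
  assert (Hrq : Rabs (r ^ q) <= r).
  { rewrite Rabs_pos_eq by (apply pow_le; lra).
    rewrite <- (pow_1 r) at 2. apply pow_antitone; auto; lra. }
  assert (Hrr : Rabs r <= r) by (rewrite Rabs_pos_eq; lra).
  assert (Hb := term_bdd a r B r (r ^ q) Ha Hrr Hrq).
  destruct (regroup_series q _ B Hq Hb) as [Hex _].
  set (b := fun k => sum_n (fun j => Rabs (regroup q (term a r (r ^ q)) k j)) k) in *.
  assert (Hb0 : forall k, 0 <= b k) by (intros; apply sum_nonneg; intros; apply Rabs_pos).
  assert (HbB : forall K, sum_n b K <= B).
  { intros K. eapply Rle_trans; [|apply (regroup_bdd q _ B Hb K K)].
    apply sum_le. intros k Hk. apply sum_mono; auto. intros; apply Rabs_pos. }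
  set (x := s / r).
  assert (Hx : 0 <= x <= 1).
  { unfold x. split; [apply Rdiv_le_0_compat; lra|]. apply Rle_div_l; lra. }
  assert (Hpb : forall k, Rabs (p k) <= x ^ k * b k).
  { intros k. unfold p, b. eapply Rle_trans; [apply sum_abs|]. rewrite <- sum_scal.
    apply sum_le. intros j _. unfold regroup, shift.
    destruct (Nat.leb_spec (q * j) k) as [Hle|Hle]; [|rewrite Rabs_R0; lra].
    unfold term.
    assert (E : x ^ k * Rabs (a (k - q * j)%nat j * r ^ (k - q * j) * (r ^ q) ^ j)
                = Rabs (a (k - q * j)%nat j) * (s ^ (k - q * j) * (s ^ q) ^ j)).
    { rewrite !Rabs_mult, <- !pow_mult.
      rewrite (Rabs_pos_eq (r ^ _)), (Rabs_pos_eq (r ^ (q * j))) by (apply pow_le; lra).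
      replace (x ^ k) with (x ^ (k - q * j) * x ^ (q * j))
        by (rewrite <- pow_add; f_equal; lia).
      replace s with (x * r) by (unfold x; field; lra).
      rewrite !Rpow_mult_distr. ring. }
    rewrite E, !Rabs_mult, Rmult_assoc. apply Rmult_le_compat_l; [apply Rabs_pos|].
    apply Rmult_le_compat; try apply Rabs_pos; rewrite <- RPow_abs;
      apply pow_incr; split; auto; apply Rabs_pos. }
  assert (Htail : forall K, Rabs (sum_n p (S n + K) - sum_n p n) <= x ^ S n * B).
  { intros K.
    apply Rle_trans with (x ^ S n * (sum_n b (S n + K) - sum_n b n)).
    - induction K as [|K IH].
      + rewrite Nat.add_0_r, !sumS.
        replace (sum_n p n + p (S n) - sum_n p n) with (p (S n)) by ring_sum.
        replace (sum_n b n + b (S n) - sum_n b n) with (b (S n)) by ring_sum.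
        apply Hpb.
      + rewrite Nat.add_succ_r, !sumS.
        replace (sum_n p (S n + K) + p (S (S n + K)) - sum_n p n)
          with ((sum_n p (S n + K) - sum_n p n) + p (S (S n + K))) by ring_sum.
        eapply Rle_trans; [apply Rabs_triang|].
        assert (Rabs (p (S (S n + K))) <= x ^ S n * b (S (S n + K))).
        { eapply Rle_trans; [apply Hpb|]. apply Rmult_le_compat_r; auto.
          apply pow_antitone; auto. lia. }
        lra.
    - apply Rmult_le_compat_l; [apply pow_le; lra|].
      assert (0 <= sum_n b n) by (apply sum_nonneg; auto). specialize (HbB (S n + K)%nat). lra. }
  assert (Hlim : is_lim_seq (fun K => sum_n p (S n + K)) (F u v)).
  { apply (is_lim_seq_ext (fun K => sum_n p (K + S n)%nat)).
    - intros K. f_equal. lia.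
    - apply is_lim_seq_incr_n. exact H1. }
  replace (B * / r ^ S n * s ^ S n) with (x ^ S n * B).
  2:{ unfold x, Rdiv. rewrite Rpow_mult_distr, pow_inv. ring. }
  apply Rabs_le_between.
  assert (H2 := is_lim_seq_minus' _ _ _ _ Hlim (is_lim_seq_const (sum_n p n))).
  split.
  - refine (is_lim_seq_le (fun _ => - (x ^ S n * B)) _ _ _ _ (is_lim_seq_const _) H2).
    intros K. specialize (Htail K). apply Rabs_le_between in Htail. lra.
  - refine (is_lim_seq_le _ (fun _ => x ^ S n * B) _ _ _ H2 (is_lim_seq_const _)).
    intros K. specialize (Htail K). apply Rabs_le_between in Htail. lra.
Qed.

(** * Weighted Taylor expansions *)

(** Along a quasi-homogeneous ray [f] scales exactly like [l ^ k], which is not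
    [O(l ^ (k+1))] unless [f] vanishes on the ray. *)
Lemma qhom_bigO_zero q k f : (1 <= q)%nat -> qhom q k f -> bigO q (S k) f -> forall u v, f u v = 0.
Proof.
  intros Hq [fu [fv Hf]] [C [d [HC [Hd H]]]] u v.
  pose proof (wpoly_scale _ _ _ _ _ Hf) as Hs.
  set (M := 1 + Rabs u + Rabs v).
  assert (HM : 1 <= M) by (unfold M; pose proof (Rabs_pos u); pose proof (Rabs_pos v); lra).
  assert (Hl : forall l, 0 < l <= d / M -> Rabs (f u v) <= C * M ^ S k * l).
  { intros l Hl.
    assert (Hlk : 0 < l ^ k) by (apply pow_lt; lra).
    assert (Hlq : 0 < l ^ q) by (apply pow_lt; lra).
    assert (HlM : M * l <= d).
    { apply Rle_trans with (M * (d / M)); [|right; field; lra].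
      apply Rmult_le_compat_l; lra. }
    apply (Rmult_le_reg_l (l ^ k)); auto.
    rewrite <- (Rabs_pos_eq (l ^ k)) at 1 by lra. rewrite <- Rabs_mult, <- Hs.
    replace (l ^ k * (C * M ^ S k * l)) with (C * (M * l) ^ S k)
      by (rewrite Rpow_mult_distr; simpl; ring).
    apply (H (M * l)).
    - split; [nra|auto].
    - rewrite Rabs_mult, (Rabs_pos_eq l) by lra.
      assert (Rabs u <= M) by (unfold M; pose proof (Rabs_pos v); lra). nra.
    - rewrite Rabs_mult, (Rabs_pos_eq (l ^ q)), Rpow_mult_distr by lra.
      assert (M <= M ^ q) by (rewrite <- (pow_1 M) at 1; apply Rle_pow; auto).
      assert (Rabs v <= M) by (unfold M; pose proof (Rabs_pos u); lra). nra. }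
  apply (vanishing _ (C * M ^ S k) (d / M)); [apply Rdiv_lt_0_compat; lra|exact Hl].
Qed.

(** Components of weight less than [m] vanish one after the other, each being of
    higher order than its weight. *)
Lemma expansion_of_order q m F : (1 <= q)%nat -> analytic F -> bigO q m F ->
  exists (p : nat -> R -> R -> R) (r : R), 0 < r /\
    (forall k, qhom q k (p k)) /\
    (forall u v, Rabs u <= r -> Rabs v <= r -> is_series (fun k => p (m + k)%nat u v) (F u v)) /\
    bigO q (S m) (fun u v => F u v - p m u v).
Proof.
  intros Hq HF HO.
  destruct (weighted_expansion q F Hq HF) as [p [r [Hr [Hp [Hs Ht]]]]].
  assert (Hz : forall k, (k < m)%nat -> forall u v, p k u v = 0).
  { intros k. induction k as [k IH] using (well_founded_induction Wf_nat.lt_wf). intros Hk.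
    apply (qhom_bigO_zero q k); auto.
    apply (bigO_ext q (S k) (fun u v => F u v - (F u v - sum_n (fun k => p k u v) k))).
    - apply bigO_sub; [apply (bigO_weaken q m); auto|apply Ht].
    - intros u v. destruct k as [|k]; [rewrite sum0; ring|].
      rewrite sumS, sum_zero; [ring|]. intros i Hi. apply IH; lia. }
  exists p, r. split; [lra|]. split; auto. split.
  - intros u v Hu Hv. specialize (Hs u v Hu Hv). destruct m as [|m]; [exact Hs|].
    apply (is_series_incr_n (fun k => p k u v) (S m) (F u v)); [lia|].
    simpl. rewrite sum_zero by (intros; apply Hz; lia).
    change (is_series (fun k => p k u v) (F u v + 0)). rewrite Rplus_0_r. exact Hs.
  - eapply bigO_ext; [apply (Ht m)|]. intros u v. simpl. f_equal. f_equal.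
    destruct m as [|m]; [rewrite sum0; reflexivity|].
    rewrite sumS, sum_zero; [ring|]. intros; apply Hz; lia.
Qed.

Lemma taylor_step q m F : (1 <= q)%nat -> analytic F -> bigO q m F ->
  exists P Pu Pv, wpoly q m P Pu Pv /\ bigO q (S m) (fun u v => F u v - P u v).
Proof.
  intros Hq HF HO. destruct (expansion_of_order q m F Hq HF HO) as [p [r [_ [Hp [_ Ht]]]]].
  destruct (Hp m) as [Pu [Pv HP]]. exists (p m), Pu, Pv. auto.
Qed.

(** The first replaced factor [h] is traded for [d], which changes the order by
    [D - a]. *)
Lemma bigO_pow_increment q a D i h d : bigO q a h -> bigO q D d -> (a <= D)%nat ->
  bigO q (i * a + D - a) (fun u v => (h u v + d u v) ^ i - h u v ^ i).
Proof.
  intros Hh Hd HaD. destruct i as [|i].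
  { eapply bigO_ext; [apply bigO_zero|]. intros; simpl; ring. }
  replace (S i * a + D - a)%nat with (i * a + D)%nat by lia.
  induction i as [|i IH].
  - eapply bigO_ext; [exact Hd|]. intros; simpl; ring.
  - assert (Hp : bigO q (S i * a) (fun u v => (h u v + d u v) ^ S i)).
    { apply bigO_pow. apply bigO_add; auto. eapply bigO_weaken; eauto. }
    apply (bigO_ext q _ (fun u v => d u v * (h u v + d u v) ^ S i
                          + h u v * ((h u v + d u v) ^ S i - h u v ^ S i))).
    + apply bigO_add.
      * replace (S i * a + D)%nat with (D + S i * a)%nat by lia. apply bigO_mul; auto.
      * replace (S i * a + D)%nat with (a + (i * a + D))%nat by lia. apply bigO_mul; auto.
    + intros; simpl; ring.
Qed.

Lemma wpoly_increment q m K D1 D2 f fu fv h1 h2 d1 d2 : (1 <= q)%nat ->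
  wpoly q m f fu fv -> bigO q 1 h1 -> bigO q q h2 ->
  bigO q D1 d1 -> bigO q D2 d2 -> (1 <= D1)%nat -> (q <= D2)%nat ->
  (K + 1 <= m + D1)%nat -> (K + q <= m + D2)%nat ->
  bigO q K (fun u v => f (h1 u v + d1 u v) (h2 u v + d2 u v) - f (h1 u v) (h2 u v)).
Proof.
  intros Hq Hf H1 H2 Hd1 Hd2 HD1 HD2.
  induction Hf as [c i j m Hm|m f fu fv g gu gv _ IHf _ IHg]; intros HK1 HK2.
  - apply (bigO_ext q K (fun u v =>
       c * (((h1 u v + d1 u v) ^ i - h1 u v ^ i) * (h2 u v + d2 u v) ^ j
            + h1 u v ^ i * ((h2 u v + d2 u v) ^ j - h2 u v ^ j)))); [|intros; ring].
    apply bigO_scal, bigO_add.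
    + apply (bigO_weaken q ((i * 1 + D1 - 1) + j * q)); [|rewrite Nat.mul_1_r, (Nat.mul_comm j q); lia].
      apply bigO_mul; [apply bigO_pow_increment; auto|].
      apply bigO_pow. apply bigO_add; auto. eapply bigO_weaken; eauto.
    + apply (bigO_weaken q (i * 1 + (j * q + D2 - q))); [|rewrite Nat.mul_1_r, (Nat.mul_comm j q); lia].
      apply bigO_mul; [apply bigO_pow; auto|apply bigO_pow_increment; auto].
  - apply (bigO_ext q K (fun u v =>
       (f (h1 u v + d1 u v) (h2 u v + d2 u v) - f (h1 u v) (h2 u v)) +
       (g (h1 u v + d1 u v) (h2 u v + d2 u v) - g (h1 u v) (h2 u v)))); [|intros; ring].
    apply bigO_add; auto.
Qed.

(** One factor of weight 1, resp. [q], of each monomial is traded for the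
    perturbation of order [D1], resp. [D2]. *)
Lemma analytic_increment q m K D1 D2 F h1 h2 d1 d2 : (1 <= q)%nat ->
  analytic F -> bigO q m F -> bigO q 1 h1 -> bigO q q h2 ->
  bigO q D1 d1 -> bigO q D2 d2 -> (1 <= D1)%nat -> (q <= D2)%nat ->
  (K + 1 <= m + D1)%nat -> (K + q <= m + D2)%nat ->
  bigO q K (fun u v => F (h1 u v + d1 u v) (h2 u v + d2 u v) - F (h1 u v) (h2 u v)).
Proof.
  intros Hq HF HO H1 H2 Hd1 Hd2 HD1 HD2.
  remember (K - m)%nat as n eqn:En. revert F m HF HO En.
  induction n as [|n IH]; intros F m HF HO En HK1 HK2.
  - apply bigO_sub; apply (bigO_weaken q m); try lia; apply (bigO_comp q m F); auto.
    + apply bigO_add; auto. eapply bigO_weaken; eauto.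
    + apply bigO_add; auto. eapply bigO_weaken; eauto.
  - destruct (taylor_step q m F Hq HF HO) as [P [Pu [Pv [HP HR]]]].
    apply (bigO_ext q K (fun u v =>
       (P (h1 u v + d1 u v) (h2 u v + d2 u v) - P (h1 u v) (h2 u v)) +
       ((fun x y => F x y - P x y) (h1 u v + d1 u v) (h2 u v + d2 u v)
        - (fun x y => F x y - P x y) (h1 u v) (h2 u v)))); [|intros; ring].
    apply bigO_add.
    + eapply (wpoly_increment q m K D1 D2 P); eauto.
    + apply (IH (fun x y => F x y - P x y) (S m)); auto; try lia.
      apply analytic_sub; auto. apply (wpoly_analytic q m P Pu Pv HP).
Qed.

Lemma sum_single (f : nat -> R) k n : (k <= n)%nat ->
  (forall i, (i <= n)%nat -> i <> k -> f i = 0) -> sum_n f n = f k.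
Proof.
  induction n as [|n IH]; intros Hk H.
  - replace k with 0%nat by lia. apply sum0.
  - rewrite sumS. destruct (Nat.eq_dec k (S n)) as [->|E].
    + rewrite sum_zero; [ring_sum|]. intros i Hi. apply H; lia.
    + rewrite IH, (H (S n)) by (intros; try apply H; lia). ring_sum.
Qed.

Lemma sum_pad (f : nat -> R) n m : (n <= m)%nat ->
  sum_n (fun i => if Nat.leb i n then f i else 0) m = sum_n f n.
Proof.
  induction 1 as [|m H IH].
  - apply sum_ext. intros i Hi. destruct (Nat.leb_spec i n); [reflexivity|lia].
  - rewrite sumS, IH. destruct (Nat.leb_spec (S m) n); [lia|]. ring_sum.
Qed.

Lemma qhom_polynomial q k f : qhom q k f -> polynomial2 f.
Proof.
  intros [fu [fv H]]. clear -H.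
  induction H as [c i j k Hk|k f fu fv g gu gv _ IHf _ IHg].
  - exists (i + j)%nat, (fun i' j' => if Nat.eqb i' i then if Nat.eqb j' j then c else 0 else 0).
    intros x y. symmetry.
    rewrite (sum_single _ i); [|lia|].
    + rewrite (sum_single _ j); [|lia|].
      * rewrite !Nat.eqb_refl. reflexivity.
      * intros j' _ Hj. rewrite Nat.eqb_refl. apply Nat.eqb_neq in Hj. rewrite Hj. ring.
    + intros i' _ Hi. apply sum_zero. intros j' _. apply Nat.eqb_neq in Hi. rewrite Hi. ring.
  - destruct IHf as [n [a Ha]], IHg as [m [b Hb]].
    assert (Hpad : forall n m (a : nat -> nat -> R) x y, (n <= m)%nat ->
      sum_n (fun i => sum_n (fun j => a i j * x ^ i * y ^ j) n) n =
      sum_n (fun i => sum_n (fun j =>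
        (if Nat.leb i n then if Nat.leb j n then a i j else 0 else 0) * x ^ i * y ^ j) m) m).
    { clear. intros n m a x y H. rewrite <- (sum_pad _ n m H). apply sum_ext. intros i _.
      destruct (Nat.leb i n).
      - rewrite <- (sum_pad _ n m H). apply sum_ext. intros j _.
        destruct (Nat.leb j n); [reflexivity|ring].
      - symmetry. apply sum_zero. intros; ring. }
    exists (n + m)%nat, (fun i j =>
       (if Nat.leb i n then if Nat.leb j n then a i j else 0 else 0) +
       (if Nat.leb i m then if Nat.leb j m then b i j else 0 else 0)).
    intros x y. rewrite Ha, Hb.
    rewrite (Hpad n (n + m)%nat a x y), (Hpad m (n + m)%nat b x y) by lia.
    rewrite <- sum_add. apply sum_ext. intros i _. rewrite <- sum_add. apply sum_ext.
    intros j _. ring.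
Qed.

Lemma locally_square (P : R -> R -> Prop) r : 0 < r ->
  (forall u v, Rabs u <= r -> Rabs v <= r -> P u v) -> locally_2d P 0 0.
Proof.
  intros Hr H. exists (mkposreal r Hr). simpl. intros u v Hu Hv.
  rewrite Rminus_0_r in Hu, Hv. apply H; lra.
Qed.

Lemma homogeneous_remainder_of_order n F1 F2 : analytic F1 -> analytic F2 ->
  bigO 1 n F1 -> bigO 1 n F2 -> homogeneous_remainder n (fun x y => (F1 x y, F2 x y)).
Proof.
  intros H1 H2 O1 O2.
  destruct (expansion_of_order 1 n F1 ltac:(lia) H1 O1) as [p [r [Hr [Hp [Hs _]]]]].
  destruct (expansion_of_order 1 n F2 ltac:(lia) H2 O2) as [p' [r' [Hr' [Hp' [Hs' _]]]]].
  split; [exact H1|]. split; [exact H2|].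
  exists (fun k x y => (p k x y, p' k x y)). split.
  - intros k _. split.
    + split; simpl; eapply qhom_polynomial; eauto.
    + intros l x y _. simpl.
      destruct (Hp k) as [? [? W]], (Hp' k) as [? [? W']].
      pose proof (wpoly_scale _ _ _ _ _ W l x y) as E.
      pose proof (wpoly_scale _ _ _ _ _ W' l x y) as E'.
      rewrite pow_1 in E, E'. auto.
  - apply (locally_square _ (Rmin r r')); [apply Rmin_glb_lt; auto|].
    intros x y Hx Hy. simpl.
    pose proof (Rmin_l r r'). pose proof (Rmin_r r r').
    split; [apply Hs|apply Hs']; lra.
Qed.

(** Degree [k] of a field is weight [k + 2 * l] of its second component. *)
Lemma quasi_homogeneous_remainder_of_order l N F : (1 <= l)%nat -> analytic F ->
  bigO (2 * l) (N + 2 * l) F ->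
  quasi_homogeneous_remainder l N (fun x y => (0, F x y)).
Proof.
  intros Hl H O.
  destruct (expansion_of_order (2 * l) (N + 2 * l) F ltac:(lia) H O) as [p [r [Hr [Hp [Hs _]]]]].
  split; [exact (analytic_const 0)|]. split; [exact H|].
  exists (fun k x y => (0, p (k + 2 * l)%nat x y)). split.
  - intros k _. split.
    + split; simpl.
      * exists 0%nat, (fun _ _ => 0). intros. rewrite !sum0. ring.
      * eapply qhom_polynomial; eauto.
    + intros lam x y _. cbn [fst snd].
      destruct (Hp (k + 2 * l)%nat) as [? [? W]].
      pose proof (wpoly_scale _ _ _ _ _ W lam x y) as E.
      rewrite pow_1. split; [ring|exact E].
  - apply (locally_square _ r); auto. intros x y Hx Hy. cbn [fst snd]. split.
    + exact (eq_ind _ (is_series (fun _ : nat => 0)) (finite_series (fun _ => 0) 0 (fun _ _ => eq_refl)) _ (sum0 (fun _ => 0))).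
    + eapply is_series_ext; [|apply Hs; auto]. intros k. simpl. f_equal. lia.
Qed.

(** * Gluing along the switching line *)

Definition lip (F : R -> R -> R) : Prop :=
  exists C, 0 <= C /\ forall u v u' v',
    Rabs u <= 1 -> Rabs v <= 1 -> Rabs u' <= 1 -> Rabs v' <= 1 ->
    Rabs (F u v - F u' v') <= C * (Rabs (u - u') + Rabs (v - v')).

(** Vanishing at O to second order, in Lipschitz form: unlike smallness of
    derivatives, this survives gluing along [v = 0]. *)
Definition flat (F : R -> R -> R) : Prop :=
  F 0 0 = 0 /\ exists C, 0 <= C /\ forall r u v u' v', 0 < r <= 1 ->
    Rabs u <= r -> Rabs v <= r -> Rabs u' <= r -> Rabs v' <= r ->
    Rabs (F u v - F u' v') <= C * r * (Rabs (u - u') + Rabs (v - v')).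

Lemma lip_const c : lip (fun _ _ => c).
Proof.
  exists 0. split; [lra|]. intros. rewrite Rminus_diag, Rabs_R0. lra.
Qed.

Lemma lip_u : lip (fun u _ => u).
Proof. exists 1. split; [lra|]. intros. pose proof (Rabs_pos (v - v')). lra. Qed.

Lemma lip_v : lip (fun _ v => v).
Proof. exists 1. split; [lra|]. intros. pose proof (Rabs_pos (u - u')). lra. Qed.

Lemma lip_add F G : lip F -> lip G -> lip (fun u v => F u v + G u v).
Proof.
  intros [C [HC H]] [D [HD H']]. exists (C + D). split; [lra|].
  intros u v u' v' h1 h2 h3 h4.
  specialize (H u v u' v' h1 h2 h3 h4). specialize (H' u v u' v' h1 h2 h3 h4).
  replace (F u v + G u v - (F u' v' + G u' v'))
    with ((F u v - F u' v') + (G u v - G u' v')) by ring.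
  eapply Rle_trans; [apply Rabs_triang|]. lra.
Qed.

Lemma lip_bound F : lip F -> exists C, 0 <= C /\ forall r u v,
  0 <= r <= 1 -> Rabs u <= r -> Rabs v <= r -> Rabs (F u v - F 0 0) <= C * r.
Proof.
  intros [C [HC H]]. exists (2 * C). split; [lra|]. intros r u v Hr Hu Hv.
  assert (Z : Rabs 0 <= 1) by (rewrite Rabs_R0; lra).
  assert (H1 := H u v 0 0 ltac:(lra) ltac:(lra) Z Z). rewrite !Rminus_0_r in H1. nra.
Qed.

Lemma product_increment a b a' b' A B :
  Rabs a <= A -> Rabs b' <= B ->
  Rabs (a * b - a' * b') <= A * Rabs (b - b') + B * Rabs (a - a').
Proof.
  intros HA HB. replace (a * b - a' * b') with (a * (b - b') + b' * (a - a')) by ring.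
  eapply Rle_trans; [apply Rabs_triang|]. rewrite !Rabs_mult.
  pose proof (Rabs_pos (b - b')). pose proof (Rabs_pos (a - a')).
  apply Rplus_le_compat; apply Rmult_le_compat_r; auto.
Qed.

Lemma lip_mul F G : lip F -> lip G -> lip (fun u v => F u v * G u v).
Proof.
  intros HF HG. destruct (lip_bound F HF) as [A [HA BA]]. destruct (lip_bound G HG) as [B [HB BB]].
  destruct HF as [C [HC H]], HG as [D [HD H']].
  set (A' := A + Rabs (F 0 0)). set (B' := B + Rabs (G 0 0)).
  assert (0 <= A') by (unfold A'; pose proof (Rabs_pos (F 0 0)); lra).
  assert (0 <= B') by (unfold B'; pose proof (Rabs_pos (G 0 0)); lra).
  exists (A' * D + B' * C). split; [nra|].
  intros u v u' v' h1 h2 h3 h4.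
  assert (E : forall x y z, Rabs (x - y) <= z -> Rabs x <= z + Rabs y).
  { intros x y z Hz. replace x with ((x - y) + y) by ring.
    eapply Rle_trans; [apply Rabs_triang|]. lra. }
  eapply Rle_trans; [apply (product_increment _ _ _ _ A' B')|].
  - apply E. eapply Rle_trans; [apply (BA 1); auto; lra|]. lra.
  - apply E. eapply Rle_trans; [apply (BB 1); auto; lra|]. lra.
  - specialize (H u v u' v' h1 h2 h3 h4). specialize (H' u v u' v' h1 h2 h3 h4). nra.
Qed.

Lemma flat_mul F G : lip F -> lip G -> F 0 0 = 0 -> G 0 0 = 0 -> flat (fun u v => F u v * G u v).
Proof.
  intros HF HG F0 G0. split; [rewrite F0; ring|].
  destruct (lip_bound F HF) as [A [HA BA]]. destruct (lip_bound G HG) as [B [HB BB]].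
  rewrite F0 in BA. rewrite G0 in BB.
  destruct HF as [C [HC H]], HG as [D [HD H']].
  exists (A * D + B * C). split; [nra|].
  intros r u v u' v' Hr h1 h2 h3 h4.
  eapply Rle_trans; [apply (product_increment _ _ _ _ (A * r) (B * r))|].
  - rewrite <- (Rminus_0_r (F u v)). apply BA; auto; lra.
  - rewrite <- (Rminus_0_r (G u' v')). apply BB; auto; lra.
  - assert (H1 := H u v u' v' ltac:(lra) ltac:(lra) ltac:(lra) ltac:(lra)).
    assert (H2 := H' u v u' v' ltac:(lra) ltac:(lra) ltac:(lra) ltac:(lra)).
    apply (Rmult_le_compat_l (A * r)) in H2; [|nra].
    apply (Rmult_le_compat_l (B * r)) in H1; [|nra]. lra.
Qed.

Lemma flat_add F G : flat F -> flat G -> flat (fun u v => F u v + G u v).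
Proof.
  intros [F0 [C [HC H]]] [G0 [D [HD H']]]. split; [rewrite F0, G0; ring|].
  exists (C + D). split; [lra|].
  intros r u v u' v' Hr h1 h2 h3 h4.
  specialize (H r u v u' v' Hr h1 h2 h3 h4). specialize (H' r u v u' v' Hr h1 h2 h3 h4).
  replace (F u v + G u v - (F u' v' + G u' v'))
    with ((F u v - F u' v') + (G u v - G u' v')) by ring.
  eapply Rle_trans; [apply Rabs_triang|]. lra.
Qed.

Lemma flat_zero : flat (fun _ _ => 0).
Proof.
  split; auto. exists 0. split; [lra|]. intros. rewrite Rminus_diag, Rabs_R0. lra.
Qed.

Lemma flat_scal c F : flat F -> flat (fun u v => c * F u v).
Proof.
  intros [F0 [C [HC H]]]. split; [rewrite F0; ring|].
  exists (Rabs c * C). pose proof (Rabs_pos c). split; [nra|].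
  intros r u v u' v' Hr h1 h2 h3 h4. specialize (H r u v u' v' Hr h1 h2 h3 h4).
  rewrite <- Rmult_minus_distr_l, Rabs_mult.
  apply (Rmult_le_compat_l (Rabs c)) in H; lra.
Qed.

Lemma lip_pow F n : lip F -> lip (fun u v => F u v ^ n).
Proof.
  intros H. induction n as [|n IH]; simpl; [apply lip_const|apply lip_mul; auto].
Qed.

Lemma wpoly_lip q k f fu fv : wpoly q k f fu fv -> lip f.
Proof.
  induction 1 as [c i j k Hk|]; [|apply lip_add; auto].
  apply (lip_mul (fun u v => c * u ^ i)).
  - apply (lip_mul (fun _ _ => c)); [apply lip_const|apply (lip_pow (fun u _ => u)), lip_u].
  - apply (lip_pow (fun _ v => v)), lip_v.
Qed.

Lemma wpoly_at_0 q k f fu fv : wpoly q k f fu fv -> (1 <= k)%nat -> f 0 0 = 0.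
Proof.
  induction 1 as [c i j k Hk|k f fu fv g gu gv _ IHf _ IHg]; intros H.
  - destruct i; [destruct j; [lia|]|]; simpl; ring.
  - rewrite IHf, IHg by auto. ring.
Qed.

Lemma dist0_bounds u v : Rabs u <= dist0 u v /\ Rabs v <= dist0 u v /\
  dist0 u v <= Rabs u + Rabs v.
Proof.
  unfold dist0.
  assert (E : forall x, Rabs x = sqrt (x ^ 2)).
  { intros x. rewrite <- (sqrt_Rsqr_abs x). f_equal. unfold Rsqr. ring. }
  repeat split.
  - rewrite E. apply sqrt_le_1_alt. nra.
  - rewrite E. apply sqrt_le_1_alt. nra.
  - pose proof (Rabs_pos u). pose proof (Rabs_pos v).
    rewrite <- (sqrt_Rsqr (Rabs u + Rabs v)) by lra. apply sqrt_le_1_alt.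
    rewrite <- (pow2_abs u), <- (pow2_abs v). unfold Rsqr. nra.
Qed.

Lemma flat_little_o F : flat F -> little_o F.
Proof.
  intros [F0 [C [HC H]]] eps He.
  destruct (small_radius (/ 2) eps (2 * C) ltac:(lra) He ltac:(lra)) as [d [[Hd Hd1] Hd2]].
  apply (locally_square _ d Hd). intros u v Hu Hv.
  destruct (dist0_bounds u v) as [B1 [B2 B3]].
  set (r := dist0 u v) in *.
  destruct (Req_dec r 0) as [E|E].
  - rewrite E in B1, B2. pose proof (Rabs_pos u). pose proof (Rabs_pos v).
    assert (u = 0) by (apply Rabs_eq_0; lra). assert (v = 0) by (apply Rabs_eq_0; lra).
    subst u v. rewrite F0, Rabs_R0, E. lra.
  - assert (Z : Rabs 0 <= r) by (rewrite Rabs_R0; lra).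
    assert (H1 := H r u v 0 0 ltac:(lra) B1 B2 Z Z).
    rewrite F0, !Rminus_0_r in H1. eapply Rle_trans; [exact H1|].
    assert (C * r * (Rabs u + Rabs v) <= C * r * (2 * d)).
    { apply Rmult_le_compat_l; [nra|lra]. }
    nra.
Qed.

Lemma glue_pos fp fm u v : 0 <= v -> glue fp fm u v = fp u v.
Proof. intros H. unfold glue. destruct (Rle_dec 0 v); [reflexivity|lra]. Qed.

Lemma glue_neg fp fm u v : v < 0 -> glue fp fm u v = fm u v.
Proof. intros H. unfold glue. destruct (Rle_dec 0 v); [lra|reflexivity]. Qed.

(** A segment crossing [v = 0] is cut at the crossing point, where both branches
    agree; lengths of the two pieces add up. *)
Lemma flat_glue F G : flat F -> flat G -> (forall u, F u 0 = G u 0) -> flat (glue F G).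
Proof.
  intros [F0 [C [HC H]]] [G0 [D [HD H']]] E.
  split; [rewrite glue_pos by lra; auto|].
  exists (C + D). split; [lra|].
  assert (Hmix : forall r u v u' v', 0 < r <= 1 ->
    Rabs u <= r -> Rabs v <= r -> Rabs u' <= r -> Rabs v' <= r -> 0 <= v -> v' < 0 ->
    Rabs (F u v - G u' v') <= (C + D) * r * (Rabs (u - u') + Rabs (v - v'))).
  { intros r u v u' v' Hr h1 h2 h3 h4 Hv Hv'.
    set (t := v / (v - v')). set (w := u + t * (u' - u)).
    assert (Ht : 0 <= t <= 1).
    { unfold t. split; [apply Rdiv_le_0_compat; lra|]. apply Rle_div_l; lra. }
    assert (Hw : Rabs w <= r).
    { unfold w. apply Rabs_le_between in h1. apply Rabs_le_between in h3.
      apply Rabs_le_between. nra. }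
    assert (Z : Rabs 0 <= r) by (rewrite Rabs_R0; lra).
    assert (H1 := H r u v w 0 Hr h1 h2 Hw Z). assert (H2 := H' r w 0 u' v' Hr Hw Z h3 h4).
    replace (F u v - G u' v') with ((F u v - F w 0) + (G w 0 - G u' v')) by (rewrite E; ring).
    assert (E1 : Rabs (u - w) + Rabs (w - u') = Rabs (u - u')).
    { unfold w. replace (u - (u + t * (u' - u))) with (t * (u - u')) by ring.
      replace (u + t * (u' - u) - u') with ((1 - t) * (u - u')) by ring.
      rewrite !Rabs_mult, (Rabs_pos_eq t), (Rabs_pos_eq (1 - t)) by lra. ring. }
    assert (E2 : Rabs (v - 0) + Rabs (0 - v') = Rabs (v - v')).
    { rewrite !Rabs_pos_eq by lra. ring. }
    eapply Rle_trans; [apply Rabs_triang|]. rewrite <- E1, <- E2.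
    pose proof (Rabs_pos (u - w)). pose proof (Rabs_pos (w - u')).
    pose proof (Rabs_pos (v - 0)). pose proof (Rabs_pos (0 - v')).
    assert (0 <= C * r) by nra. assert (0 <= D * r) by nra. nra. }
  intros r u v u' v' Hr h1 h2 h3 h4.
  assert (HP : 0 <= Rabs (u - u') + Rabs (v - v')).
  { pose proof (Rabs_pos (u - u')). pose proof (Rabs_pos (v - v')). lra. }
  assert (0 <= C * r * (Rabs (u - u') + Rabs (v - v'))) by (apply Rmult_le_pos; nra).
  assert (0 <= D * r * (Rabs (u - u') + Rabs (v - v'))) by (apply Rmult_le_pos; nra).
  destruct (Rle_or_lt 0 v), (Rle_or_lt 0 v').
  - rewrite !glue_pos by auto. specialize (H r u v u' v' Hr h1 h2 h3 h4). lra.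
  - rewrite glue_pos, glue_neg by auto. apply Hmix; auto.
  - rewrite glue_neg, glue_pos by auto. rewrite Rabs_minus_sym, (Rabs_minus_sym u), (Rabs_minus_sym v).
    apply Hmix; auto.
  - rewrite !glue_neg by auto. specialize (H' r u v u' v' Hr h1 h2 h3 h4). lra.
Qed.

(** Banach's fixed point theorem on a box, for contractions of ratio 1/2. *)
Lemma contraction_fixed_point (T1 T2 : R -> R -> R) r : 0 < r ->
  (forall u v u' v', Rabs u <= r -> Rabs v <= r -> Rabs u' <= r -> Rabs v' <= r ->
     Rabs (T1 u v - T1 u' v') + Rabs (T2 u v - T2 u' v')
       <= / 2 * (Rabs (u - u') + Rabs (v - v'))) ->
  Rabs (T1 0 0) + Rabs (T2 0 0) < r / 2 ->
  exists u v, Rabs u < r /\ Rabs v < r /\ T1 u v = u /\ T2 u v = v.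
Proof.
  intros Hr HT H0.
  set (p := fix p n := match n with
              | O => (0, 0)
              | S n => (T1 (fst (p n)) (snd (p n)), T2 (fst (p n)) (snd (p n))) end).
  set (a := fun n => fst (p n)). set (b := fun n => snd (p n)).
  assert (Ea : forall n, a (S n) = T1 (a n) (b n)) by reflexivity.
  assert (Eb : forall n, b (S n) = T2 (a n) (b n)) by reflexivity.
  assert (Z : Rabs 0 <= r) by (rewrite Rabs_R0; lra).
  assert (E0 : forall u v, Rabs u <= r -> Rabs v <= r ->
    Rabs (T1 u v) + Rabs (T2 u v) <= / 2 * (Rabs u + Rabs v) + (Rabs (T1 0 0) + Rabs (T2 0 0))).
  { intros u v Hu Hv. assert (H1 := HT u v 0 0 Hu Hv Z Z). rewrite !Rminus_0_r in H1.
    pose proof (Rabs_triang (T1 u v - T1 0 0) (T1 0 0)).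
    pose proof (Rabs_triang (T2 u v - T2 0 0) (T2 0 0)).
    replace (T1 u v - T1 0 0 + T1 0 0) with (T1 u v) in * by ring.
    replace (T2 u v - T2 0 0 + T2 0 0) with (T2 u v) in * by ring. lra. }
  assert (Hin : forall n, Rabs (a n) + Rabs (b n) <= r).
  { induction n as [|n IH].
    - unfold a, b; simpl. rewrite Rabs_R0. lra.
    - rewrite Ea, Eb. pose proof (Rabs_pos (a n)). pose proof (Rabs_pos (b n)).
      eapply Rle_trans; [apply E0; lra|]. lra. }
  assert (Ha : forall n, Rabs (a n) <= r).
  { intros n. specialize (Hin n). pose proof (Rabs_pos (b n)). lra. }
  assert (Hb : forall n, Rabs (b n) <= r).
  { intros n. specialize (Hin n). pose proof (Rabs_pos (a n)). lra. }
  assert (Hd : forall n, Rabs (a (S n) - a n) + Rabs (b (S n) - b n) <= r * (/ 2) ^ n).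
  { induction n as [|n IH].
    - rewrite Ea, Eb. unfold a, b; simpl. rewrite !Rminus_0_r. lra.
    - rewrite (Ea (S n)), (Ea n), (Eb (S n)), (Eb n). rewrite <- Ea, <- Eb.
      rewrite (Ea n), (Eb n). eapply Rle_trans; [apply HT; auto|].
      + rewrite <- Ea; auto.
      + rewrite <- Eb; auto.
      + rewrite <- Ea, <- Eb. simpl. lra. }
  assert (Hconv : forall c : nat -> R, c 0%nat = 0 ->
     (forall n, Rabs (c (S n) - c n) <= r * (/ 2) ^ n) -> exists l, is_lim_seq c (Finite l)).
  { intros c c0 Hc.
    assert (Hex : ex_series (fun n => c (S n) - c n)).
    { apply (ex_series_le (fun n => c (S n) - c n) (fun n => r * (/ 2) ^ n)); [exact Hc|].
      apply (ex_series_scal_l r (fun n => (/ 2) ^ n)). apply ex_series_geom.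
      rewrite Rabs_pos_eq; lra. }
    destruct Hex as [l Hl]. exists l. apply is_lim_seq_incr_1.
    apply (is_lim_seq_ext (sum_n (fun n => c (S n) - c n))); [|exact Hl].
    intros n. induction n as [|n IH]; [rewrite sum0, c0; ring|]. rewrite sumS, IH. ring_sum. }
  destruct (Hconv a) as [u Hu]; auto.
  { intros n. eapply Rle_trans; [|apply Hd]. pose proof (Rabs_pos (b (S n) - b n)). lra. }
  destruct (Hconv b) as [v Hv]; auto.
  { intros n. eapply Rle_trans; [|apply Hd]. pose proof (Rabs_pos (a (S n) - a n)). lra. }
  assert (Hle : forall (c : nat -> R) l m, is_lim_seq c (Finite l) ->
     (forall n, Rabs (c n) <= m) -> Rabs l <= m).
  { intros c l m Hc Hm. apply (is_lim_seq_le (fun n => Rabs (c n)) (fun _ => m) (Rabs l) m Hm).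
    - apply (is_lim_seq_abs c l Hc).
    - apply is_lim_seq_const. }
  assert (Hur : Rabs u <= r) by (eapply Hle; eauto).
  assert (Hvr : Rabs v <= r) by (eapply Hle; eauto).
  assert (Hs : is_lim_seq (fun n => / 2 * (Rabs (a n - u) + Rabs (b n - v))) 0).
  { assert (G : forall (c : nat -> R) l, is_lim_seq c (Finite l) ->
       is_lim_seq (fun n => Rabs (c n - l)) 0).
    { intros c l Hc. rewrite <- Rabs_R0 at 1. apply (is_lim_seq_abs _ (Finite 0)).
      replace 0 with (l - l) by ring. apply is_lim_seq_minus'; auto. apply is_lim_seq_const. }
    replace 0 with (/ 2 * (0 + 0)) by ring.
    apply (is_lim_seq_scal_l _ (/ 2) (Finite (0 + 0))). apply is_lim_seq_plus'; auto. }
  assert (Hfix : forall (c : nat -> R) T l, is_lim_seq c (Finite l) ->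
     (forall n, Rabs (c (S n) - T) <= / 2 * (Rabs (a n - u) + Rabs (b n - v))) -> T = l).
  { intros c T l Hc Hn. apply is_lim_seq_incr_1 in Hc.
    assert (H1 : is_lim_seq (fun n => c (S n) - T) (Finite 0)).
    { apply is_lim_seq_abs_0.
      apply (is_lim_seq_le_le (fun _ => 0) _ _ 0 (fun n => conj (Rabs_pos _) (Hn n))).
      - apply is_lim_seq_const.
      - exact Hs. }
    assert (H2 := is_lim_seq_minus' _ _ _ _ Hc (is_lim_seq_const T)).
    pose proof (is_lim_seq_unique _ _ H1) as U1. pose proof (is_lim_seq_unique _ _ H2) as U2.
    pose proof (eq_trans (eq_sym U1) U2) as U. injection U. lra. }
  assert (F1 : T1 u v = u).
  { apply (Hfix a); auto. intros n. rewrite Ea. eapply Rle_trans; [|apply HT; auto].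
    pose proof (Rabs_pos (T2 (a n) (b n) - T2 u v)). lra. }
  assert (F2 : T2 u v = v).
  { apply (Hfix b); auto. intros n. rewrite Eb. eapply Rle_trans; [|apply HT; auto].
    pose proof (Rabs_pos (T1 (a n) (b n) - T1 u v)). lra. }
  exists u, v. specialize (E0 u v Hur Hvr). rewrite F1, F2 in E0.
  pose proof (Rabs_pos u). pose proof (Rabs_pos v). repeat split; auto; lra.
Qed.

(** * Glued local homeomorphisms *)

Definition good_branch (h : branch) : Prop :=
  0 < q1 h /\ analytic (Phi h) /\ analytic (Psi h) /\ flat (Phi h) /\ flat (Psi h) /\
  forall u, Psi h u 0 = 0.

Definition piecewise_linear (a b x : R) : R := if Rle_dec 0 x then a * x else b * x.

Lemma piecewise_linear_lip a b x y : Rabs (piecewise_linear a b x - piecewise_linear a b y) <= (Rabs a + Rabs b) * Rabs (x - y).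
Proof.
  pose proof (Rabs_pos a). pose proof (Rabs_pos b). pose proof (Rabs_pos (x - y)).
  unfold piecewise_linear. destruct (Rle_dec 0 x), (Rle_dec 0 y).
  - rewrite <- Rmult_minus_distr_l, Rabs_mult. nra.
  - replace (a * x - b * y) with (a * x + b * (- y)) by ring.
    eapply Rle_trans; [apply Rabs_triang|]. rewrite !Rabs_mult.
    rewrite (Rabs_pos_eq x), (Rabs_pos_eq (- y)), (Rabs_pos_eq (x - y)) by lra. nra.
  - replace (b * x - a * y) with (b * x + a * (- y)) by ring.
    eapply Rle_trans; [apply Rabs_triang|]. rewrite !Rabs_mult.
    rewrite (Rabs_left1 x), (Rabs_left1 (- y)), (Rabs_left1 (x - y)) by lra. nra.
  - rewrite <- Rmult_minus_distr_l, Rabs_mult. nra.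
Qed.

Lemma piecewise_linear_inv a b x : 0 < a -> 0 < b -> piecewise_linear a b (piecewise_linear (/ a) (/ b) x) = x.
Proof.
  intros Ha Hb. pose proof (Rinv_0_lt_compat a Ha). pose proof (Rinv_0_lt_compat b Hb).
  unfold piecewise_linear. destruct (Rle_dec 0 x).
  - destruct (Rle_dec 0 (/ a * x)); [field; lra|nra].
  - destruct (Rle_dec 0 (/ b * x)); [nra|field; lra].
Qed.

Lemma piecewise_linear_inv' a b x : 0 < a -> 0 < b -> piecewise_linear (/ a) (/ b) (piecewise_linear a b x) = x.
Proof.
  intros Ha Hb. pose proof (piecewise_linear_inv (/ a) (/ b) x) as H. rewrite !Rinv_inv in H.
  apply H; apply Rinv_0_lt_compat; auto.
Qed.

Definition box (r : R) (p : R * R) : Prop := Rabs (fst p) < r /\ Rabs (snd p) < r.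

(** The local inverse is chosen point by point on a small diamond; the lower
    Lipschitz bound makes it unique and continuous. *)
Lemma local_homeomorphism_criterion (h1 h2 : R -> R -> R) r rho H L :
  0 < r -> 0 < rho -> 0 <= H -> 0 <= L -> h1 0 0 = 0 -> h2 0 0 = 0 ->
  (forall u v u' v', Rabs u < r -> Rabs v < r -> Rabs u' < r -> Rabs v' < r ->
     Rabs (h1 u v - h1 u' v') + Rabs (h2 u v - h2 u' v') <= H * (Rabs (u - u') + Rabs (v - v')) /\
     Rabs (u - u') + Rabs (v - v') <= L * (Rabs (h1 u v - h1 u' v') + Rabs (h2 u v - h2 u' v'))) ->
  (forall x y, Rabs x + Rabs y < rho -> exists u v, Rabs u < r /\ Rabs v < r /\
     h1 u v = x /\ h2 u v = y) ->
  local_homeomorphism (fun p => (h1 (fst p) (snd p), h2 (fst p) (snd p))).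
Proof.
  intros Hr Hrho HH HL Z1 Z2 Hlip Hsurj.
  set (h := fun p : R * R => (h1 (fst p) (snd p), h2 (fst p) (snd p))).
  set (V := fun p : R * R => Rabs (fst p) + Rabs (snd p) < rho).
  assert (Hs : forall p, V p -> exists p', box r p' /\ h p' = p).
  { intros [x y] HV. destruct (Hsurj x y HV) as [u [v [Hu [Hv [E1 E2]]]]].
    exists (u, v). split; [split; auto|]. unfold h; simpl. rewrite E1, E2. reflexivity. }
  set (g := fun p => match excluded_middle_informative (V p) with
     | left HV => proj1_sig (constructive_indefinite_description _ (Hs p HV))
     | right _ => (0, 0) end).
  assert (Hg : forall p, V p -> box r (g p) /\ h (g p) = p).
  { intros p HV. unfold g. destruct (excluded_middle_informative (V p)) as [HV'|]; [|tauto].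
    apply proj2_sig. }
  clearbody g.
  assert (Hcont : forall (k : R * R -> R * R) K (p : R * R) (Dom : R * R -> Prop), 0 <= K ->
    (exists e : posreal, forall p', Rabs (fst p' - fst p) + Rabs (snd p' - snd p) < e -> Dom p') ->
    (forall p', Dom p' -> Rabs (fst (k p') - fst (k p)) + Rabs (snd (k p') - snd (k p))
         <= K * (Rabs (fst p' - fst p) + Rabs (snd p' - snd p))) ->
    continuous k p).
  { intros k K p Dom HK [e He] HDom. apply filterlim_locally. intros eps.
    pose proof (cond_pos e). pose proof (cond_pos eps).
    destruct (small_radius (e / 2) eps (2 * K)) as [d [[Hd Hd1] Hd2]]; try lra.
    exists (mkposreal d Hd). refine (fun p' : R * R => _). intros [B1 B2].
    change (Rabs (fst p' - fst p) < d) in B1. change (Rabs (snd p' - snd p) < d) in B2.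
    assert (HD : Dom p') by (apply He; lra).
    specialize (HDom p' HD).
    assert (Hlt : K * (Rabs (fst p' - fst p) + Rabs (snd p' - snd p)) < eps).
    { apply Rle_lt_trans with (K * (2 * d)); [apply Rmult_le_compat_l; lra|nra]. }
    pose proof (Rabs_pos (fst (k p') - fst (k p))).
    pose proof (Rabs_pos (snd (k p') - snd (k p))).
    split; [change (Rabs (fst (k p') - fst (k p)) < eps)
           |change (Rabs (snd (k p') - snd (k p)) < eps)]; lra. }
  assert (Hopen_ball : forall p : R * R, forall e : R, 0 < e -> forall P : R * R -> Prop,
    (forall p', Rabs (fst p' - fst p) + Rabs (snd p' - snd p) < e -> P p') -> locally p P).
  { intros p e He P HP. assert (He2 : 0 < e / 2) by lra.
    exists (mkposreal _ He2). refine (fun p' : R * R => _). intros [B1 B2].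
    change (Rabs (fst p' - fst p) < e / 2) in B1. change (Rabs (snd p' - snd p) < e / 2) in B2.
    apply HP. lra. }
  assert (Hbox : forall p, box r p -> exists e : posreal, forall p',
     Rabs (fst p' - fst p) + Rabs (snd p' - snd p) < e -> box r p').
  { intros p [B1 B2].
    set (e := Rmin (r - Rabs (fst p)) (r - Rabs (snd p))).
    assert (He : 0 < e) by (apply Rmin_glb_lt; lra).
    exists (mkposreal e He). simpl. intros p' Hp'.
    assert (e <= r - Rabs (fst p)) by apply Rmin_l.
    assert (e <= r - Rabs (snd p)) by apply Rmin_r.
    pose proof (Rabs_pos (fst p' - fst p)). pose proof (Rabs_pos (snd p' - snd p)).
    pose proof (Rabs_triang (fst p' - fst p) (fst p)).
    pose proof (Rabs_triang (snd p' - snd p) (snd p)).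
    replace (fst p' - fst p + fst p) with (fst p') in * by ring.
    replace (snd p' - snd p + snd p) with (snd p') in * by ring.
    split; lra. }
  assert (HVball : forall p, V p -> exists e : posreal, forall p',
     Rabs (fst p' - fst p) + Rabs (snd p' - snd p) < e -> V p').
  { intros p HV. unfold V in *.
    assert (He : 0 < rho - (Rabs (fst p) + Rabs (snd p))) by lra.
    exists (mkposreal _ He). simpl. intros p' Hp'.
    pose proof (Rabs_triang (fst p' - fst p) (fst p)).
    pose proof (Rabs_triang (snd p' - snd p) (snd p)).
    replace (fst p' - fst p + fst p) with (fst p') in * by ring.
    replace (snd p' - snd p + snd p) with (snd p') in * by ring. lra. }
  set (U := fun p => box r p /\ V (h p)).
  assert (Hhc : forall p, box r p -> continuous h p).
  { intros p Hp. apply (Hcont h H p (box r) HH (Hbox p Hp)).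
    intros p' Hp'. apply (Hlip (fst p') (snd p') (fst p) (snd p)); apply Hp || apply Hp'. }
  exists g, U, V.
  split; [|split; [|split; [|split; [|split]]]].
  - intros p [Hp HV]. apply filter_and.
    + destruct (Hbox p Hp) as [e He]. apply (Hopen_ball p e (cond_pos e)). exact He.
    + apply (Hhc p Hp V). destruct (HVball (h p) HV) as [e He].
      apply (Hopen_ball (h p) e (cond_pos e)). exact He.
  - intros p HV. destruct (HVball p HV) as [e He]. apply (Hopen_ball p e (cond_pos e)). exact He.
  - split.
    + split; simpl; rewrite Rabs_R0; auto.
    + unfold V, h; simpl. rewrite Z1, Z2, Rabs_R0. lra.
  - unfold V; simpl. rewrite Rabs_R0. lra.
  - intros p [Hp HV]. split; auto. split; [|apply Hhc, Hp].
    destruct (Hg (h p) HV) as [Hb E].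
    assert (E1 : h1 (fst (g (h p))) (snd (g (h p))) = h1 (fst p) (snd p)) by exact (f_equal fst E).
    assert (E2 : h2 (fst (g (h p))) (snd (g (h p))) = h2 (fst p) (snd p)) by exact (f_equal snd E).
    destruct (Hlip (fst (g (h p))) (snd (g (h p))) (fst p) (snd p)) as [_ Hl];
      try apply Hb; try apply Hp.
    rewrite E1, E2, !Rminus_diag, Rabs_R0, Rplus_0_r, Rmult_0_r in Hl.
    pose proof (Rabs_pos (fst (g (h p)) - fst p)). pose proof (Rabs_pos (snd (g (h p)) - snd p)).
    change (g (h p) = p). apply injective_projections;
      apply Rminus_diag_uniq, Rabs_eq_0; lra.
  - intros p HV. destruct (Hg p HV) as [Hb E]. split; [|split; auto].
    + split; auto. rewrite E. exact HV.
    + apply (Hcont g L p V HL (HVball p HV)). intros p' HV'.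
      destruct (Hg p' HV') as [Hb' E'].
      destruct (Hlip (fst (g p')) (snd (g p')) (fst (g p)) (snd (g p))) as [_ Hl];
        try apply Hb; try apply Hb'.
      assert (E1 := f_equal fst E). assert (E2 := f_equal snd E).
      assert (E1' := f_equal fst E'). assert (E2' := f_equal snd E').
      unfold h in E1, E2, E1', E2'; simpl in E1, E2, E1', E2'.
      rewrite E1, E2, E1', E2' in Hl. exact Hl.
Qed.

(** Composed with the inverse of its piecewise linear part, the glued map is the
    identity plus a contraction. *)
Lemma glue_local_homeomorphism hp hm : good_branch hp -> good_branch hm ->
  (forall u, Phi hp u 0 = Phi hm u 0) ->
  local_homeomorphism
    (fun p => (glue_x hp hm (fst p) (snd p), glue_y hp hm (fst p) (snd p))).
Proof.
  intros [q1p [_ [_ [F1p [F2p Zp]]]]] [q1m [_ [_ [F1m [F2m Zm]]]]] Htr.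
  set (K1 := glue (Phi hp) (Phi hm)). set (K2 := glue (Psi hp) (Psi hm)).
  assert (HK1 : flat K1) by (apply flat_glue; auto).
  assert (HK2 : flat K2) by (apply flat_glue; auto; intros; rewrite Zp, Zm; reflexivity).
  set (Q1 := piecewise_linear (q1 hp) (q1 hm)). set (Q2 := piecewise_linear (q2 hp) (q2 hm)).
  set (B := piecewise_linear (/ q1 hp) (/ q1 hm)).
  assert (E1 : forall u v, glue_x hp hm u v = u + Q2 v + K1 u v).
  { intros. unfold glue_x, glue, branch_x, K1, glue, Q2, piecewise_linear. destruct (Rle_dec 0 v); ring. }
  assert (E2 : forall u v, glue_y hp hm u v = Q1 v + K2 u v).
  { intros. unfold glue_y, glue, branch_y, K2, glue, Q1, piecewise_linear. destruct (Rle_dec 0 v); ring. }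
  assert (EB1 : forall y, Q1 (B y) = y) by (intros; apply piecewise_linear_inv; auto).
  assert (EB2 : forall y, B (Q1 y) = y) by (intros; apply piecewise_linear_inv'; auto).
  destruct HK1 as [K10 [C1 [HC1 L1]]], HK2 as [K20 [C2 [HC2 L2]]].
  assert (LB := piecewise_linear_lip (/ q1 hp) (/ q1 hm)). fold B in LB.
  set (b := Rabs (/ q1 hp) + Rabs (/ q1 hm)) in *.
  assert (LQ := piecewise_linear_lip (q2 hp) (q2 hm)). fold Q2 in LQ.
  set (s := Rabs (q2 hp) + Rabs (q2 hm)) in *.
  assert (LQ1 := piecewise_linear_lip (q1 hp) (q1 hm)). fold Q1 in LQ1.
  set (m := Rabs (q1 hp) + Rabs (q1 hm)) in *.
  assert (Hb : 0 <= b) by (unfold b; pose proof (Rabs_pos (/ q1 hp)); pose proof (Rabs_pos (/ q1 hm)); lra).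
  assert (Hs : 0 <= s) by (unfold s; pose proof (Rabs_pos (q2 hp)); pose proof (Rabs_pos (q2 hm)); lra).
  assert (Hm : 0 <= m) by (unfold m; pose proof (Rabs_pos (q1 hp)); pose proof (Rabs_pos (q1 hm)); lra).
  clearbody b s m.
  assert (Z0 : forall a c, piecewise_linear a c 0 = 0) by (intros; unfold piecewise_linear; destruct (Rle_dec 0 0); ring).
  set (Lam := 1 + s * b + b).
  assert (HLam : 1 <= Lam) by (unfold Lam; nra).
  (* the inverse of the piecewise linear part is Lipschitz *)
  assert (LI : forall x y x' y',
     Rabs ((x - Q2 (B y)) - (x' - Q2 (B y'))) + Rabs (B y - B y')
       <= Lam * (Rabs (x - x') + Rabs (y - y'))).
  { intros x y x' y'.
    replace (x - Q2 (B y) - (x' - Q2 (B y'))) with ((x - x') + (Q2 (B y') - Q2 (B y))) by ring.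
    pose proof (Rabs_triang (x - x') (Q2 (B y') - Q2 (B y))) as T1.
    pose proof (LQ (B y') (B y)) as T2. pose proof (LB y y') as T3.
    rewrite (Rabs_minus_sym (B y')) in T2.
    pose proof (Rabs_pos (x - x')). pose proof (Rabs_pos (y - y')).
    assert (s * Rabs (B y - B y') <= s * (b * Rabs (y - y'))) by (apply Rmult_le_compat_l; auto).
    assert (0 <= s * b * Rabs (x - x')) by (repeat apply Rmult_le_pos; auto).
    assert (0 <= b * Rabs (x - x')) by (apply Rmult_le_pos; auto).
    unfold Lam. lra. }
  destruct (small_radius 1 (/ 2) (Lam * (C1 + C2))) as [r [Hr Hrs]]; [lra|lra|nra|].
  assert (LK : forall u v u' v', Rabs u <= r -> Rabs v <= r -> Rabs u' <= r -> Rabs v' <= r ->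
     Lam * (Rabs (K1 u v - K1 u' v') + Rabs (K2 u v - K2 u' v'))
       <= / 2 * (Rabs (u - u') + Rabs (v - v'))).
  { intros u v u' v' h1 h2 h3 h4.
    assert (M1 := L1 r u v u' v' Hr h1 h2 h3 h4). assert (M2 := L2 r u v u' v' Hr h1 h2 h3 h4).
    set (D := Rabs (u - u') + Rabs (v - v')) in *.
    assert (0 <= D) by (unfold D; pose proof (Rabs_pos (u - u')); pose proof (Rabs_pos (v - v')); lra).
    apply Rle_trans with (Lam * (C1 + C2) * r * D); [|apply Rmult_le_compat_r; lra].
    rewrite !Rmult_assoc. apply Rmult_le_compat_l; lra. }
  apply (local_homeomorphism_criterion (glue_x hp hm) (glue_y hp hm) r (r / (4 * Lam))
           (1 + s + m + (C1 + C2)) (2 * Lam)).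
  - lra.
  - apply Rdiv_lt_0_compat; lra.
  - lra.
  - lra.
  - rewrite E1, K10. unfold Q2. rewrite Z0. ring.
  - rewrite E2, K20. unfold Q1. rewrite Z0. ring.
  - intros u v u' v' h1 h2 h3 h4. rewrite !E1, !E2. split.
    + assert (M1 := L1 r u v u' v' Hr ltac:(lra) ltac:(lra) ltac:(lra) ltac:(lra)).
      assert (M2 := L2 r u v u' v' Hr ltac:(lra) ltac:(lra) ltac:(lra) ltac:(lra)).
      set (D := Rabs (u - u') + Rabs (v - v')) in *.
      assert (HD : 0 <= Rabs (u - u') /\ 0 <= Rabs (v - v')) by (split; apply Rabs_pos).
      assert (C1 * r * D <= C1 * D) by (apply Rmult_le_compat_r; [unfold D; lra|nra]).
      assert (C2 * r * D <= C2 * D) by (apply Rmult_le_compat_r; [unfold D; lra|nra]).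
      specialize (LQ v v'). specialize (LQ1 v v').
      replace (u + Q2 v + K1 u v - (u' + Q2 v' + K1 u' v'))
        with ((u - u') + (Q2 v - Q2 v') + (K1 u v - K1 u' v')) by ring.
      replace (Q1 v + K2 u v - (Q1 v' + K2 u' v'))
        with ((Q1 v - Q1 v') + (K2 u v - K2 u' v')) by ring.
      pose proof (Rabs_triang (u - u' + (Q2 v - Q2 v')) (K1 u v - K1 u' v')).
      pose proof (Rabs_triang (u - u') (Q2 v - Q2 v')).
      pose proof (Rabs_triang (Q1 v - Q1 v') (K2 u v - K2 u' v')).
      assert (s * Rabs (v - v') <= s * D) by (apply Rmult_le_compat_l; unfold D; lra).
      assert (m * Rabs (v - v') <= m * D) by (apply Rmult_le_compat_l; unfold D; lra).
      assert (Rabs (u - u') <= D) by (unfold D; lra). lra.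
    + set (x := u + Q2 v + K1 u v). set (x' := u' + Q2 v' + K1 u' v').
      set (y := Q1 v + K2 u v). set (y' := Q1 v' + K2 u' v').
      assert (M := LI (x - K1 u v) (y - K2 u v) (x' - K1 u' v') (y' - K2 u' v')).
      assert (Ey : y - K2 u v = Q1 v) by (unfold y; ring).
      assert (Ey' : y' - K2 u' v' = Q1 v') by (unfold y'; ring).
      rewrite Ey, Ey', !EB2 in M. rewrite <- Ey, <- Ey' in M.
      replace (x - K1 u v - Q2 v - (x' - K1 u' v' - Q2 v')) with (u - u') in M
        by (unfold x, x'; ring).
      assert (N := LK u v u' v' ltac:(lra) ltac:(lra) ltac:(lra) ltac:(lra)).
      replace (x - K1 u v - (x' - K1 u' v')) with ((x - x') - (K1 u v - K1 u' v')) in M by ring.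
      replace (y - K2 u v - (y' - K2 u' v')) with ((y - y') - (K2 u v - K2 u' v')) in M by ring.
      pose proof (Rabs_triang (x - x') (- (K1 u v - K1 u' v'))) as T1.
      pose proof (Rabs_triang (y - y') (- (K2 u v - K2 u' v'))) as T2.
      rewrite Rabs_Ropp in T1, T2. unfold Rminus at 1 in M. unfold Rminus at 3 in M.
      unfold Rminus in M, N, T1, T2 |- *.
      set (A3 := Rabs (x + - x')) in *. set (A4 := Rabs (y + - y')) in *.
      set (A5 := Rabs (K1 u v + - K1 u' v')) in *. set (A6 := Rabs (K2 u v + - K2 u' v')) in *.
      set (A7 := Rabs (x + - x' + - (K1 u v + - K1 u' v'))) in *.
      set (A8 := Rabs (y + - y' + - (K2 u v + - K2 u' v'))) in *.
      assert (Lam * (A7 + A8) <= Lam * (A3 + A4 + (A5 + A6))) by (apply Rmult_le_compat_l; lra).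
      lra.
  - intros x y Hxy.
    destruct (contraction_fixed_point
      (fun u v => (x - K1 u v) - Q2 (B (y - K2 u v))) (fun u v => B (y - K2 u v)) r)
      as [u [v [Hu [Hv [G1 G2]]]]].
    + lra.
    + intros u v u' v' h1 h2 h3 h4.
      eapply Rle_trans; [apply LI|].
      eapply Rle_trans; [|apply LK; eauto].
      replace (x - K1 u v - (x - K1 u' v')) with (- (K1 u v - K1 u' v')) by ring.
      replace (y - K2 u v - (y - K2 u' v')) with (- (K2 u v - K2 u' v')) by ring.
      rewrite !Rabs_Ropp. lra.
    + rewrite K10, K20, !Rminus_0_r.
      assert (M := LI x y 0 0).
      assert (B 0 = 0) as B0 by apply Z0. assert (Q2 0 = 0) as Q0 by apply Z0.
      rewrite B0, Q0, !Rminus_0_r in M.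
      assert (Lam * (Rabs x + Rabs y) < Lam * (r / (4 * Lam))) by (apply Rmult_lt_compat_l; lra).
      replace (Lam * (r / (4 * Lam))) with (r / 4) in * by (field; lra). lra.
    + exists u, v. split; auto. split; auto. rewrite E1, E2.
      rewrite G2 in G1. split; [lra|]. rewrite <- G2 at 1. rewrite EB1. ring.
Qed.

Lemma branch_y_sign h : good_branch h ->
  locally_2d (fun u v => (0 < v -> 0 < branch_y h u v) /\ (v < 0 -> branch_y h u v < 0)) 0 0.
Proof.
  intros [Hq [_ [_ [_ [[_ [C [HC L]]] Z]]]]].
  destruct (small_radius 1 (q1 h) C Rlt_0_1 Hq HC) as [r [Hr Hrs]].
  apply (locally_square _ r); [lra|]. intros u v Hu Hv.
  assert (M := L r u v u 0 Hr Hu Hv Hu ltac:(rewrite Rabs_R0; lra)).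
  rewrite Z, Rminus_diag, !Rminus_0_r, Rabs_R0, Rplus_0_l in M.
  apply Rabs_le_between in M. unfold branch_y. split; intros H.
  - rewrite (Rabs_pos_eq v) in M by lra. nra.
  - rewrite (Rabs_left v) in M by lra. nra.
Qed.

Definition conjugates (h : branch) (tau X Y : R -> R -> R) (F : R -> R -> R * R) : Prop :=
  locally_2d (fun u v =>
    transformed_field (branch_x h) (branch_y h) tau X Y u v = F u v) 0 0.

(** Off [v = 0] the glued data are those of one branch near each point, and the
    transformed field sees only them. *)
Lemma transformed_field_local h1 h2 tau X Y k1 k2 sig P Q u v :
  (forall s, h1 s v = k1 s v /\ h2 s v = k2 s v) ->
  locally v (fun s => h1 u s = k1 u s /\ h2 u s = k2 u s) ->
  tau u v = sig u v -> X (k1 u v) (k2 u v) = P (k1 u v) (k2 u v) ->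
  Y (k1 u v) (k2 u v) = Q (k1 u v) (k2 u v) ->
  transformed_field h1 h2 tau X Y u v = transformed_field k1 k2 sig P Q u v.
Proof.
  intros Hu Hv Et EX EY. unfold transformed_field.
  destruct (Hu u) as [-> ->]. rewrite Et, EX, EY.
  rewrite (Derive_ext (fun s => h1 s v) (fun s => k1 s v)) by apply Hu.
  rewrite (Derive_ext (fun s => h2 s v) (fun s => k2 s v)) by apply Hu.
  rewrite (Derive_ext_loc (fun s => h1 u s) (fun s => k1 u s))
    by (revert Hv; apply filter_imp; tauto).
  rewrite (Derive_ext_loc (fun s => h2 u s) (fun s => k2 u s))
    by (revert Hv; apply filter_imp; tauto).
  reflexivity.
Qed.

Lemma glue_transformable Xp Yp Xm Ym Fp Fm hp hm taup taum :
  good_branch hp -> good_branch hm -> (forall u, Phi hp u 0 = Phi hm u 0) ->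
  admissible_scaling taup -> admissible_scaling taum ->
  conjugates hp taup Xp Yp Fp -> conjugates hm taum Xm Ym Fm ->
  transformable_into Xp Yp Xm Ym Fp Fm.
Proof.
  intros Hp Hm Htr Htp Htm Cp Cm. exists hp, hm, taup, taum.
  split; [|split; [exact Htp|split; [exact Htm|]]].
  - split; [|split; [|split; [|split]]].
    + apply Rmult_lt_0_compat; [apply Hp|apply Hm].
    + destruct Hp as [_ [A1 [A2 [A3 [A4 _]]]]].
      repeat split; auto; apply flat_little_o; auto.
    + destruct Hm as [_ [A1 [A2 [A3 [A4 _]]]]].
      repeat split; auto; apply flat_little_o; auto.
    + apply filter_forall. intros u. split; auto. split; [apply Hp|apply Hm].
    + apply glue_local_homeomorphism; auto.
  - intros Z'.
    assert (S1 := branch_y_sign hp Hp). assert (S2 := branch_y_sign hm Hm).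
    unfold conjugates in *.
    generalize (locally_2d_and _ _ _ _ (locally_2d_and _ _ _ _ Cp Cm) (locally_2d_and _ _ _ _ S1 S2)).
    apply locally_2d_impl, locally_2d_forall. intros u v [[Ep Em] [Sp Sm]]. split; intros Hv.
    + rewrite <- Ep. apply transformed_field_local.
      * intros s. split; apply glue_pos; lra.
      * generalize (open_gt 0 v Hv). apply filter_imp. intros s Hs. split; apply glue_pos; lra.
      * apply glue_pos; lra.
      * apply glue_pos. left. apply Sp, Hv.
      * apply glue_pos. left. apply Sp, Hv.
    + rewrite <- Em. apply transformed_field_local.
      * intros s. split; apply glue_neg; lra.
      * generalize (open_lt 0 v Hv). apply filter_imp. intros s Hs. split; apply glue_neg; lra.
      * apply glue_neg; lra.
      * apply glue_neg. apply Sm, Hv.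
      * apply glue_neg. apply Sm, Hv.
Qed.

(** * The sense of rotation *)

Lemma continuous_ball f t : continuous f t ->
  forall e, 0 < e -> exists d, 0 < d /\ forall s, Rabs (s - t) < d -> Rabs (f s - f t) < e.
Proof.
  intros H e He. destruct (proj1 (filterlim_locally f (f t)) H (mkposreal e He)) as [d Hd].
  exists d. split; [apply cond_pos|]. intros s Hs. apply (Hd s). exact Hs.
Qed.

Lemma last_time (f : R -> R) a b c : a < b ->
  (forall t, a <= t <= b -> continuous f t) -> f a <= c < f b ->
  exists t, a <= t < b /\ f t = c /\ forall s, t < s <= b -> c < f s.
Proof.
  intros Hab Hc Hf.
  set (E := fun s => a <= s <= b /\ f s <= c).
  destruct (completeness E) as [t [Hub Hlub]].
  - exists b. intros s [Hs _]. lra.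
  - exists a. split; lra.
  - assert (Hat : a <= t) by (apply Hub; split; lra).
    assert (Htb : t <= b) by (apply Hlub; intros s [Hs _]; lra).
    assert (Hgt : forall s, t < s <= b -> c < f s).
    { intros s Hs. destruct (Rlt_or_le c (f s)) as [H|H]; auto.
      assert (s <= t) by (apply Hub; split; lra). lra. }
    assert (Hct := continuous_ball f t (Hc t (conj Hat Htb))).
    assert (Hle : f t <= c).
    { destruct (Rle_or_lt (f t) c) as [H|H]; auto. exfalso.
      destruct (Hct (f t - c)) as [d [Hd Hd']]; [lra|].
      assert (t <= t - d / 2); [|lra].
      apply Hlub. intros s [Hs Hfs]. destruct (Rle_or_lt s (t - d / 2)) as [H1|H1]; auto.
      exfalso. assert (s <= t) by (apply Hub; split; auto).
      assert (Hsd : Rabs (s - t) < d) by (apply Rabs_def1; lra).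
      specialize (Hd' s Hsd). apply Rabs_def2 in Hd'. lra. }
    assert (Htb' : t < b).
    { destruct Htb as [H|H]; auto. subst t. lra. }
    exists t. split; [lra|]. split; auto. apply Rle_antisym; auto.
    destruct (Rle_or_lt c (f t)) as [H|H]; auto. exfalso.
    destruct (Hct (c - f t)) as [d [Hd Hd']]; [lra|].
    set (s := Rmin (t + d / 2) b).
    assert (Hs : t < s <= b) by (split; [apply Rmin_glb_lt; lra|apply Rmin_r]).
    assert (s <= t + d / 2) by apply Rmin_l.
    assert (Hsd : Rabs (s - t) < d) by (apply Rabs_def1; lra).
    specialize (Hd' s Hsd). apply Rabs_def2 in Hd'. specialize (Hgt s Hs). lra.
Qed.

Lemma first_time (f : R -> R) a b c : a < b ->
  (forall t, a <= t <= b -> continuous f t) -> f a < c <= f b ->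
  exists t, a < t <= b /\ f t = c /\ forall s, a <= s < t -> f s < c.
Proof.
  intros Hab Hc Hf.
  destruct (last_time (fun s => - f (- s)) (- b) (- a) (- c)) as [t [Ht [Hft Hs]]].
  - lra.
  - intros t Ht. apply (continuous_opp (fun s => f (- s))).
    apply (continuous_comp Ropp f); [|apply Hc; lra].
    apply (continuous_opp (fun s : R => s) t), continuous_id.
  - rewrite !Ropp_involutive. lra.
  - exists (- t). split; [lra|]. split; [lra|]. intros s H.
    specialize (Hs (- s)). rewrite Ropp_involutive in Hs. lra.
Qed.

(** The last time at the lower level before the first time at the upper one. *)
Lemma band_crossing (f : R -> R) a b c d : a < b -> c < d ->
  (forall t, a <= t <= b -> continuous f t) -> f a <= c -> d <= f b ->
  exists t1 t2, a <= t1 < t2 /\ t2 <= b /\ f t1 = c /\ f t2 = d /\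
    forall t, t1 <= t <= t2 -> c <= f t <= d.
Proof.
  intros Hab Hcd Hc Ha Hb.
  destruct (first_time f a b d Hab Hc) as [t2 [Ht2 [E2 H2]]]; [lra|].
  destruct (last_time f a t2 c) as [t1 [Ht1 [E1 H1]]]; [lra| |lra|].
  { intros t Ht. apply Hc. lra. }
  exists t1, t2. repeat split; try lra.
  - destruct (Req_dec t t1) as [->|N]; [lra|]. left. apply H1. lra.
  - destruct (Req_dec t t2) as [->|N]; [lra|]. left. apply H2. lra.
Qed.

(** Monotonicity from a one-sided sign of the derivative off isolated points: a
    decrease would have a last time at its initial level, after which the mean
    value theorem on a punctured neighbourhood gives a contradiction. *)
Lemma increasing_off_isolated (g : R -> R) t1 t2 : t1 < t2 ->
  (forall t, t1 <= t <= t2 -> continuous g t) ->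
  (forall t, t1 <= t <= t2 -> locally' t (fun s => exists d, is_derive g s d /\ 0 <= d)) ->
  g t1 <= g t2.
Proof.
  intros Ht Hc Hd. destruct (Rle_or_lt (g t1) (g t2)) as [H|H]; auto. exfalso.
  destruct (last_time (fun s => - g s) t1 t2 (- g t1)) as [t [Htt [E Hs]]]; try lra.
  { intros t Htt. apply (continuous_opp g). auto. }
  destruct (Hd t) as [e He]; [lra|]. assert (He0 := cond_pos e).
  set (s := Rmin (t + e / 2) t2).
  assert (Hst : t < s <= t2) by (split; [apply Rmin_glb_lt; lra|apply Rmin_r]).
  assert (s <= t + e / 2) by apply Rmin_l.
  assert (Hin : forall x, t < x < s -> exists d, is_derive g x d /\ 0 <= d).
  { intros x Hx. apply He; [|lra]. change (Rabs (x - t) < e). apply Rabs_def1; lra. }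
  destruct (MVT_gen g t s (fun x => if Rlt_dec t x then if Rlt_dec x s then Derive g x else 0 else 0))
    as [x [_ Ex]].
  - intros x. rewrite Rmin_left, Rmax_right by lra. intros Hx.
    destruct (Rlt_dec t x); [|lra]. destruct (Rlt_dec x s); [|lra].
    apply Derive_correct. destruct (Hin x Hx) as [d [Hxd _]]. exists d. exact Hxd.
  - intros x. rewrite Rmin_left, Rmax_right by lra. intros Hx.
    apply continuity_pt_filterlim, Hc. lra.
  - assert (0 <= (if Rlt_dec t x then if Rlt_dec x s then Derive g x else 0 else 0)).
    { destruct (Rlt_dec t x); [|lra]. destruct (Rlt_dec x s); [|lra].
      destruct (Hin x) as [d [Hxd Hd0]]; [lra|]. rewrite (is_derive_unique _ _ _ Hxd). auto. }
    specialize (Hs s Hst). nra.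
Qed.

(** An arc of orbit within [eps] of O in the half plane [0 < sg * y], from the side
    [0 < sg * x] to the other one: what one counterclockwise turn leaves in each
    half plane. Only the field of that half plane is seen by it. *)
Definition half_turn (sg : R) (X Y : R -> R -> R) (eps : R) : Prop :=
  exists (x y : R -> R) t1 t2, t1 < t2 /\ 0 < sg * x t1 /\ sg * x t2 < 0 /\
    forall t, t1 <= t <= t2 -> continuous x t /\ continuous y t /\ 0 < sg * y t /\
      locally' t (fun s => 0 < sg * y s /\ Rabs (x s) < eps /\ Rabs (y s) < eps /\
        is_derive x s (X (x s) (y s)) /\ is_derive y s (Y (x s) (y s))).

Lemma locally'_and (t : R) (P Q : R -> Prop) : locally' t P -> locally' t Q ->
  locally' t (fun s => P s /\ Q s).
Proof. apply filter_and. Qed.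

Lemma locally_punctured (t : R) (P : R -> Prop) : locally t P -> locally' t P.
Proof. intros [e H]. exists e. intros s Hs _. apply H, Hs. Qed.

(** Starting on the positive [x] axis, the angle sweeps the two bands around the
    vertical half axes, where the orbit is away from [y = 0]. *)
Lemma half_turns Xp Yp Xm Ym : rotates_counterclockwise Xp Yp Xm Ym ->
  forall eps, 0 < eps -> half_turn 1 Xp Yp eps /\ half_turn (-1) Xm Ym eps.
Proof.
  intros H eps He. destruct (H eps He) as [delta [Hdelta Hrot]].
  assert (D0 : dist0 (delta / 2) 0 = delta / 2).
  { unfold dist0. replace ((delta / 2) ^ 2 + 0 ^ 2) with (Rsqr (delta / 2)) by (unfold Rsqr; ring).
    apply sqrt_Rsqr. lra. }
  destruct (Hrot (delta / 2) 0) as [a [T [b [x [y [th [HaT [HTb [Horb [Ex0 [Ey0 [Hth ET]]]]]]]]]]]].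
  { rewrite D0. lra. }
  assert (Hpi := PI_RGT_0).
  destruct (Hth 0) as [_ [_ [_ [Ec Es]]]]; [lra|].
  rewrite Ex0, Ey0, D0 in Ec, Es.
  assert (C0 : cos (th 0) = 1) by nra. assert (S0 : sin (th 0) = 0) by nra.
  assert (Hxy : forall t, a < t < b -> 0 < dist0 (x t) (y t) /\
     x t = dist0 (x t) (y t) * cos (th t - th 0) /\ y t = dist0 (x t) (y t) * sin (th t - th 0)).
  { intros t Ht. destruct (Hth t Ht) as [_ [[Hd _] [_ [E1 E2]]]].
    rewrite cos_minus, sin_minus, C0, S0. split; auto. split.
    - rewrite E1 at 1. ring.
    - rewrite E2 at 1. ring. }
  assert (Hcf : forall t, a < t < b -> continuous (fun t => th t - th 0) t).
  { intros t Ht. apply (continuous_minus th (fun _ => th 0)); [|apply continuous_const].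
    apply (Hth t Ht). }
  assert (Hgen : forall (sg : R) X Y, (sg = 1 \/ sg = -1) ->
    (forall px py vx vy, velocity Xp Yp Xm Ym px py vx vy -> 0 < sg * py ->
        vx = X px py /\ vy = Y px py) ->
    (exists t1 t2, 0 <= t1 < t2 /\ t2 <= T /\ 0 < sg * x t1 /\ sg * x t2 < 0 /\
       forall t, t1 <= t <= t2 -> 0 < sg * y t) ->
    half_turn sg X Y eps).
  { intros sg X Y Hsg Hv [t1 [t2 [H12 [H2T [Hx1 [Hx2 Hy]]]]]].
    exists x, y, t1, t2. split; [lra|]. split; auto. split; auto.
    intros t Ht. assert (Hat : a < t < b) by lra.
    destruct (Horb t) as [Hcx [Hcy Hloc]]; [exact (proj1 Hat)|exact (proj2 Hat)|].
    split; auto. split; auto. split; auto.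
    assert (L1 : locally t (fun s => 0 < sg * y s)).
    { destruct (continuous_ball y t Hcy (sg * y t)) as [d [Hd Hd']]; auto.
      exists (mkposreal d Hd). intros s Hs. specialize (Hd' s Hs). apply Rabs_def2 in Hd'.
      destruct Hsg; subst sg; lra. }
    assert (L2 : locally t (fun s => a < s < b)).
    { assert (Hm : 0 < Rmin (t - a) (b - t)) by (apply Rmin_glb_lt; lra).
      exists (mkposreal _ Hm). intros s Hs. change (Rabs (s - t) < Rmin (t - a) (b - t)) in Hs.
      pose proof (Rmin_l (t - a) (b - t)). pose proof (Rmin_r (t - a) (b - t)).
      apply Rabs_def2 in Hs. lra. }
    generalize (locally'_and _ _ _ Hloc
      (locally'_and _ _ _ (locally_punctured _ _ L1) (locally_punctured _ _ L2))).
    apply filter_imp. intros s [[vx [vy [Dx [Dy V]]]] [P1 P2]].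
    destruct (Hv _ _ _ _ V P1) as [-> ->].
    destruct (Hth s P2) as [_ [[_ Hde] _]]. destruct (dist0_bounds (x s) (y s)) as [B1 [B2 _]].
    split; [auto|]. split; [lra|]. split; [lra|]. split; auto. }
  assert (cpi : cos (PI / 4) > 0) by (apply cos_gt_0; lra).
  assert (c3pi : cos (3 * (PI / 4)) < 0) by (apply cos_lt_0; lra).
  split.
  - apply Hgen; auto.
    + intros px py vx vy V Hpy. apply V. lra.
    + destruct (band_crossing (fun t => th t - th 0) 0 T (PI / 4) (3 * (PI / 4)))
        as [t1 [t2 [H12 [H2T [E1 [E2 Hb]]]]]]; try lra.
      { intros t Ht. apply Hcf. lra. }
      exists t1, t2. split; [lra|]. split; [lra|].
      destruct (Hxy t1) as [D1 [X1 _]]; [lra|]. destruct (Hxy t2) as [D2 [X2 _]]; [lra|].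
      rewrite E1 in X1. rewrite E2 in X2.
      split; [nra|]. split; [nra|]. intros t Ht.
      destruct (Hxy t) as [D [_ Y]]; [lra|]. specialize (Hb t Ht).
      assert (0 < sin (th t - th 0)) by (apply sin_gt_0; lra). nra.
  - apply Hgen; auto.
    + intros px py vx vy V Hpy. apply V. lra.
    + destruct (band_crossing (fun t => th t - th 0) 0 T (PI / 4 + PI) (3 * (PI / 4) + PI))
        as [t1 [t2 [H12 [H2T [E1 [E2 Hb]]]]]]; try lra.
      { intros t Ht. apply Hcf. lra. }
      exists t1, t2. split; [lra|]. split; [lra|].
      destruct (Hxy t1) as [D1 [X1 _]]; [lra|]. destruct (Hxy t2) as [D2 [X2 _]]; [lra|].
      rewrite E1, neg_cos in X1. rewrite E2, neg_cos in X2.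
      split; [nra|]. split; [nra|]. intros t Ht.
      destruct (Hxy t) as [D [_ Y]]; [lra|]. specialize (Hb t Ht).
      assert (sin (th t - th 0) < 0) by (apply sin_lt_0; lra). nra.
Qed.

(** The coordinate [sg * x] decreases overall along a half turn, and its speed is
    [sg * X]. *)
Lemma half_turn_speed sg X Y : (sg = 1 \/ sg = -1) ->
  (forall eps, 0 < eps -> half_turn sg X Y eps) ->
  ~ locally_2d (fun x y => 0 <= sg * X x y) 0 0.
Proof.
  intros Hsg H [d Hd]. destruct (H d (cond_pos d)) as [x [y [t1 [t2 [Ht [H1 [H2 Hall]]]]]]].
  assert (Hinc : sg * x t1 <= sg * x t2); [|lra].
  apply (increasing_off_isolated (fun t => sg * x t)); auto.
  - intros t Htt. apply (continuous_scal_r sg x). apply (Hall t Htt).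
  - intros t Htt. destruct (Hall t Htt) as [_ [_ [_ L]]]. revert L. apply filter_imp.
    intros s [_ [B1 [B2 [Dx _]]]]. exists (sg * X (x s) (y s)). split.
    + apply (is_derive_scal x s sg), Dx.
    + apply Hd; rewrite Rminus_0_r; auto.
Qed.

(** The cotangent [x / y] decreases overall along a half turn, and the sign of its
    derivative is opposite to that of the angular speed. *)
Lemma half_turn_angle sg X Y : (sg = 1 \/ sg = -1) ->
  (forall eps, 0 < eps -> half_turn sg X Y eps) ->
  ~ locally_2d (fun x y => x * Y x y - y * X x y <= 0) 0 0.
Proof.
  intros Hsg H [d Hd]. destruct (H d (cond_pos d)) as [x [y [t1 [t2 [Ht [H1 [H2 Hall]]]]]]].
  assert (Hy : forall t, t1 <= t <= t2 -> 0 < sg * y t) by (intros t Htt; apply (Hall t Htt)).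
  assert (Hn : forall z, 0 < sg * z -> z <> 0) by (intros z Hz E; subst z; lra).
  assert (Hinc : x t1 / y t1 <= x t2 / y t2).
  - apply (increasing_off_isolated (fun t => x t / y t)); auto.
    + intros t Htt. destruct (Hall t Htt) as [Cx [Cy [Hyt _]]].
      apply (continuous_mult x (fun t => / y t)); auto.
      apply continuous_Rinv_comp; auto.
    + intros t Htt. destruct (Hall t Htt) as [_ [_ [_ L]]]. revert L. apply filter_imp.
      intros s [P [B1 [B2 [Dx Dy]]]].
      exists ((X (x s) (y s) * y s - x s * Y (x s) (y s)) / y s ^ 2). split.
      * apply is_derive_div; auto.
      * assert (Hsq : 0 < y s ^ 2) by (assert (y s <> 0) by auto; nra).
        apply Rdiv_le_0_compat; auto.
        assert (x s * Y (x s) (y s) - y s * X (x s) (y s) <= 0)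
          by (apply Hd; rewrite Rminus_0_r; auto). lra.
  - assert (P1 := Hy t1 ltac:(lra)). assert (P2 := Hy t2 ltac:(lra)).
    assert (Q : forall u v, sg * u < 0 -> 0 < sg * v -> u / v < 0 /\ (- u) / v > 0).
    { intros u v Hu Hv. destruct Hsg; subst sg.
      - assert (0 < / v) by (apply Rinv_0_lt_compat; lra). unfold Rdiv. nra.
      - assert (/ v < 0) by (apply Rinv_lt_0_compat; lra). unfold Rdiv. nra. }
    destruct (Q (x t2) (y t2)) as [Q1 _]; auto.
    destruct (Q (- x t1) (y t1)) as [_ Q2]; auto; [lra|]. rewrite Ropp_involutive in Q2. lra.
Qed.

(** * Parabolic type: the homological equation *)

Lemma analytic_bigO1 q F : (1 <= q)%nat -> analytic F -> F 0 0 = 0 -> bigO q 1 F.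
Proof.
  intros Hq HF H0. destruct (analytic_pser F HF) as [r [B P]].
  assert (Hr : 0 < r) by apply P. assert (HB := pser_pos _ _ _ P).
  exists (B / r), (Rmin r 1). split; [apply Rdiv_le_0_compat; lra|].
  split; [split; [apply Rmin_glb_lt; lra|apply Rmin_r]|].
  intros s u v Hs Hu Hv. assert (Rmin r 1 <= r) by apply Rmin_l.
  assert (Rmin r 1 <= 1) by apply Rmin_r.
  assert (Hsq : s ^ q <= s).
  { rewrite <- (pow_1 s) at 2. apply pow_antitone; auto; lra. }
  assert (Ht : 0 < s / r <= 1).
  { split; [apply Rdiv_lt_0_compat; lra|]. apply Rle_div_l; lra. }
  assert (P' := pser_shrink r B F P (s / r) Ht). rewrite H0, Rabs_R0, Rplus_0_l in P'.
  replace (s / r * r) with s in P' by (field; lra).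
  assert (M := pser_bound _ _ _ u v P' Hu ltac:(lra)).
  replace (B / r * s ^ 1) with (s / r * B) by (field; lra). exact M.
Qed.

Lemma analytic_near F : analytic F -> 0 < F 0 0 ->
  locally_2d (fun u v => 0 < F u v) 0 0.
Proof.
  intros HF H0.
  destruct (analytic_bigO1 1 (fun u v => F u v - F 0 0)) as [C [d [HC [Hd H]]]]; auto.
  { apply analytic_sub; auto. apply analytic_const. }
  { ring. }
  destruct (small_radius d (F 0 0) C (proj1 Hd) H0 HC) as [r [[Hr Hrd] HrC]].
  apply (locally_square _ r Hr). intros u v Hu Hv.
  specialize (H r u v (conj Hr Hrd) Hu). rewrite pow_1 in H. specialize (H Hv).
  apply Rabs_le_between in H. nra.
Qed.

Lemma analytic_near_neq F : analytic F -> F 0 0 <> 0 ->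
  locally_2d (fun u v => F u v <> 0) 0 0.
Proof.
  intros HF H0. destruct (Rtotal_order (F 0 0) 0) as [H|[H|H]]; [|lra|].
  - generalize (analytic_near (fun u v => - F u v) (analytic_opp F HF) ltac:(lra)).
    apply locally_2d_impl, locally_2d_forall. intros; lra.
  - generalize (analytic_near F HF H). apply locally_2d_impl, locally_2d_forall. intros; lra.
Qed.

(** Admissible nonlinear terms of a coordinate change; the derivatives are named
    because they enter the defects. *)
Definition perturb (F Fu Fv : R -> R -> R) : Prop :=
  analytic F /\ analytic Fu /\ analytic Fv /\
  (forall u v, is_derive (fun s => F s v) u (Fu u v)) /\
  (forall u v, is_derive (fun s => F u s) v (Fv u v)) /\ flat F.

Lemma perturb_add F Fu Fv G Gu Gv : perturb F Fu Fv -> perturb G Gu Gv ->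
  perturb (fun u v => F u v + G u v) (fun u v => Fu u v + Gu u v) (fun u v => Fv u v + Gv u v).
Proof.
  intros [A1 [A2 [A3 [D1 [D2 L]]]]] [A1' [A2' [A3' [D1' [D2' L']]]]].
  split; [apply analytic_add; auto|]. split; [apply analytic_add; auto|].
  split; [apply analytic_add; auto|]. split; [|split; [|apply flat_add; auto]].
  - intros u v. apply (is_derive_plus (fun s => F s v) (fun s => G s v)); auto.
  - intros u v. apply (is_derive_plus (fun s => F u s) (fun s => G u s)); auto.
Qed.

Lemma wpoly_perturb q k F Fu Fv : wpoly q k F Fu Fv -> flat F -> perturb F Fu Fv.
Proof.
  intros H L. destruct (wpoly_analytic _ _ _ _ _ H) as [A1 [A2 A3]].
  split; auto. split; auto. split; auto. split; [|split; auto].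
  - apply (wpoly_derive_u _ _ _ _ _ H).
  - apply (wpoly_derive_v _ _ _ _ _ H).
Qed.

Lemma perturb_zero : perturb (fun _ _ => 0) (fun _ _ => 0) (fun _ _ => 0).
Proof.
  assert (A := analytic_const 0).
  split; auto. split; auto. split; auto. split; [|split; [|apply flat_zero]];
    intros; apply (is_derive_const (V := R_NormedModule)).
Qed.

(** Common values of the two branches of the coordinate change on [v = 0]. Seen as
    functions of [(u,v)] they have the same orders for all weights, which lets the
    two half planes use different ones. *)
Definition trace (phi dphi : R -> R) : Prop :=
  perturb (fun u _ => phi u) (fun u _ => dphi u) (fun _ _ => 0) /\
  forall q, bigO q 2 (fun u _ => phi u) /\ bigO q 1 (fun u _ => dphi u).

Lemma trace_zero : trace (fun _ => 0) (fun _ => 0).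
Proof. split; [apply perturb_zero|]. intros q. split; apply bigO_zero. Qed.

Lemma trace_add_monomial phi dphi a s : trace phi dphi -> (2 <= s)%nat ->
  trace (fun u => phi u + a * u ^ s) (fun u => dphi u + a * (INR s * u ^ (s - 1))).
Proof.
  intros [P O] Hs. split.
  - assert (W : perturb (fun u v => a * u ^ s) (fun u v => a * (INR s * u ^ (s - 1)))
                  (fun _ _ => 0)).
    { assert (W := wp_mono 1 a s 0 s ltac:(lia)).
      replace (fun u v : R => a * u ^ s * v ^ 0) with (fun u v : R => a * u ^ s) in W
        by (apply fun2_ext; intros; simpl; ring).
      replace (fun u v : R => a * (INR s * u ^ (s - 1)) * v ^ 0)
        with (fun u v : R => a * (INR s * u ^ (s - 1))) in W
        by (apply fun2_ext; intros; simpl; ring).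
      replace (fun u v : R => a * u ^ s * (INR 0 * v ^ (0 - 1)))
        with (fun u v : R => 0) in W by (apply fun2_ext; intros; simpl; ring).
      apply (wpoly_perturb 1 s); auto.
      assert (L : flat (fun u v => u * (a * u ^ (s - 1)))).
      { apply flat_mul; [apply lip_u| |ring|].
        - apply (lip_mul (fun _ _ => a)); [apply lip_const|apply (lip_pow (fun u _ => u)), lip_u].
        - destruct s as [|[|s]]; [lia|lia|]. simpl. ring. }
      replace (fun u v : R => a * u ^ s) with (fun u v : R => u * (a * u ^ (s - 1))); auto.
      apply fun2_ext. intros. destruct s; [lia|]. simpl. rewrite Nat.sub_0_r. ring. }
    assert (Q := perturb_add _ _ _ _ _ _ P W).
    replace (fun _ _ : R => 0) with (fun _ _ : R => 0 + 0) by (apply fun2_ext; intros; ring).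
    exact Q.
  - intros q. destruct (O q) as [O1 O2]. split; apply bigO_add; auto.
    + apply bigO_scal. apply (bigO_weaken q (s * 1)); [|lia]. apply (bigO_pow q 1), bigO_u.
    + apply bigO_scal, bigO_scal. apply (bigO_weaken q ((s - 1) * 1)); [|lia].
      apply (bigO_pow q 1), bigO_u.
Qed.

Lemma derive_branch (q1 q2 : R) (P Pu Pv S Su Sv : R -> R -> R) u v :
  perturb P Pu Pv -> perturb S Su Sv ->
  let h := Branch q1 q2 P S in
  Derive (fun s => branch_x h s v) u = 1 + Pu u v /\
  Derive (fun s => branch_x h u s) v = q2 + Pv u v /\
  Derive (fun s => branch_y h s v) u = Su u v /\
  Derive (fun s => branch_y h u s) v = q1 + Sv u v.
Proof.
  intros [_ [_ [_ [D1 [D2 _]]]]] [_ [_ [_ [D3 [D4 _]]]]] h.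
  unfold branch_x, branch_y, h; simpl.
  repeat split; apply is_derive_unique.
  - apply (is_derive_plus (fun s => s + q2 * v) (fun s => P s v)); auto. auto_derive; auto.
  - apply (is_derive_plus (fun s => u + q2 * s) (fun s => P u s)); auto. auto_derive; auto. ring.
  - replace (Su u v) with (0 + Su u v) by ring.
    apply (is_derive_plus (fun s => q1 * v) (fun s => S s v)); auto. auto_derive; auto.
  - apply (is_derive_plus (fun s => q1 * s) (fun s => S u s)); auto. auto_derive; auto. ring.
Qed.

(** Only the value at [u] of the linear coefficient matters: replacing [u + eta] by
    [u] there costs one more order. *)
Lemma bigO_pow_linear q s n (eta d : R -> R -> R) :
  bigO q 2 eta -> bigO q s d -> (2 <= s)%nat ->
  bigO q (n + s) (fun u v => (u + eta u v + d u v) ^ n - (u + eta u v) ^ n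
                              - INR n * u ^ (n - 1) * d u v).
Proof.
  intros He Hd Hs.
  assert (Hh : bigO q 1 (fun u v => u + eta u v)).
  { apply bigO_add; [apply bigO_u|]. apply (bigO_weaken q 2); auto. }
  assert (Hed : bigO q 2 (fun u v => eta u v + d u v)).
  { apply bigO_add; auto. apply (bigO_weaken q s); auto. }
  induction n as [|n IH].
  - eapply bigO_ext; [apply bigO_zero|]. intros; simpl; ring.
  - apply (bigO_ext q _ (fun u v =>
      u * ((u + eta u v + d u v) ^ n - (u + eta u v) ^ n - INR n * u ^ (n - 1) * d u v) +
      ((eta u v + d u v) * ((u + eta u v + d u v) ^ n - (u + eta u v) ^ n) +
       d u v * ((u + eta u v) ^ n - u ^ n)))).
    + apply bigO_add; [|apply bigO_add].
      * apply (bigO_mul q 1 (n + s)); auto. apply bigO_u.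
      * apply (bigO_weaken q (2 + (n * 1 + s - 1))); [|lia]. apply bigO_mul; auto.
        apply (bigO_pow_increment q 1 s n (fun u v => u + eta u v) d); auto. lia.
      * apply (bigO_weaken q (s + (n * 1 + 2 - 1))); [|lia]. apply bigO_mul; auto.
        apply (bigO_pow_increment q 1 2 n (fun u v => u) eta); auto. apply bigO_u.
    + intros u v. rewrite S_INR. destruct n as [|n]; [simpl; ring|].
      replace (S (S n) - 1)%nat with (S n) by lia. replace (S n - 1)%nat with n by lia.
      simpl. ring.
Qed.

(** Failure of [x = u + phi(u)], [y = c * v + S(u,v)] to carry the orbits of
    [dv/du = k * g(u)] to those of [dy/dx = f(x,y)]. *)
Definition slope_defect (k : R) (f : R -> R -> R) (c : R) (phi dphi : R -> R)
    (S Su Sv : R -> R -> R) (g : R -> R) (u v : R) : R :=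
  (1 + dphi u) * f (u + phi u) (c * v + S u v) - Su u v - k * g u * (c + Sv u v).

Definition slope_state (l : nat) (k : R) (f : R -> R -> R) (c : R) (phi dphi : R -> R)
    (S Su Sv : R -> R -> R) (g : R -> R) (w : nat) : Prop :=
  trace phi dphi /\ perturb S Su Sv /\ (forall u, S u 0 = 0) /\
  bigO (2 * l) (2 * l + 1) S /\ bigO (2 * l) 1 Sv /\
  analytic (fun u _ => g u) /\
  bigO (2 * l) (2 * l) (fun u _ => g u - u ^ (2 * l - 1)) /\
  bigO (2 * l) w (slope_defect k f c phi dphi S Su Sv g).

(** A slope field whose part of lowest weight is that of an invisible tangency of
    multiplicity [2 * l - 1]. *)
Definition fold_slope (l : nat) (k c : R) (f : R -> R -> R) : Prop :=
  (1 <= l)%nat /\ analytic f /\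
  bigO (2 * l) (2 * l) (fun x y => f x y - k * c * x ^ (2 * l - 1)).

Lemma fold_slope_rest l k c f : analytic f ->
  analytic (fun x y => f x y - k * c * x ^ (2 * l - 1)).
Proof.
  intros Hf. apply (analytic_sub f); auto.
  apply (analytic_mul (fun _ _ => k * c)); [apply analytic_const|].
  apply (analytic_pow (fun x _ => x)), analytic_x.
Qed.

Lemma fold_slope_along l k c f eta h2 : fold_slope l k c f ->
  bigO (2 * l) 2 eta -> bigO (2 * l) (2 * l) h2 ->
  bigO (2 * l) (2 * l) (fun u v => f (u + eta u v) (h2 u v) - k * c * u ^ (2 * l - 1)).
Proof.
  intros [Hl [Hf HO]] He H2.
  apply (bigO_ext _ _ (fun u v =>
    (fun x y => f x y - k * c * x ^ (2 * l - 1)) (u + eta u v) (h2 u v) +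
    k * c * ((u + eta u v) ^ (2 * l - 1) - u ^ (2 * l - 1)))).
  - apply bigO_add.
    + apply (bigO_comp (2 * l) (2 * l) (fun x y => f x y - k * c * x ^ (2 * l - 1))); auto; [lia|].
      apply bigO_add; [apply bigO_u|]. apply (bigO_weaken _ 2); auto.
    + apply bigO_scal. apply (bigO_weaken _ ((2 * l - 1) * 1 + 2 - 1)); [|lia].
      apply (bigO_pow_increment (2 * l) 1 2 (2 * l - 1) (fun u v => u) eta); auto. apply bigO_u.
  - intros; simpl; ring.
Qed.

(** The leading slope operator sends [u^(i+1) v^(j+1)] to a nonzero multiple of
    [u^i v^(j+1)] plus a monomial with one factor [v] less, so that by induction on
    the power of [v] only [u ^ w] is left out of its image on multiples of [v]. *)
Lemma slope_homological l k w P Pu Pv : (1 <= l)%nat -> wpoly (2 * l) w P Pu Pv ->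
  exists rho D Du Dv, wpoly (2 * l) (w + 1) D Du Dv /\ flat D /\ (forall u, D u 0 = 0) /\
    forall u v, Du u v + k * u ^ (2 * l - 1) * Dv u v + rho * u ^ w = P u v.
Proof.
  intros Hl H. induction H as [c i j w Hw|w f fu fv g gu gv _ IHf _ IHg].
  - revert c i Hw. induction j as [|j IH]; intros c i Hw.
    + replace i with w by lia.
      eexists c, _, _, _. split; [apply (wp_mono (2 * l) 0 (w + 1) 0); lia|].
      split; [|split].
      * replace (fun u v : R => 0 * u ^ (w + 1) * v ^ 0) with (fun _ _ : R => 0).
        -- apply flat_zero.
        -- apply fun2_ext; intros; ring.
      * intros; ring.
      * intros; simpl; ring.
    + set (a := c / INR (S i)).
      assert (HI : INR (S i) <> 0) by (apply not_0_INR; lia).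
      destruct (IH (- (k * (a * INR (S j)))) (i + 2 * l)%nat) as [rho [D [Du [Dv [W [L [Z E]]]]]]].
      { nia. }
      eexists rho, _, _, _. split; [|split; [|split]].
      * apply wp_add; [apply (wp_mono (2 * l) a (S i) (S j)); nia|exact W].
      * apply flat_add; auto.
        replace (fun u v : R => a * u ^ S i * v ^ S j)
          with (fun u v : R => (a * u ^ S i * v ^ j) * v)
          by (apply fun2_ext; intros; simpl; ring).
        apply flat_mul; [|apply lip_v|simpl; ring|ring].
        eapply wpoly_lip, (wp_mono 1 a (S i) j _ eq_refl).
      * intros u. cbv beta. rewrite (Z u). simpl. ring.
      * intros u v. replace (S i - 1)%nat with i by lia. replace (S j - 1)%nat with j by lia.
        assert (E' := E u v). rewrite pow_add in E'.
        assert (Ea : a * INR (S i) = c) by (unfold a; field; auto).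
        assert (E2 : u ^ (2 * l) = u * u ^ (2 * l - 1)).
        { replace (2 * l)%nat with (S (2 * l - 1)) at 1 by lia.
          reflexivity. }
        rewrite E2 in E'.
        replace (c * u ^ i * v ^ S j) with (a * INR (S i) * u ^ i * v ^ S j) by (rewrite Ea; ring).
        replace (Du u v) with (- (k * (a * INR (S j))) * (u ^ i * (u * u ^ (2 * l - 1))) * v ^ j
           - k * u ^ (2 * l - 1) * Dv u v - rho * u ^ w) by (rewrite <- E'; ring).
        simpl pow. ring.
  - destruct IHf as [r1 [D1 [D1u [D1v [W1 [L1 [Z1 E1]]]]]]].
    destruct IHg as [r2 [D2 [D2u [D2v [W2 [L2 [Z2 E2]]]]]]].
    eexists (r1 + r2), _, _, _. split; [exact (wp_add _ _ _ _ _ _ _ _ W1 W2)|]. split; [apply flat_add; auto|].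
    split.
    + intros u. cbv beta. rewrite (Z1 u), (Z2 u). ring.
    + intros u v. cbv beta. rewrite <- E1, <- E2. ring.
Qed.

Lemma slope_defect_analytic l k f c phi dphi S Su Sv g w : fold_slope l k c f ->
  slope_state l k f c phi dphi S Su Sv g w -> analytic (slope_defect k f c phi dphi S Su Sv g).
Proof.
  intros [_ [Af _]] [[[A1 [A2 [_ [_ [_ [F0 _]]]]]] _] [[A3 [A4 [A5 _]]] [Z [_ [_ [Ag _]]]]]].
  assert (A : forall a G, analytic G -> analytic (fun u v => a * G u v)).
  { intros a G. apply (analytic_mul (fun _ _ => a)), analytic_const. }
  unfold slope_defect. apply analytic_sub; [apply analytic_sub; auto|].
  - apply (analytic_mul (fun u _ => 1 + dphi u)).
    + apply (analytic_add (fun _ _ => 1)); [apply analytic_const|auto].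
    + apply (analytic_comp f (fun u v => u + phi u) (fun u v => c * v + S u v)); auto.
      * apply analytic_add; [apply analytic_x|auto].
      * apply analytic_add; [apply A, analytic_y|auto].
      * rewrite F0. ring.
      * rewrite Z. ring.
  - apply (analytic_mul (fun u _ => k * g u)); [apply (A k (fun u _ => g u)); auto|].
    apply (analytic_add (fun _ _ => c)); [apply analytic_const|auto].
Qed.

(** The part of [f] depending on [x] only does not see a change of [S], and the rest
    has order [2 * l]; so in weight [w] the defect changes by the leading slope
    operator alone. *)
Lemma slope_step l k f c phi dphi S Su Sv g w : fold_slope l k c f -> (2 * l <= w)%nat ->
  slope_state l k f c phi dphi S Su Sv g w ->
  exists S' Su' Sv' rho, slope_state l k f c phi dphi S' Su' Sv' g w /\
    bigO (2 * l) (w + 1)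
      (fun u v => slope_defect k f c phi dphi S' Su' Sv' g u v - rho * u ^ w).
Proof.
  intros Hf Hw HS. assert (AE := slope_defect_analytic _ _ _ _ _ _ _ _ _ _ _ Hf HS).
  destruct HS as [Tr [PS [ZS [OS [OSv [Ag [Og OE]]]]]]].
  destruct Hf as [Hl [Af Of]].
  destruct (proj2 Tr (2 * l)%nat) as [Ophi Odphi].
  assert (Hq : (1 <= 2 * l)%nat) by lia.
  destruct (taylor_step (2 * l) w _ Hq AE OE) as [P [Pu [Pv [WP RP]]]].
  destruct (slope_homological l k w P Pu Pv Hl WP) as [rho [D [Du [Dv [WD [LD [ZD ED]]]]]]].
  assert (OD := wpoly_bigO _ _ _ _ _ WD).
  assert (ODv := wpoly_bigO_v _ _ _ _ _ WD).
  assert (Hres : bigO (2 * l) (w + 1) (fun u v =>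
     slope_defect k f c phi dphi (fun u v => S u v + D u v) (fun u v => Su u v + Du u v)
       (fun u v => Sv u v + Dv u v) g u v - rho * u ^ w)).
  { set (f1 := fun x y => f x y - k * c * x ^ (2 * l - 1)).
    apply (bigO_ext _ _ (fun u v =>
      (slope_defect k f c phi dphi S Su Sv g u v - P u v) +
      ((1 + dphi u) * (f1 (u + phi u + 0) (c * v + S u v + D u v) - f1 (u + phi u) (c * v + S u v))
       - k * (g u - u ^ (2 * l - 1)) * Dv u v))).
    - apply bigO_add; [apply (bigO_weaken _ (Datatypes.S w)); [exact RP|lia]|]. apply bigO_sub.
      + replace (w + 1)%nat with (0 + (w + 1))%nat by lia.
        apply (bigO_mul _ 0 (w + 1) (fun u _ => 1 + dphi u)).
        * apply (bigO_add _ 0 (fun _ _ => 1)); [apply bigO_const|].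
          apply (bigO_weaken _ 1); auto.
        * apply (analytic_increment (2 * l) (2 * l) (w + 1) (w + 2) (w + 1) f1
             (fun u v => u + phi u) (fun u v => c * v + S u v) (fun _ _ => 0) D); auto; try lia.
          -- apply fold_slope_rest; auto.
          -- apply bigO_add; [apply bigO_u|]. apply (bigO_weaken _ 2); auto.
          -- apply bigO_add; [apply bigO_scal, bigO_v|].
             apply (bigO_weaken _ (2 * l + 1)); [auto|lia].
          -- apply bigO_zero.
      + apply (bigO_weaken _ (2 * l + (w + 1 - 2 * l))); [|lia].
        apply (bigO_mul _ _ _ (fun u _ => k * (g u - u ^ (2 * l - 1)))); auto.
        apply (bigO_scal _ _ k (fun u _ => g u - u ^ (2 * l - 1))); auto.
    - intros u v. unfold slope_defect, f1. rewrite <- ED, Rplus_0_r, !Rplus_assoc. ring. }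
  exists (fun u v => S u v + D u v), (fun u v => Su u v + Du u v),
         (fun u v => Sv u v + Dv u v), rho.
  split; [|exact Hres].
  split; auto. split.
  { apply perturb_add; auto. eapply wpoly_perturb; eauto. }
  split; [intros u; rewrite ZS, ZD; ring|]. split.
  { apply bigO_add; auto. apply (bigO_weaken _ (w + 1)); [auto|lia]. }
  split.
  { apply bigO_add; auto. apply (bigO_weaken _ (w + 1 - 2 * l)); [auto|lia]. }
  split; auto. split; auto.
  apply (bigO_ext _ _ (fun u v =>
     (slope_defect k f c phi dphi (fun u v => S u v + D u v) (fun u v => Su u v + Du u v)
       (fun u v => Sv u v + Dv u v) g u v - rho * u ^ w) + rho * u ^ w)); [|intros; ring].
  apply bigO_add; [eapply bigO_weaken; [exact Hres|lia]|].
  apply bigO_scal. apply (bigO_weaken _ (w * 1)); [|lia]. apply (bigO_pow _ 1), bigO_u.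
Qed.

(** In the upper half plane, where the trace is imposed, the leftover becomes the
    coefficient of the normal form. *)
Lemma slope_absorb_sigma l k f c phi dphi S Su Sv g w rho : fold_slope l k c f ->
  (2 * l <= w)%nat -> k * k = 1 -> c <> 0 ->
  slope_state l k f c phi dphi S Su Sv g w ->
  bigO (2 * l) (w + 1) (fun u v => slope_defect k f c phi dphi S Su Sv g u v - rho * u ^ w) ->
  slope_state l k f c phi dphi S Su Sv (fun u => g u + k * rho / c * u ^ w) (w + 1).
Proof.
  intros Hf Hw Hk Hc [Tr [PS [ZS [OS [OSv [Ag [Og OE]]]]]]] HR.
  split; auto. split; auto. split; auto. split; auto. split; auto.
  assert (Ow : bigO (2 * l) w (fun u _ => k * rho / c * u ^ w)).
  { apply bigO_scal. apply (bigO_weaken _ (w * 1)); [|lia]. apply (bigO_pow _ 1), bigO_u. }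
  split; [|split].
  - apply (analytic_add (fun u _ => g u)); auto.
    apply (analytic_mul (fun _ _ => k * rho / c)); [apply analytic_const|].
    apply (analytic_pow (fun u _ => u)), analytic_x.
  - apply (bigO_ext _ _ (fun u _ => (g u - u ^ (2 * l - 1)) + k * rho / c * u ^ w));
      [|intros; ring].
    apply bigO_add; auto. eapply bigO_weaken; eauto.
  - apply (bigO_ext _ _ (fun u v => (slope_defect k f c phi dphi S Su Sv g u v - rho * u ^ w)
         - k * (k * rho / c * u ^ w * Sv u v))).
    + apply bigO_sub; auto. apply bigO_scal. apply (bigO_mul _ w 1); auto.
    + intros u v. unfold slope_defect.
      replace (rho * u ^ w) with (k * k * rho / c * u ^ w * c) by (rewrite Hk; field; auto).
      unfold Rdiv. ring.
Qed.

(** In the lower half plane the trace is free. A new term [a * u ^ s] of it enters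
    through [dphi] and through the argument of the leading slope, and together they
    change the coefficient of [u ^ w] by [k * c * (w + 1) * a]. *)
Lemma slope_absorb_trace l k f c phi dphi S Su Sv g w rho : fold_slope l k c f ->
  (2 * l <= w)%nat -> k * k = 1 -> c <> 0 ->
  slope_state l k f c phi dphi S Su Sv g w ->
  bigO (2 * l) (w + 1) (fun u v => slope_defect k f c phi dphi S Su Sv g u v - rho * u ^ w) ->
  exists phi' dphi', slope_state l k f c phi' dphi' S Su Sv g (w + 1).
Proof.
  intros Hf Hw Hk Hc [Tr [PS [ZS [OS [OSv [Ag [Og OE]]]]]]] HR.
  set (s := (w - 2 * l + 2)%nat). set (n := (2 * l - 1)%nat).
  assert (Hl := proj1 Hf).
  assert (Hk0 : k <> 0) by (intros E; subst k; lra).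
  assert (HI : INR (w + 1) <> 0) by (apply not_0_INR; lia).
  set (a := - (rho / (k * c * INR (w + 1)))).
  set (d := fun u v : R => a * u ^ s). set (d' := fun u v : R => a * (INR s * u ^ (s - 1))).
  assert (Od : bigO (2 * l) s d).
  { apply bigO_scal. apply (bigO_weaken _ (s * 1)); [|lia]. apply (bigO_pow _ 1), bigO_u. }
  assert (Od' : bigO (2 * l) (s - 1) d').
  { apply bigO_scal, bigO_scal. apply (bigO_weaken _ ((s - 1) * 1)); [|lia].
    apply (bigO_pow _ 1), bigO_u. }
  assert (Hs : (2 <= s)%nat) by (unfold s; lia).
  assert (Tr' := trace_add_monomial phi dphi a s Tr Hs).
  exists (fun u => phi u + a * u ^ s), (fun u => dphi u + a * (INR s * u ^ (s - 1))).
  split; auto. split; auto. split; auto. split; auto. split; auto. split; auto. split; auto.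
  destruct (proj2 Tr (2 * l)%nat) as [Ophi Odphi].
  destruct (proj2 Tr' (2 * l)%nat) as [Ophi' _].
  assert (Oh2 : bigO (2 * l) (2 * l) (fun u v => c * v + S u v)).
  { apply bigO_add; [apply bigO_scal, bigO_v|]. apply (bigO_weaken _ (2 * l + 1)); [auto|lia]. }
  set (f1 := fun x y => f x y - k * c * x ^ n).
  set (inc := fun u v => f (u + phi u + d u v) (c * v + S u v) - f (u + phi u) (c * v + S u v)).
  assert (Oinc : bigO (2 * l) (w + 1) (fun u v => inc u v - k * c * (INR n * u ^ (n - 1) * d u v))).
  { apply (bigO_ext _ _ (fun u v =>
      (f1 (u + phi u + d u v) (c * v + S u v + 0) - f1 (u + phi u) (c * v + S u v)) +
      k * c * ((u + phi u + d u v) ^ n - (u + phi u) ^ n - INR n * u ^ (n - 1) * d u v))).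
    - apply bigO_add.
      + apply (analytic_increment (2 * l) (2 * l) (w + 1) s (w + 1) f1
             (fun u v => u + phi u) (fun u v => c * v + S u v) d (fun _ _ => 0));
          auto; try (unfold s; lia); try apply Hf.
        * apply fold_slope_rest, Hf.
        * apply bigO_add; [apply bigO_u|]. apply (bigO_weaken _ 2); auto.
        * apply bigO_zero.
      + apply bigO_scal. apply (bigO_weaken _ (n + s)); [|unfold n, s; lia].
        apply (bigO_pow_linear (2 * l) s n (fun u _ => phi u) d); auto.
    - intros u v. unfold inc, f1. rewrite Rplus_0_r. ring. }
  assert (Olead : bigO (2 * l) w (fun u v => k * c * (INR n * u ^ (n - 1) * d u v))).
  { apply bigO_scal. apply (bigO_weaken _ ((n - 1) * 1 + s)); [|unfold n, s; lia].
    apply (bigO_mul _ ((n - 1) * 1) s (fun u _ => INR n * u ^ (n - 1))); auto.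
    apply bigO_scal, (bigO_pow _ 1), bigO_u. }
  assert (Oinc0 : bigO (2 * l) w inc).
  { apply (bigO_ext _ _ (fun u v => (inc u v - k * c * (INR n * u ^ (n - 1) * d u v)) +
        k * c * (INR n * u ^ (n - 1) * d u v))); [|intros; ring].
    apply bigO_add; auto. eapply bigO_weaken; [exact Oinc|lia]. }
  assert (Oalong := fold_slope_along l k c f (fun u v => phi u + d u v)
      (fun u v => c * v + S u v) Hf Ophi' Oh2). cbv beta in Oalong. fold n in Oalong.
  apply (bigO_ext _ _ (fun u v =>
     (slope_defect k f c phi dphi S Su Sv g u v - rho * u ^ w) +
     ((inc u v - k * c * (INR n * u ^ (n - 1) * d u v)) +
      (dphi u * inc u v +
       d' u v * (f (u + (phi u + d u v)) (c * v + S u v) - k * c * u ^ n))))).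
  - apply bigO_add; auto. apply bigO_add; auto. apply bigO_add.
    + apply (bigO_weaken _ (1 + w)); [|lia].
      apply (bigO_mul _ 1 w (fun u _ => dphi u)); auto.
    + apply (bigO_weaken _ (s - 1 + 2 * l)); [|unfold s; lia]. apply bigO_mul; auto.
  - intros u v. unfold slope_defect, inc.
    assert (Ew : rho * u ^ w = - (k * c * (INR n * u ^ (n - 1) * d u v) + d' u v * (k * c * u ^ n))).
    { unfold d, d', a.
      assert (E1 : u ^ (n - 1) * u ^ s = u ^ w) by (rewrite <- pow_add; f_equal; unfold n, s; lia).
      assert (E2 : u ^ (s - 1) * u ^ n = u ^ w) by (rewrite <- pow_add; f_equal; unfold n, s; lia).
      replace (k * c * (INR n * u ^ (n - 1) * (- (rho / (k * c * INR (w + 1))) * u ^ s)))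
        with (- (rho / INR (w + 1)) * INR n * (u ^ (n - 1) * u ^ s)) by (field; auto).
      replace (- (rho / (k * c * INR (w + 1))) * (INR s * u ^ (s - 1)) * (k * c * u ^ n))
        with (- (rho / INR (w + 1)) * INR s * (u ^ (s - 1) * u ^ n)) by (field; auto).
      rewrite E1, E2.
      replace (INR (w + 1)) with (INR n + INR s) in * by
        (rewrite <- plus_INR; f_equal; unfold n, s; lia).
      field. auto. }
    rewrite Ew. replace (u + (phi u + d u v)) with (u + phi u + d u v) by ring.
    unfold d, d'. rewrite <- !Rplus_assoc. ring.
Qed.

(** * Parabolic type: normal forms *)

Lemma slope_start l k f c phi dphi : fold_slope l k c f -> trace phi dphi ->
  slope_state l k f c phi dphi (fun _ _ => 0) (fun _ _ => 0) (fun _ _ => 0)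
    (fun u => u ^ (2 * l - 1)) (2 * l).
Proof.
  intros Hf Tr. assert (Hl := proj1 Hf). destruct (proj2 Tr (2 * l)%nat) as [O1 O2].
  split; auto. split; [apply perturb_zero|]. split; auto. split; [apply bigO_zero|].
  split; [apply bigO_zero|]. split.
  { apply (analytic_pow (fun u _ => u)), analytic_x. }
  split.
  { eapply bigO_ext; [apply bigO_zero|]. intros; simpl; ring. }
  assert (Oh2 : bigO (2 * l) (2 * l) (fun u v => c * v + 0)).
  { apply bigO_add; [apply bigO_scal, bigO_v|apply bigO_zero]. }
  assert (A := fold_slope_along l k c f (fun u _ => phi u) (fun u v => c * v + 0) Hf O1 Oh2).
  cbv beta in A.
  apply (bigO_ext _ _ (fun u v =>
     (f (u + phi u) (c * v + 0) - k * c * u ^ (2 * l - 1)) +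
     dphi u * ((f (u + phi u) (c * v + 0) - k * c * u ^ (2 * l - 1)) + k * c * u ^ (2 * l - 1)))).
  - apply bigO_add; auto. apply (bigO_weaken _ (1 + (2 * l - 1))); [|lia].
    apply (bigO_mul _ 1 (2 * l - 1) (fun u _ => dphi u)); auto.
    apply bigO_add; [apply (bigO_weaken _ (2 * l)); [auto|lia]|].
    apply bigO_scal. apply (bigO_weaken _ ((2 * l - 1) * 1)); [|lia].
    apply (bigO_pow _ 1), bigO_u.
  - intros u v. unfold slope_defect. ring.
Qed.

Definition sigma_slope (l N : nat) (sigma : nat -> R) (u : R) : R :=
  u ^ (2 * l - 1) + sum_n_m (fun i => sigma (i + 1)%nat * u ^ (2 * l - 1 + i)) 1 N.

Lemma slope_upper l k f c phi dphi N : fold_slope l k c f -> trace phi dphi ->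
  k * k = 1 -> c <> 0 ->
  exists sigma S Su Sv, slope_state l k f c phi dphi S Su Sv (sigma_slope l N sigma) (N + 2 * l).
Proof.
  intros Hf Tr Hk Hc. induction N as [|N [sigma [S [Su [Sv HS]]]]].
  - exists (fun _ => 0), (fun _ _ => 0), (fun _ _ => 0), (fun _ _ => 0).
    replace (sigma_slope l 0 (fun _ => 0)) with (fun u : R => u ^ (2 * l - 1)).
    + apply slope_start; auto.
    + apply functional_extensionality. intros u. unfold sigma_slope.
      rewrite sum_n_m_zero by lia. unfold zero; simpl. ring.
  - destruct (slope_step _ _ _ _ _ _ _ _ _ _ _ Hf (Nat.le_add_l (2 * l) N) HS)
      as [S' [Su' [Sv' [rho [HS' HR]]]]].
    assert (HN := slope_absorb_sigma _ _ _ _ _ _ _ _ _ _ _ _ Hf (Nat.le_add_l (2 * l) N) Hk Hc HS' HR).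
    exists (fun i => if Nat.eqb i (N + 2) then k * rho / c else sigma i), S', Su', Sv'.
    replace (Datatypes.S N + 2 * l)%nat with (N + 2 * l + 1)%nat by lia.
    replace (sigma_slope l (Datatypes.S N) _)
      with (fun u => sigma_slope l N sigma u + k * rho / c * u ^ (N + 2 * l)); auto.
    apply functional_extensionality. intros u. unfold sigma_slope.
    rewrite sum_n_Sm by lia.
    rewrite (sum_n_m_ext_loc (fun i => (if Nat.eqb (i + 1) (N + 2) then k * rho / c
               else sigma (i + 1)%nat) * u ^ (2 * l - 1 + i))
             (fun i => sigma (i + 1)%nat * u ^ (2 * l - 1 + i)) 1 N).
    + replace (Datatypes.S N + 1)%nat with (N + 2)%nat by lia. rewrite Nat.eqb_refl.
      assert (Hl := proj1 Hf).
      replace (2 * l - 1 + Datatypes.S N)%nat with (N + 2 * l)%nat by lia.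
      unfold plus; simpl. ring.
    + intros i Hi. destruct (Nat.eqb_spec (i + 1) (N + 2)); [lia|reflexivity].
Qed.

Lemma slope_lower l k f c N : fold_slope l k c f -> k * k = 1 -> c <> 0 ->
  exists phi dphi S Su Sv,
    slope_state l k f c phi dphi S Su Sv (fun u => u ^ (2 * l - 1)) (N + 2 * l).
Proof.
  intros Hf Hk Hc. induction N as [|N [phi [dphi [S [Su [Sv HS]]]]]].
  - exists (fun _ => 0), (fun _ => 0), (fun _ _ => 0), (fun _ _ => 0), (fun _ _ => 0).
    apply slope_start; auto. apply trace_zero.
  - destruct (slope_step _ _ _ _ _ _ _ _ _ _ _ Hf (Nat.le_add_l (2 * l) N) HS)
      as [S' [Su' [Sv' [rho [HS' HR]]]]].
    destruct (slope_absorb_trace _ _ _ _ _ _ _ _ _ _ _ _ Hf (Nat.le_add_l (2 * l) N) Hk Hc HS' HR)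
      as [phi' [dphi' HN]].
    exists phi', dphi', S', Su', Sv'.
    replace (Datatypes.S N + 2 * l)%nat with (N + 2 * l + 1)%nat by lia. exact HN.
Qed.

Lemma bigO_at_0 q F : bigO q 1 F -> F 0 0 = 0.
Proof.
  intros [C [d [HC [Hd H]]]].
  apply (vanishing _ C d (proj1 Hd)). intros l Hl. rewrite <- (pow_1 l).
  assert (0 <= l ^ q) by (apply pow_le; lra).
  apply H; auto; rewrite Rabs_R0; lra.
Qed.

Lemma analytic_scal a F : analytic F -> analytic (fun u v => a * F u v).
Proof. apply (analytic_mul (fun _ _ => a)), analytic_const. Qed.

(** A small slope defect is a small defect of the vector fields themselves: the
    time scaling makes the first component constant, and the slope defect becomes
    the remainder in the second. *)
Lemma slope_state_conjugates l k X Y c phi dphi S Su Sv g N :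
  (1 <= l)%nat -> analytic X -> analytic Y -> k * k = 1 -> 0 < k * X 0 0 -> 0 < c ->
  fold_slope l k c (fun x y => Y x y / X x y) ->
  slope_state l k (fun x y => Y x y / X x y) c phi dphi S Su Sv g (N + 2 * l) ->
  exists tau F, admissible_scaling tau /\
    quasi_homogeneous_remainder l N (fun x y => (0, F x y)) /\
    good_branch (Branch c 0 (fun u _ => phi u) S) /\
    conjugates (Branch c 0 (fun u _ => phi u) S) tau X Y (fun u v => (k, g u + F u v)).
Proof.
  intros Hl AX AY Hk HX Hc Hf HS.
  assert (AE := slope_defect_analytic _ _ _ _ _ _ _ _ _ _ _ Hf HS).
  destruct HS as [Tr [PS [ZS [OS [OSv [Ag [Og OE]]]]]]].
  assert (Pphi := proj1 Tr).
  assert (HX0 : X 0 0 <> 0) by (intros E; rewrite E in HX; lra).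
  assert (phi0 : phi 0 = 0) by apply Pphi.
  assert (dphi0 : dphi 0 = 0) by exact (bigO_at_0 1 _ (proj2 (proj2 Tr 1%nat))).
  assert (Sv0 : Sv 0 0 = 0) by exact (bigO_at_0 (2 * l) _ OSv).
  destruct Pphi as [Aphi [Adphi _]]. destruct PS as [AS [ASu [ASv [DSu [DSv LS]]]]].
  set (h := Branch c 0 (fun u _ => phi u) S).
  assert (Ahx : analytic (fun u v => u + phi u)) by (apply analytic_add; [apply analytic_x|auto]).
  assert (Ahy : analytic (fun u v => c * v + S u v)).
  { apply analytic_add; [apply analytic_scal, analytic_y|auto]. }
  assert (AXh : analytic (fun u v => X (u + phi u) (c * v + S u v))).
  { apply (analytic_comp X (fun u v => u + phi u) (fun u v => c * v + S u v)); auto.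
    - rewrite phi0. ring.
    - rewrite ZS. ring. }
  assert (AYh : analytic (fun u v => Y (u + phi u) (c * v + S u v))).
  { apply (analytic_comp Y (fun u v => u + phi u) (fun u v => c * v + S u v)); auto.
    - rewrite phi0. ring.
    - rewrite ZS. ring. }
  assert (Ad : analytic (fun u v => c + Sv u v)).
  { apply (analytic_add (fun _ _ => c)); [apply analytic_const|auto]. }
  assert (Aa : analytic (fun u v => 1 + dphi u)).
  { apply (analytic_add (fun _ _ => 1)); [apply analytic_const|auto]. }
  assert (EX0 : X (0 + phi 0) (c * 0 + S 0 0) = X 0 0).
  { rewrite phi0, ZS. f_equal; ring. }
  set (tau := fun u v => k * (1 + dphi u) / X (u + phi u) (c * v + S u v)).
  assert (Atau : analytic tau).
  { apply (analytic_div (fun u v => k * (1 + dphi u))); auto.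
    - apply (analytic_scal k (fun u v => 1 + dphi u)). auto.
    - rewrite EX0. auto. }
  set (F := fun u v => k * slope_defect k (fun x y => Y x y / X x y) c phi dphi S Su Sv g u v
                       / (c + Sv u v)).
  assert (Hcv : c + Sv 0 0 <> 0) by (rewrite Sv0; lra).
  exists tau, F. split; [|split; [|split]].
  - split; auto. apply analytic_near; auto. unfold tau. rewrite EX0, dphi0.
    replace (k * (1 + 0) / X 0 0) with (/ (k * X 0 0)).
    + apply Rinv_0_lt_compat; auto.
    + assert (k <> 0) by (intros E; rewrite E in Hk; lra).
      replace (k * (1 + 0) / X 0 0) with (k * k * (1 + 0) / (k * X 0 0)) by (field; auto).
      rewrite Hk. field. auto.
  - assert (AF : analytic F).
    { apply (analytic_div (fun u v => k * slope_defect k (fun x y => Y x y / X x y)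
               c phi dphi S Su Sv g u v)); auto. apply analytic_scal; auto. }
    apply quasi_homogeneous_remainder_of_order; auto.
    unfold F, Rdiv. replace (N + 2 * l)%nat with (N + 2 * l + 0)%nat by lia.
    apply bigO_mul; [apply bigO_scal; auto|].
    apply bigO_analytic; [lia|]. apply (analytic_inv (fun u v => c + Sv u v)); auto.
  - split; [exact Hc|]. split; [exact Aphi|]. split; [exact AS|].
    split; [apply (proj1 Tr)|]. split; [exact LS|exact ZS].
  - assert (N1 := analytic_near_neq _ Ad Hcv).
    assert (N2 := analytic_near_neq _ Aa ltac:(cbv beta; rewrite dphi0; lra)).
    assert (N3 := analytic_near_neq _ AXh ltac:(cbv beta; rewrite EX0; auto)).
    generalize (locally_2d_and _ _ _ _ N1 (locally_2d_and _ _ _ _ N2 N3)).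
    apply locally_2d_impl, locally_2d_forall. intros u v [H1 [H2 H3]].
    unfold transformed_field.
    destruct (derive_branch c 0 (fun u _ => phi u) (fun u _ => dphi u) (fun _ _ => 0)
                S Su Sv u v (proj1 Tr)
                (conj AS (conj ASu (conj ASv (conj DSu (conj DSv LS))))))
      as [E1 [E2 [E3 E4]]].
    fold h in E1, E2, E3, E4. rewrite E1, E2, E3, E4.
    assert (Ex : branch_x h u v = u + phi u) by (unfold branch_x, h; simpl; ring).
    assert (Ey : branch_y h u v = c * v + S u v) by reflexivity.
    rewrite Ex, Ey. unfold tau, F, slope_defect.
    f_equal.
    + field. auto.
    + assert (K : k = 1 \/ k = -1).
      { assert ((k - 1) * (k + 1) = 0) as K by (ring_simplify; lra).
        apply Rmult_integral in K. lra. }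
      clear - H1 H2 H3 K. destruct K; subst k; field; auto.
Qed.

Lemma wpoly_axis q k f fu fv : wpoly q k f fu fv -> forall u, f u 0 = f 1 0 * u ^ k.
Proof.
  induction 1 as [c i j k Hk|k f fu fv g gu gv _ IHf _ IHg]; intros u.
  - destruct j as [|j].
    + replace i with k by lia. rewrite pow1. simpl. ring.
    + simpl. ring.
  - rewrite IHf, IHg. ring.
Qed.

Lemma wpoly_low q k f fu fv : wpoly q k f fu fv -> (k < q)%nat ->
  forall u v, f u v = f 1 0 * u ^ k.
Proof.
  induction 1 as [c i j k Hk|k f fu fv g gu gv _ IHf _ IHg]; intros Hq u v.
  - destruct j as [|j]; [|nia].
    replace i with k by lia. rewrite pow1. simpl. ring.
  - rewrite IHf, IHg by auto. ring.
Qed.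

(** In weight less than [q] there is no [y], so the expansion is the Taylor
    expansion along [y = 0]. *)
Lemma axis_expansion q F : (1 <= q)%nat -> analytic F ->
  bigO q q (fun x y => F x y -
    sum_n (fun k => Derive_n (fun x => F x 0) k 0 / INR (Factorial.fact k) * x ^ k) (q - 1)).
Proof.
  intros Hq AF. destruct (weighted_expansion q F Hq AF) as [p [r [Hr [Hp [Hs HO]]]]].
  set (b := fun k => p k 1 0).
  assert (Hax : forall x, Rabs x <= r -> F x 0 = PSeries b x).
  { intros x Hx. assert (H0 : Rabs 0 <= r) by (rewrite Rabs_R0; lra).
    specialize (Hs x 0 Hx H0). symmetry. apply is_series_unique.
    eapply is_series_ext; [|exact Hs]. intros k. simpl.
    destruct (Hp k) as [fu [fv W]]. apply (wpoly_axis _ _ _ _ _ W). }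
  assert (Hcv : Rbar_lt 0 (CV_radius b)).
  { destruct (Rbar_lt_le_dec 0 (CV_radius b)) as [H|H]; auto. exfalso.
    assert (Hrr : Rbar_lt (CV_radius b) (Rabs r)).
    { eapply Rbar_le_lt_trans; [exact H|]. simpl. rewrite Rabs_pos_eq; lra. }
    apply (CV_disk_outside b r Hrr). apply ex_series_lim_0.
    assert (H0 : Rabs 0 <= r) by (rewrite Rabs_R0; lra).
    exists (F r 0). eapply is_series_ext; [|apply (Hs r 0); [rewrite Rabs_pos_eq; lra|auto]].
    intros k. simpl. destruct (Hp k) as [fu [fv W]]. apply (wpoly_axis _ _ _ _ _ W). }
  assert (HD : forall k, Derive_n (fun x => F x 0) k 0 = b k * INR (Factorial.fact k)).
  { intros k. rewrite <- (Derive_n_coef b k Hcv). apply Derive_n_ext_loc.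
    assert (Hr0 : 0 < r) by lra. exists (mkposreal r Hr0). intros x Hx.
    change (Rabs (x - 0) < r) in Hx. rewrite Rminus_0_r in Hx. apply Hax. lra. }
  specialize (HO (q - 1)%nat). replace (S (q - 1)) with q in HO by lia.
  eapply bigO_ext; [exact HO|]. intros x y. cbv beta. apply (f_equal (fun z => F x y - z)).
  apply sum_ext. intros k Hk. rewrite HD. destruct (Hp k) as [fu [fv W]].
  rewrite (wpoly_low _ _ _ _ _ W) by lia. unfold b. field. apply INR_fact_neq_0.
Qed.

Lemma tangency_expansion Y l : (1 <= l)%nat -> analytic Y ->
  (forall j, (j <= 2 * l - 2)%nat -> Derive_n (fun x => Y x 0) j 0 = 0) ->
  bigO (2 * l) (2 * l) (fun x y => Y x y -
     Derive_n (fun x => Y x 0) (2 * l - 1) 0 / INR (Factorial.fact (2 * l - 1)) * x ^ (2 * l - 1)).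
Proof.
  intros Hl AY H. eapply bigO_ext; [apply (axis_expansion (2 * l) Y); auto; lia|].
  intros x y. cbv beta. apply (f_equal (fun z => Y x y - z)).
  replace (2 * l - 1)%nat with (S (2 * l - 2)) by lia. rewrite sumS, sum_zero.
  - ring_sum.
  - intros k Hk. rewrite H by auto. unfold Rdiv. ring.
Qed.

Lemma tangency_fold_slope X Y l k : analytic X -> analytic Y -> tangency X Y l -> k * k = 1 ->
  fold_slope l k (k * (Derive_n (fun x => Y x 0) (2 * l - 1) 0 / INR (Factorial.fact (2 * l - 1)) / X 0 0))
    (fun x y => Y x y / X x y).
Proof.
  intros AX AY [Hl [HX HD]] Hk. split; auto. split; [apply analytic_div; auto|].
  assert (O := tangency_expansion Y l Hl AY HD).
  set (y0 := Derive_n (fun x => Y x 0) (2 * l - 1) 0 / INR (Factorial.fact (2 * l - 1))) in *.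
  assert (Ai : analytic (fun x y => / X x y)) by (apply analytic_inv; auto).
  apply (bigO_ext _ _ (fun x y => (Y x y - y0 * x ^ (2 * l - 1)) * / X x y +
      y0 * (x ^ (2 * l - 1) * (/ X x y - / X 0 0)))).
  - apply bigO_add.
    + replace (2 * l)%nat with (2 * l + 0)%nat at 2 by lia. apply bigO_mul; auto.
      apply bigO_analytic; [lia|auto].
    + apply bigO_scal. replace (2 * l)%nat with ((2 * l - 1) * 1 + 1)%nat at 2 by lia.
      apply (bigO_mul _ _ _ (fun x _ => x ^ (2 * l - 1))).
      * apply (bigO_pow _ 1), bigO_u.
      * apply analytic_bigO1; [lia| |ring]. apply analytic_sub; [auto|apply analytic_const].
  - intros x y. replace (k * (k * (y0 / X 0 0))) with (k * k * (y0 / X 0 0)) by ring.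
    rewrite Hk. unfold Rdiv. ring.
Qed.

(** The sign of [X] fixes that of the derivative of [Y], hence [0 < c]: the change
    of variables preserves the half planes. *)
Lemma upper_parabolic_normal_form X Y N phi dphi : analytic X -> analytic Y ->
  upper_parabolic_type X Y -> X 0 0 < 0 -> trace phi dphi ->
  exists sigma l h tau F, (1 <= l)%nat /\ quasi_homogeneous_remainder l N F /\
    good_branch h /\ (forall u, Phi h u 0 = phi u) /\ admissible_scaling tau /\
    conjugates h tau X Y (upper_parabolic_form N l sigma F).
Proof.
  intros AX AY [l [HT HD]] HX Tr. assert (Hk : (-1) * (-1) = 1) by ring.
  assert (Hf := tangency_fold_slope X Y l (-1) AX AY HT Hk).
  set (c := -1 * (Derive_n (fun x => Y x 0) (2 * l - 1) 0 / INR (Factorial.fact (2 * l - 1)) / X 0 0)) in *.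
  assert (Hc : 0 < c).
  { unfold c. set (D := Derive_n (fun x => Y x 0) (2 * l - 1) 0) in *.
    assert (0 < INR (Factorial.fact (2 * l - 1))) by apply INR_fact_lt_0.
    replace (-1 * (D / INR (Factorial.fact (2 * l - 1)) / X 0 0)) with
      (D / (INR (Factorial.fact (2 * l - 1)) * (- X 0 0))) by (field; lra).
    apply Rdiv_lt_0_compat; nra. }
  destruct (slope_upper l (-1) _ c phi dphi N Hf Tr Hk ltac:(lra)) as [sigma [S [Su [Sv HS]]]].
  destruct (slope_state_conjugates l (-1) X Y c phi dphi S Su Sv _ N (proj1 HT) AX AY Hk
              ltac:(lra) Hc Hf HS) as [tau [F [Ht [HF [Hg HC]]]]].
  exists sigma, l, (Branch c 0 (fun u _ => phi u) S), tau, (fun x y => (0, F x y)).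
  split; [apply HT|]. split; auto. split; auto. split; auto. split; auto.
  revert HC. apply locally_2d_impl, locally_2d_forall. intros u v ->.
  unfold upper_parabolic_form, sigma_slope. simpl fst. simpl snd. f_equal. ring.
Qed.

Lemma lower_parabolic_normal_form X Y N : analytic X -> analytic Y ->
  lower_parabolic_type X Y -> 0 < X 0 0 ->
  exists phi dphi l h tau F, trace phi dphi /\
    (1 <= l)%nat /\ quasi_homogeneous_remainder l N F /\
    good_branch h /\ (forall u, Phi h u 0 = phi u) /\ admissible_scaling tau /\
    conjugates h tau X Y (lower_parabolic_form l F).
Proof.
  intros AX AY [l [HT HD]] HX. assert (Hk : 1 * 1 = 1) by ring.
  assert (Hf := tangency_fold_slope X Y l 1 AX AY HT Hk).
  set (c := 1 * (Derive_n (fun x => Y x 0) (2 * l - 1) 0 / INR (Factorial.fact (2 * l - 1)) / X 0 0)) in *.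
  assert (Hc : 0 < c).
  { unfold c. set (D := Derive_n (fun x => Y x 0) (2 * l - 1) 0) in *.
    assert (0 < INR (Factorial.fact (2 * l - 1))) by apply INR_fact_lt_0.
    replace (1 * (D / INR (Factorial.fact (2 * l - 1)) / X 0 0)) with
      (D / (INR (Factorial.fact (2 * l - 1)) * X 0 0)) by (field; lra).
    apply Rdiv_lt_0_compat; nra. }
  destruct (slope_lower l 1 _ c N Hf Hk ltac:(lra)) as [phi [dphi [S [Su [Sv HS]]]]].
  destruct (slope_state_conjugates l 1 X Y c phi dphi S Su Sv _ N (proj1 HT) AX AY Hk
              ltac:(lra) Hc Hf HS) as [tau [F [Ht [HF [Hg HC]]]]].
  exists phi, dphi, l, (Branch c 0 (fun u _ => phi u) S), tau, (fun x y => (0, F x y)).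
  split; [apply HS|].
  split; [apply HT|]. split; auto. split; auto. split; auto. split; auto.
  revert HC. apply locally_2d_impl, locally_2d_forall. intros u v ->.
  unfold lower_parabolic_form. simpl fst. simpl snd. f_equal. ring.
Qed.

(** * Focus type: the homological equation *)

Lemma wpoly_eq q k f fu fv g gu gv : wpoly q k f fu fv ->
  (forall u v, g u v = f u v) -> (forall u v, gu u v = fu u v) ->
  (forall u v, gv u v = fv u v) -> wpoly q k g gu gv.
Proof.
  intros H E1 E2 E3. rewrite (fun2_ext _ _ E1), (fun2_ext _ _ E2), (fun2_ext _ _ E3). exact H.
Qed.

Lemma wpoly_zero q k : wpoly q k (fun _ _ => 0) (fun _ _ => 0) (fun _ _ => 0).
Proof.
  eapply wpoly_eq; [apply (wp_mono q 0 k 0); lia| | |]; intros; simpl; ring.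
Qed.

Lemma wpoly_scal q k a f fu fv : wpoly q k f fu fv ->
  wpoly q k (fun u v => a * f u v) (fun u v => a * fu u v) (fun u v => a * fv u v).
Proof.
  induction 1 as [c i j k Hk|k f fu fv g gu gv _ IHf _ IHg].
  - eapply wpoly_eq; [apply (wp_mono q (a * c) i j k Hk)| | |]; intros; simpl; ring.
  - eapply wpoly_eq; [apply (wp_add _ _ _ _ _ _ _ _ IHf IHg)| | |]; intros; simpl; ring.
Qed.

Lemma wpoly_mulu q k f fu fv : wpoly q k f fu fv ->
  wpoly q (S k) (fun u v => u * f u v) (fun u v => f u v + u * fu u v) (fun u v => u * fv u v).
Proof.
  induction 1 as [c i j k Hk|k f fu fv g gu gv _ IHf _ IHg].
  - eapply wpoly_eq; [apply (wp_mono q c (S i) j); lia| | |]; intros u v.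
    + simpl; ring.
    + rewrite S_INR. replace (S i - 1)%nat with i by lia. destruct i as [|i]; [simpl; ring|].
      replace (S i - 1)%nat with i by lia. simpl pow. ring.
    + simpl; ring.
  - eapply wpoly_eq; [apply (wp_add _ _ _ _ _ _ _ _ IHf IHg)| | |]; intros; simpl; ring.
Qed.

Lemma wpoly_mulv q k f fu fv : wpoly q k f fu fv ->
  wpoly q (q + k) (fun u v => v * f u v) (fun u v => v * fu u v) (fun u v => f u v + v * fv u v).
Proof.
  induction 1 as [c i j k Hk|k f fu fv g gu gv _ IHf _ IHg].
  - eapply wpoly_eq; [apply (wp_mono q c i (S j)); lia| | |]; intros u v.
    + simpl; ring.
    + simpl; ring.
    + rewrite S_INR. replace (S j - 1)%nat with j by lia. destruct j as [|j]; [simpl; ring|].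
      replace (S j - 1)%nat with j by lia. simpl pow. ring.
  - eapply wpoly_eq; [apply (wp_add _ _ _ _ _ _ _ _ IHf IHg)| | |]; intros; simpl; ring.
Qed.

Lemma qhom_eq q k f g : qhom q k f -> (forall u v, g u v = f u v) -> qhom q k g.
Proof. intros H E. rewrite (fun2_ext _ _ E). exact H. Qed.

Lemma qhom_add q k f g : qhom q k f -> qhom q k g -> qhom q k (fun u v => f u v + g u v).
Proof.
  intros [fu [fv Hf]] [gu [gv Hg]]. eexists _, _. exact (wp_add _ _ _ _ _ _ _ _ Hf Hg).
Qed.

Lemma qhom_scal q k a f : qhom q k f -> qhom q k (fun u v => a * f u v).
Proof. intros [fu [fv H]]. eexists _, _. exact (wpoly_scal _ _ a _ _ _ H). Qed.

Lemma qhom_mulu q k f : qhom q k f -> qhom q (S k) (fun u v => u * f u v).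
Proof. intros [fu [fv H]]. eexists _, _. exact (wpoly_mulu _ _ _ _ _ H). Qed.

Lemma qhom_mulv k f : qhom 1 k f -> qhom 1 (S k) (fun u v => v * f u v).
Proof. intros [fu [fv H]]. eexists _, _. exact (wpoly_mulv 1 _ _ _ _ H). Qed.

(** Real and imaginary parts of [(u - i v) ^ n]. *)
Fixpoint conj_pow (n : nat) (u v : R) : R * R :=
  match n with
  | O => (1, 0)
  | S n => (u * fst (conj_pow n u v) + v * snd (conj_pow n u v),
            u * snd (conj_pow n u v) - v * fst (conj_pow n u v))
  end.

Definition conj_re n u v := fst (conj_pow n u v).
Definition conj_im n u v := snd (conj_pow n u v).

(** Derivative along the linear focus of matrix [(g, -1; 1, g)]. *)
Definition along (g : R) (fu fv : R -> R -> R) (u v : R) : R :=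
  (g * u - v) * fu u v + (u + g * v) * fv u v.

(** [(u - i v) ^ n] is an eigenvector of the derivation [along g], for the
    eigenvalue [n * (g - i)]. *)
Lemma conj_pow_along g n : exists pu pv qu qv,
  wpoly 1 n (conj_re n) pu pv /\ wpoly 1 n (conj_im n) qu qv /\
  (forall u v, along g pu pv u v = INR n * (g * conj_re n u v + conj_im n u v)) /\
  (forall u v, along g qu qv u v = INR n * (g * conj_im n u v - conj_re n u v)).
Proof.
  induction n as [|n [pu [pv [qu [qv [Hp [Hq [Ep Eq]]]]]]]].
  - exists (fun _ _ => 0), (fun _ _ => 0), (fun _ _ => 0), (fun _ _ => 0).
    split; [|split; [apply wpoly_zero|split]].
    + eapply wpoly_eq; [apply (wp_mono 1 1 0 0); lia| | |]; intros; unfold conj_re; simpl; ring.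
    + intros; unfold along; simpl; ring.
    + intros; unfold along; simpl; ring.
  - assert (H1 := wp_add _ _ _ _ _ _ _ _ (wpoly_mulu _ _ _ _ _ Hp) (wpoly_mulv _ _ _ _ _ Hq)).
    assert (H2 := wp_add _ _ _ _ _ _ _ _ (wpoly_mulu _ _ _ _ _ Hq)
                    (wpoly_scal _ _ (-1) _ _ _ (wpoly_mulv _ _ _ _ _ Hp))).
    eexists _, _, _, _. split; [|split; [|split]].
    + eapply wpoly_eq; [exact H1| | |]; reflexivity.
    + eapply wpoly_eq; [exact H2| | |]; try reflexivity.
      intros. unfold conj_im, conj_re. simpl. ring.
    + intros u v. specialize (Ep u v). specialize (Eq u v). unfold along in *.
      replace (conj_re (S n) u v) with (u * conj_re n u v + v * conj_im n u v) by reflexivity.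
      replace (conj_im (S n) u v) with (u * conj_im n u v - v * conj_re n u v) by reflexivity.
      rewrite S_INR.
      match goal with |- ?l = _ => transitivity
        ((g * u - v) * conj_re n u v + u * ((g * u - v) * pu u v + (u + g * v) * pv u v)
         + ((u + g * v) * conj_im n u v + v * ((g * u - v) * qu u v + (u + g * v) * qv u v))) end.
      * ring.
      * rewrite Ep, Eq. ring.
    + intros u v. specialize (Ep u v). specialize (Eq u v). unfold along in *.
      replace (conj_re (S n) u v) with (u * conj_re n u v + v * conj_im n u v) by reflexivity.
      replace (conj_im (S n) u v) with (u * conj_im n u v - v * conj_re n u v) by reflexivity.
      rewrite S_INR.
      match goal with |- ?l = _ => transitivity
        ((g * u - v) * conj_im n u v + u * ((g * u - v) * qu u v + (u + g * v) * qv u v)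
         - ((u + g * v) * conj_re n u v + v * ((g * u - v) * pu u v + (u + g * v) * pv u v))) end.
      * ring.
      * rewrite Ep, Eq. ring.
Qed.

(** [E1 + i E2] equals [(e1 + i e2) (u - i v)^(n+1) + (u + i v) (B1 + i B2)]: modulo
    [u + i v] a homogeneous polynomial is a multiple of a power of [u - i v]. *)
Definition decomposes (n : nat) (E1 E2 : R -> R -> R) : Prop :=
  exists e1 e2 B1 B2, qhom 1 n B1 /\ qhom 1 n B2 /\ forall u v,
    E1 u v = e1 * conj_re (S n) u v - e2 * conj_im (S n) u v + (B1 u v * u - B2 u v * v) /\
    E2 u v = e1 * conj_im (S n) u v + e2 * conj_re (S n) u v + (B1 u v * v + B2 u v * u).

Lemma conj_qhom n : qhom 1 n (conj_re n) /\ qhom 1 n (conj_im n).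
Proof.
  destruct (conj_pow_along 0 n) as [pu [pv [qu [qv [Hp [Hq _]]]]]].
  split; [exists pu, pv|exists qu, qv]; auto.
Qed.

Lemma decomposes_add n E1 E2 F1 F2 : decomposes n E1 E2 -> decomposes n F1 F2 ->
  decomposes n (fun u v => E1 u v + F1 u v) (fun u v => E2 u v + F2 u v).
Proof.
  intros [e1 [e2 [B1 [B2 [H1 [H2 E]]]]]] [f1 [f2 [C1 [C2 [H3 [H4 F]]]]]].
  exists (e1 + f1), (e2 + f2), (fun u v => B1 u v + C1 u v), (fun u v => B2 u v + C2 u v).
  split; [apply qhom_add; auto|]. split; [apply qhom_add; auto|].
  intros u v. destruct (E u v) as [-> ->], (F u v) as [-> ->]. split; ring.
Qed.

Lemma decomposes_scal n a b E1 E2 : decomposes n E1 E2 ->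
  decomposes n (fun u v => a * E1 u v - b * E2 u v) (fun u v => a * E2 u v + b * E1 u v).
Proof.
  intros [e1 [e2 [B1 [B2 [H1 [H2 E]]]]]].
  exists (a * e1 - b * e2), (a * e2 + b * e1), (fun u v => a * B1 u v + (- b) * B2 u v),
         (fun u v => a * B2 u v + b * B1 u v).
  split; [apply qhom_add; apply qhom_scal; auto|].
  split; [apply qhom_add; apply qhom_scal; auto|].
  intros u v. destruct (E u v) as [-> ->]. split; ring.
Qed.

Lemma decomposes_mulu n E1 E2 : decomposes n E1 E2 ->
  decomposes (S n) (fun u v => u * E1 u v) (fun u v => u * E2 u v).
Proof.
  intros [e1 [e2 [B1 [B2 [H1 [H2 E]]]]]].
  destruct (conj_qhom (S n)) as [Q1 Q2].
  exists (/ 2 * e1), (/ 2 * e2),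
    (fun u v => u * B1 u v + (/ 2 * e1 * conj_re (S n) u v + (- (/ 2 * e2)) * conj_im (S n) u v)),
    (fun u v => u * B2 u v + (/ 2 * e1 * conj_im (S n) u v + (/ 2 * e2) * conj_re (S n) u v)).
  split; [repeat apply qhom_add; try apply qhom_scal; auto; apply qhom_mulu; auto|].
  split; [repeat apply qhom_add; try apply qhom_scal; auto; apply qhom_mulu; auto|].
  intros u v. destruct (E u v) as [-> ->].
  replace (conj_re (S (S n)) u v) with (u * conj_re (S n) u v + v * conj_im (S n) u v) by reflexivity.
  replace (conj_im (S (S n)) u v) with (u * conj_im (S n) u v - v * conj_re (S n) u v) by reflexivity.
  split; field.
Qed.

Lemma decomposes_mulv n E1 E2 : decomposes n E1 E2 ->
  decomposes (S n) (fun u v => v * E1 u v) (fun u v => v * E2 u v).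
Proof.
  intros [e1 [e2 [B1 [B2 [H1 [H2 E]]]]]].
  destruct (conj_qhom (S n)) as [Q1 Q2].
  exists (- (/ 2 * e2)), (/ 2 * e1),
    (fun u v => v * B1 u v + (/ 2 * e2 * conj_re (S n) u v + (/ 2 * e1) * conj_im (S n) u v)),
    (fun u v => v * B2 u v + (/ 2 * e2 * conj_im (S n) u v + (- (/ 2 * e1)) * conj_re (S n) u v)).
  split; [repeat apply qhom_add; try apply qhom_scal; auto; apply qhom_mulv; auto|].
  split; [repeat apply qhom_add; try apply qhom_scal; auto; apply qhom_mulv; auto|].
  intros u v. destruct (E u v) as [-> ->].
  replace (conj_re (S (S n)) u v) with (u * conj_re (S n) u v + v * conj_im (S n) u v) by reflexivity.
  replace (conj_im (S (S n)) u v) with (u * conj_im (S n) u v - v * conj_re (S n) u v) by reflexivity.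
  split; field.
Qed.

Lemma decomposes_ext n E1 E2 F1 F2 : decomposes n E1 E2 ->
  (forall u v, F1 u v = E1 u v) -> (forall u v, F2 u v = E2 u v) -> decomposes n F1 F2.
Proof. intros H H1 H2. rewrite (fun2_ext _ _ H1), (fun2_ext _ _ H2). exact H. Qed.

Lemma decomposes_monomial n i j : (i + j = S n)%nat ->
  decomposes n (fun u v => u ^ i * v ^ j) (fun _ _ => 0).
Proof.
  revert i j. induction n as [|n IH]; intros i j H.
  - assert (Q0 : forall a, qhom 1 0 (fun _ _ => a)).
    { intros a. apply (qhom_eq 1 0 (fun u v => a * u ^ 0 * v ^ 0)).
      - eexists _, _. apply wp_mono. lia.
      - intros; simpl; ring. }
    destruct i as [|i].
    + replace j with 1%nat by lia.
      exists 0, (/ 2), (fun _ _ => 0), (fun _ _ => - / 2). split; auto. split; auto.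
      intros u v. unfold conj_re, conj_im. simpl. split; field.
    + replace i with 0%nat by lia. replace j with 0%nat by lia.
      exists (/ 2), 0, (fun _ _ => / 2), (fun _ _ => 0). split; auto. split; auto.
      intros u v. unfold conj_re, conj_im. simpl. split; field.
  - destruct i as [|i].
    + destruct j as [|j]; [lia|].
      eapply decomposes_ext; [apply decomposes_mulv, (IH 0%nat j); lia| |]; intros; simpl; ring.
    + eapply decomposes_ext; [apply decomposes_mulu, (IH i j); lia| |]; intros; simpl; ring.
Qed.

Lemma decomposes_real n E : qhom 1 (S n) E -> decomposes n E (fun _ _ => 0).
Proof.
  intros [Eu [Ev H]]. remember (S n) as k eqn:Ek.
  induction H as [c i j k Hk|k f fu fv g gu gv _ IHf _ IHg].
  - eapply decomposes_ext; [apply (decomposes_scal n c 0), (decomposes_monomial n i j); lia| |];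
      intros; simpl; ring.
  - eapply decomposes_ext; [apply decomposes_add; [apply IHf|apply IHg]; auto| |]; intros; simpl; ring.
Qed.

Lemma decomposition n E1 E2 : qhom 1 (S n) E1 -> qhom 1 (S n) E2 -> decomposes n E1 E2.
Proof.
  intros H1 H2. eapply decomposes_ext.
  - apply decomposes_add; [apply (decomposes_real n E1 H1)|].
    apply (decomposes_scal n 0 1), (decomposes_real n E2 H2).
  - intros; simpl; ring.
  - intros; simpl; ring.
Qed.

(** The radial equation. The derivation [along g] sends [u^i v^(j+1)] to
    [(j+1) u^(i+1) v^j] plus terms with smaller power of [u], so that only [v^n]
    escapes its image on multiples of [v]. *)
Lemma radial_homological g n P : qhom 1 n P ->
  exists s f fu fv, wpoly 1 n f fu fv /\ (forall u, f u 0 = 0) /\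
    forall u v, along g fu fv u v + s * v ^ n = P u v.
Proof.
  intros [Pu [Pv H]]. induction H as [c i j n Hn|n f fu fv h hu hv _ IHf _ IHh].
  - revert c j Hn. induction i as [i IH] using (well_founded_induction Wf_nat.lt_wf). intros c j Hn.
    destruct i as [|i].
    + exists c, (fun _ _ => 0), (fun _ _ => 0), (fun _ _ => 0).
      split; [apply wpoly_zero|]. split; auto. intros u v. unfold along.
      replace j with n by lia. simpl. ring.
    + set (a := c / INR (S j)).
      assert (HI : INR (S j) <> 0) by (apply not_0_INR; lia).
      assert (Ea : a * INR (S j) = c) by (unfold a; field; auto).
      destruct (IH i ltac:(lia) (- (a * g * INR n)) (S j) ltac:(lia))
        as [s1 [f1 [f1u [f1v [W1 [Z1 E1]]]]]].
      assert (H2 : exists s f fu fv, wpoly 1 n f fu fv /\ (forall u, f u 0 = 0) /\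
         forall u v, along g fu fv u v + s * v ^ n = a * INR i * u ^ (i - 1) * v ^ S (S j)).
      { destruct i as [|i].
        - exists 0, (fun _ _ => 0), (fun _ _ => 0), (fun _ _ => 0).
          split; [apply wpoly_zero|]. split; auto. intros u v. unfold along. simpl. ring.
        - replace (S i - 1)%nat with i by lia. apply IH; lia. }
      destruct H2 as [s2 [f2 [f2u [f2v [W2 [Z2 E2]]]]]].
      assert (W0 := wp_mono 1 a i (S j) n ltac:(lia)).
      exists (s1 + s2). eexists _, _, _. split; [|split].
      * exact (wp_add _ _ _ _ _ _ _ _ W0 (wp_add _ _ _ _ _ _ _ _ W1 W2)).
      * intros u. cbv beta. rewrite Z1, Z2. simpl. ring.
      * intros u v. specialize (E1 u v). specialize (E2 u v). unfold along in *.
        replace (S j - 1)%nat with j by lia.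
        match goal with |- ?l = _ => transitivity
          ((g * u - v) * (a * (INR i * u ^ (i - 1)) * v ^ S j)
           + (u + g * v) * (a * u ^ i * (INR (S j) * v ^ j))
           + ((g * u - v) * f1u u v + (u + g * v) * f1v u v + s1 * v ^ n)
           + ((g * u - v) * f2u u v + (u + g * v) * f2v u v + s2 * v ^ n)) end; [ring|].
        rewrite E1, E2, <- Ea. replace n with (i + S j)%nat by lia. rewrite plus_INR.
        destruct i as [|i]; [simpl; ring|]. replace (S i - 1)%nat with i by lia.
        simpl pow. ring.
  - destruct IHf as [s1 [f1 [f1u [f1v [W1 [Z1 E1]]]]]].
    destruct IHh as [s2 [f2 [f2u [f2v [W2 [Z2 E2]]]]]].
    exists (s1 + s2). eexists _, _, _. split; [exact (wp_add _ _ _ _ _ _ _ _ W1 W2)|]. split.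
    + intros u. cbv beta. rewrite Z1, Z2. ring.
    + intros u v. rewrite <- E1, <- E2. unfold along. ring.
Qed.

(** The homological equation of a focus, with displacements vanishing on [v = 0]:
    the displacement [v (a + i b) (u - i v)^n] removes the part not divisible by
    [u + i v]; what is left is radial plus a multiple of the linear field, i.e. a
    time scaling. *)
Lemma focus_homological g n E1 E2 : (1 <= n)%nat -> qhom 1 (S n) E1 -> qhom 1 (S n) E2 ->
  exists s e1 e1u e1v e2 e2u e2v T,
    wpoly 1 (S n) e1 e1u e1v /\ wpoly 1 (S n) e2 e2u e2v /\ qhom 1 n T /\
    flat e1 /\ flat e2 /\ (forall u, e1 u 0 = 0) /\ (forall u, e2 u 0 = 0) /\
    forall u v,
      along g e1u e1v u v - (g * e1 u v - e2 u v) - T u v * (g * u - v) + s * v ^ n * u = E1 u v /\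
      along g e2u e2v u v - (e1 u v + g * e2 u v) - T u v * (u + g * v) + s * v ^ n * v = E2 u v.
Proof.
  intros Hn H1 H2.
  destruct (decomposition n E1 E2 H1 H2) as [c1 [c2 [B1 [B2 [QB1 [QB2 EB]]]]]].
  (* [m1 + i m2] is the factor by which the displacement [v (u - i v)^n] enters the
     coefficient of [(u - i v)^(n+1)]; it never vanishes *)
  set (m1 := (INR n + 2) / 2). set (m2 := INR n * g / 2). set (M := m1 ^ 2 + m2 ^ 2).
  assert (HM : M <> 0).
  { assert (0 <= INR n) by apply pos_INR. unfold M, m1. nra. }
  set (a := (c1 * m1 + c2 * m2) / M). set (b := (c2 * m1 - c1 * m2) / M).
  assert (Ea : a * m1 - b * m2 = c1).
  { unfold a, b. replace ((c1 * m1 + c2 * m2) / M * m1 - (c2 * m1 - c1 * m2) / M * m2)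
      with (c1 * (m1 ^ 2 + m2 ^ 2) / M) by (field; auto). fold M. field. auto. }
  assert (Eb : a * m2 + b * m1 = c2).
  { unfold a, b. replace ((c1 * m1 + c2 * m2) / M * m2 + (c2 * m1 - c1 * m2) / M * m1)
      with (c2 * (m1 ^ 2 + m2 ^ 2) / M) by (field; auto). fold M. field. auto. }
  (* what the first displacement adds to [B1 + i B2]: [(a + i b) m' (u - i v)^n]
     with [m' = 1 - m] *)
  set (k1 := a * (- INR n / 2) - b * (- m2)). set (k2 := a * (- m2) + b * (- INR n / 2)).
  destruct (conj_qhom n) as [Qp Qq].
  set (C1 := fun u v => B1 u v + ((- k1) * conj_re n u v + k2 * conj_im n u v)).
  set (C2 := fun u v => B2 u v + ((- k1) * conj_im n u v + (- k2) * conj_re n u v)).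
  assert (QC1 : qhom 1 n C1) by (repeat apply qhom_add; try apply qhom_scal; auto).
  assert (QC2 : qhom 1 n C2) by (repeat apply qhom_add; try apply qhom_scal; auto).
  destruct (radial_homological g n (fun u v => C1 u v + (- g) * C2 u v))
    as [s [f [fu [fv [Wf [Zf Ef]]]]]].
  { apply qhom_add; auto. apply qhom_scal; auto. }
  destruct (conj_pow_along g n) as [pu [pv [qu [qv [Wp [Wq [Ep Eq]]]]]]].
  assert (W1 := wp_add _ _ _ _ _ _ _ _
    (wpoly_mulv _ _ _ _ _ (wp_add _ _ _ _ _ _ _ _ (wpoly_scal _ _ a _ _ _ Wp)
                                                   (wpoly_scal _ _ (- b) _ _ _ Wq)))
    (wpoly_mulu _ _ _ _ _ Wf)).
  assert (W2 := wp_add _ _ _ _ _ _ _ _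
    (wpoly_mulv _ _ _ _ _ (wp_add _ _ _ _ _ _ _ _ (wpoly_scal _ _ a _ _ _ Wq)
                                                   (wpoly_scal _ _ b _ _ _ Wp)))
    (wpoly_mulv _ _ _ _ _ Wf)).
  assert (p0 := wpoly_at_0 _ _ _ _ _ Wp Hn). assert (q0 := wpoly_at_0 _ _ _ _ _ Wq Hn).
  assert (Lp := wpoly_lip _ _ _ _ _ Wp). assert (Lq := wpoly_lip _ _ _ _ _ Wq).
  assert (Lf := wpoly_lip _ _ _ _ _ Wf).
  assert (Lsc : forall c F, lip F -> lip (fun u v => c * F u v)).
  { intros c F. apply (lip_mul (fun _ _ => c)), lip_const. }
  exists s. eexists _, _, _, _, _, _, (fun u v => (-1) * C2 u v).
  split; [exact W1|]. split; [exact W2|]. split; [apply qhom_scal; auto|].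
  split; [|split; [|split; [|split]]].
  - apply flat_add.
    + apply flat_mul; [apply lip_v| |ring|rewrite p0, q0; ring].
      apply lip_add; apply Lsc; auto.
    + apply flat_mul; [apply lip_u|auto|ring|apply Zf].
  - apply flat_add.
    + apply flat_mul; [apply lip_v| |ring|rewrite p0, q0; ring].
      apply lip_add; apply Lsc; auto.
    + apply flat_mul; [apply lip_v|auto|ring|apply Zf].
  - intros u. cbv beta. rewrite Zf. ring.
  - intros u. cbv beta. rewrite Zf. ring.
  - intros u v. destruct (EB u v) as [-> ->]. rewrite <- Ea, <- Eb.
    specialize (Ep u v). specialize (Eq u v). specialize (Ef u v). unfold along in *.
    replace (conj_re (S n) u v) with (u * conj_re n u v + v * conj_im n u v) by reflexivity.
    replace (conj_im (S n) u v) with (u * conj_im n u v - v * conj_re n u v) by reflexivity.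
    set (p := conj_re n u v) in *. set (q := conj_im n u v) in *.
    assert (EC1 : C1 u v = B1 u v + (- k1 * p + k2 * q)) by reflexivity.
    assert (EC2 : C2 u v = B2 u v + (- k1 * q + - k2 * p)) by reflexivity.
    split.
    + match goal with |- ?l = _ => transitivity
        ((u + g * v) * (a * p - b * q)
         + v * (a * ((g * u - v) * pu u v + (u + g * v) * pv u v)
                - b * ((g * u - v) * qu u v + (u + g * v) * qv u v))
         + u * ((g * u - v) * fu u v + (u + g * v) * fv u v + s * v ^ n)
         + (g * u - v) * f u v
         - (g * (v * (a * p - b * q) + u * f u v) - (v * (a * q + b * p) + v * f u v))
         + C2 u v * (g * u - v)) end.
      * ring.
      * rewrite Ep, Eq, Ef, EC1, EC2. unfold k1, k2, m1, m2. field.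
    + match goal with |- ?l = _ => transitivity
        ((u + g * v) * (a * q + b * p)
         + v * (a * ((g * u - v) * qu u v + (u + g * v) * qv u v)
                + b * ((g * u - v) * pu u v + (u + g * v) * pv u v))
         + v * ((g * u - v) * fu u v + (u + g * v) * fv u v + s * v ^ n)
         + (u + g * v) * f u v
         - ((v * (a * p - b * q) + u * f u v) + g * (v * (a * q + b * p) + v * f u v))
         + C2 u v * (u + g * v)) end.
      * ring.
      * rewrite Ep, Eq, Ef, EC1, EC2. unfold k1, k2, m1, m2. field.
Qed.

(** * Focus type: normal forms *)

(** One component of [tau * Z(h) - Dh * W], where [W] is the target field
    [(g(v) u - v, u + g(v) v)] and [a1 + Fu], [a2 + Fv] are the entries of the
    corresponding row of [Dh]. *)
Definition field_defect (tau X h1 h2 : R -> R -> R) (a1 a2 : R) (Fu Fv : R -> R -> R)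
    (g : R -> R) (u v : R) : R :=
  tau u v * X (h1 u v) (h2 u v)
  - ((a1 + Fu u v) * (g v * u - v) + (a2 + Fv u v) * (u + g v * v)).

Definition linear_part (X : R -> R -> R) (a b : R) : Prop :=
  analytic X /\ bigO 1 2 (fun x y => X x y - (a * x + b * y)).

Lemma linear_rest X a b : analytic X -> analytic (fun x y => X x y - (a * x + b * y)).
Proof.
  intros H. apply (analytic_sub X); auto.
  apply (analytic_add (fun x _ => a * x)).
  - apply (analytic_scal a (fun x _ => x)), analytic_x.
  - apply (analytic_scal b (fun _ y => y)), analytic_y.
Qed.

Lemma bigO_linear q1 q2 : bigO 1 1 (fun u v => q1 * u + q2 * v).
Proof. apply bigO_add; apply bigO_scal; [apply bigO_u|apply bigO_v]. Qed.

(** To first order the defect depends on the perturbation through the linear part of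
    the field only; this is the homological operator. The perturbation has degree
    [n + 1] for the coordinate change and [n] for the time scaling. *)
Lemma field_defect_increment X a b tau t0 q1 q2 P S d1 d2 T a1 a2 Fu Fv du dv g gam s n :
  (1 <= n)%nat -> linear_part X a b ->
  bigO 1 2 P -> bigO 1 2 S -> bigO 1 (n + 1) d1 -> bigO 1 (n + 1) d2 -> bigO 1 n T ->
  bigO 1 1 (fun u v => tau u v - t0) ->
  bigO 1 1 Fu -> bigO 1 1 Fv -> bigO 1 n du -> bigO 1 n dv ->
  bigO 1 1 (fun _ v => g v - gam) ->
  bigO 1 (n + 2) (fun u v =>
    field_defect (fun u v => tau u v + T u v) X
      (fun u v => u + q2 * v + (P u v + d1 u v)) (fun u v => q1 * v + (S u v + d2 u v))
      a1 a2 (fun u v => Fu u v + du u v) (fun u v => Fv u v + dv u v)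
      (fun v => g v + s * v ^ n) u v
    - field_defect tau X (fun u v => u + q2 * v + P u v) (fun u v => q1 * v + S u v)
        a1 a2 Fu Fv g u v
    - (t0 * (a * d1 u v + b * d2 u v) + T u v * (a * (u + q2 * v) + b * (q1 * v))
       - (du u v * (gam * u - v) + dv u v * (u + gam * v))
       - s * v ^ n * (a1 * u + a2 * v))).
Proof.
  intros Hn [AX OX] OP OS Od1 Od2 OT Ot OFu OFv Odu Odv Og.
  set (X2 := fun x y => X x y - (a * x + b * y)) in *.
  assert (AX2 : analytic X2) by (apply linear_rest; auto).
  assert (Oh1 : bigO 1 1 (fun u v => u + q2 * v + P u v)).
  { apply bigO_add; [apply bigO_add; [apply bigO_u|apply bigO_scal, bigO_v]|].
    apply (bigO_weaken 1 2); auto. }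
  assert (Oh2 : bigO 1 1 (fun u v => q1 * v + S u v)).
  { apply bigO_add; [apply bigO_scal, bigO_v|]. apply (bigO_weaken 1 2); auto. }
  set (inc := fun u v => X2 (u + q2 * v + P u v + d1 u v) (q1 * v + S u v + d2 u v)
                         - X2 (u + q2 * v + P u v) (q1 * v + S u v)).
  assert (Oinc : bigO 1 (n + 2) inc).
  { apply (analytic_increment 1 2 (n + 2) (n + 1) (n + 1) X2
      (fun u v => u + q2 * v + P u v) (fun u v => q1 * v + S u v) d1 d2); auto; lia. }
  assert (OX2 : bigO 1 2 (fun u v => X2 (u + q2 * v + P u v) (q1 * v + S u v))).
  { apply (bigO_comp 1 2 X2); auto. }
  assert (Old : bigO 1 (n + 1) (fun u v => a * d1 u v + b * d2 u v)).
  { apply bigO_add; apply bigO_scal; auto. }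
  assert (Otau : bigO 1 0 tau).
  { apply (bigO_ext 1 0 (fun u v => (tau u v - t0) + t0)); [|intros; ring].
    apply bigO_add; [apply (bigO_weaken 1 1); auto|apply bigO_const]. }
  assert (Osv : bigO 1 n (fun u v => s * v ^ n)).
  { apply bigO_scal. apply (bigO_weaken 1 (n * 1)); [|lia]. apply (bigO_pow 1 1), bigO_v. }
  assert (Ogu : bigO 1 2 (fun u v => (g v - gam) * u)).
  { apply (bigO_mul 1 1 1 (fun _ v => g v - gam)); auto. apply bigO_u. }
  assert (Ogv : bigO 1 2 (fun u v => (g v - gam) * v)).
  { apply (bigO_mul 1 1 1 (fun _ v => g v - gam)); auto. apply bigO_v. }
  assert (Orow : bigO 1 2 (fun u v => (Fu u v + du u v) * u + (Fv u v + dv u v) * v)).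
  { apply bigO_add.
    - apply (bigO_mul 1 1 1); [|apply bigO_u]. apply bigO_add; auto.
      apply (bigO_weaken 1 n); auto.
    - apply (bigO_mul 1 1 1); [|apply bigO_v]. apply bigO_add; auto.
      apply (bigO_weaken 1 n); auto. }
  apply (bigO_ext 1 _ (fun u v =>
     (tau u v - t0) * (a * d1 u v + b * d2 u v) + tau u v * inc u v
     + T u v * (a * P u v + b * S u v + (a * d1 u v + b * d2 u v)
                + X2 (u + q2 * v + P u v) (q1 * v + S u v) + inc u v)
     - (du u v * ((g v - gam) * u) + dv u v * ((g v - gam) * v)
        + s * v ^ n * ((Fu u v + du u v) * u + (Fv u v + dv u v) * v)))).
  - apply bigO_sub; [apply bigO_add; [apply bigO_add|]|apply bigO_add; [apply bigO_add|]].
    + replace (n + 2)%nat with (1 + (n + 1))%nat by lia.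
      apply (bigO_mul 1 1 (n + 1) (fun u v => tau u v - t0)); auto.
    + apply (bigO_mul 1 0 (n + 2)); auto.
    + apply bigO_mul; auto.
      apply bigO_add; [apply bigO_add; [apply bigO_add; [apply bigO_add|]|]|].
      * apply bigO_scal; auto.
      * apply bigO_scal; auto.
      * apply (bigO_weaken 1 (n + 1)); [exact Old|lia].
      * exact OX2.
      * apply (bigO_weaken 1 (n + 2)); [auto|lia].
    + apply bigO_mul; auto.
    + apply bigO_mul; auto.
    + apply (bigO_mul 1 n 2 (fun u v => s * v ^ n)); auto.
  - intros u v. unfold field_defect, inc, X2.
    replace (u + q2 * v + (P u v + d1 u v)) with (u + q2 * v + P u v + d1 u v) by ring.
    replace (q1 * v + (S u v + d2 u v)) with (q1 * v + S u v + d2 u v) by ring.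
    ring.
Qed.

(** The linear change [x = u + q2 v], [y = q1 v] and the constant time scaling [t0]
    take the linear part [(a, b; c, d)] to [(gam, -1; 1, gam)]. *)
Definition linearized (a b c d t0 q1 q2 gam : R) : Prop :=
  t0 * a = gam + q2 /\ t0 * (a * q2 + b * q1) = q2 * gam - 1 /\
  t0 * c = q1 /\ t0 * (c * q2 + d * q1) = q1 * gam.

Definition focus_state (X Y : R -> R -> R) (t0 q1 q2 gam : R) (phi : R -> R)
    (tau P Pu Pv S Su Sv : R -> R -> R) (g : R -> R) (k : nat) : Prop :=
  analytic tau /\ bigO 1 1 (fun u v => tau u v - t0) /\
  perturb P Pu Pv /\ perturb S Su Sv /\
  (forall u, P u 0 = phi u) /\ (forall u, S u 0 = 0) /\
  bigO 1 2 P /\ bigO 1 2 S /\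
  bigO 1 1 Pu /\ bigO 1 1 Pv /\ bigO 1 1 Su /\ bigO 1 1 Sv /\
  analytic (fun _ v => g v) /\ bigO 1 1 (fun _ v => g v - gam) /\
  bigO 1 k (field_defect tau X (fun u v => u + q2 * v + P u v) (fun u v => q1 * v + S u v)
              1 q2 Pu Pv g) /\
  bigO 1 k (field_defect tau Y (fun u v => u + q2 * v + P u v) (fun u v => q1 * v + S u v)
              0 q1 Su Sv g).

Lemma field_defect_analytic tau X h1 h2 a1 a2 Fu Fv g :
  analytic tau -> analytic X -> analytic h1 -> analytic h2 -> h1 0 0 = 0 -> h2 0 0 = 0 ->
  analytic Fu -> analytic Fv -> analytic (fun _ v => g v) ->
  analytic (field_defect tau X h1 h2 a1 a2 Fu Fv g).
Proof.
  intros At AX A1 A2 Z1 Z2 AFu AFv Ag. unfold field_defect.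
  assert (Agu : analytic (fun u v => g v * u)).
  { apply (analytic_mul (fun _ v => g v)); auto. apply analytic_x. }
  assert (Agv : analytic (fun u v => g v * v)).
  { apply (analytic_mul (fun _ v => g v)); auto. apply analytic_y. }
  apply analytic_sub.
  - apply analytic_mul; auto. apply analytic_comp; auto.
  - apply analytic_add; apply analytic_mul.
    + apply (analytic_add (fun _ _ => a1)); auto. apply analytic_const.
    + apply (analytic_sub (fun u v => g v * u)); auto. apply analytic_y.
    + apply (analytic_add (fun _ _ => a2)); auto. apply analytic_const.
    + apply (analytic_add (fun u _ => u)); auto. apply analytic_x.
Qed.

Lemma focus_state_analytic X Y t0 q1 q2 gam phi tau P Pu Pv S Su Sv g k :
  analytic X -> analytic Y ->
  focus_state X Y t0 q1 q2 gam phi tau P Pu Pv S Su Sv g k ->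
  analytic (field_defect tau X (fun u v => u + q2 * v + P u v) (fun u v => q1 * v + S u v)
              1 q2 Pu Pv g) /\
  analytic (field_defect tau Y (fun u v => u + q2 * v + P u v) (fun u v => q1 * v + S u v)
              0 q1 Su Sv g).
Proof.
  intros AX AY [At [_ [[AP [APu [APv [_ [_ [P0 _]]]]]] [[AS [ASu [ASv [_ [_ [S0 _]]]]]]
    [_ [_ [_ [_ [_ [_ [_ [_ [Ag _]]]]]]]]]]]]].
  assert (A1 : analytic (fun u v => u + q2 * v + P u v)).
  { apply analytic_add; auto. apply analytic_add; [apply analytic_x|].
    apply analytic_scal, analytic_y. }
  assert (A2 : analytic (fun u v => q1 * v + S u v)).
  { apply analytic_add; auto. apply analytic_scal, analytic_y. }
  split; apply field_defect_analytic; auto; try (rewrite P0; ring); rewrite S0; ring.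
Qed.

Lemma focus_start X Y a b c d t0 q1 q2 gam phi dphi :
  linear_part X a b -> linear_part Y c d -> linearized a b c d t0 q1 q2 gam ->
  trace phi dphi ->
  focus_state X Y t0 q1 q2 gam phi (fun _ _ => t0)
    (fun u _ => phi u) (fun u _ => dphi u) (fun _ _ => 0)
    (fun _ _ => 0) (fun _ _ => 0) (fun _ _ => 0) (fun _ => gam) 2.
Proof.
  intros LX LY [L1 [L2 [L3 L4]]] [Pp Op]. destruct (Op 1%nat) as [Ophi Odphi].
  assert (Z : forall w, bigO 1 1 (fun _ _ : R => w - w)).
  { intros w. eapply bigO_ext; [apply bigO_zero|]. intros; simpl; ring. }
  split; [apply analytic_const|]. split; [apply Z|]. split; auto.
  split; [apply perturb_zero|]. split; auto. split; auto. split; auto.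
  split; [apply bigO_zero|]. split; auto. split; [apply bigO_zero|].
  split; [apply bigO_zero|]. split; [apply bigO_zero|]. split; [apply analytic_const|].
  split; [apply Z|].
  assert (Oh1 : bigO 1 1 (fun u v => u + q2 * v + phi u)).
  { apply bigO_add; [apply bigO_add; [apply bigO_u|apply bigO_scal, bigO_v]|].
    apply (bigO_weaken 1 2); auto. }
  assert (Oh2 : bigO 1 1 (fun u v => q1 * v + 0)).
  { apply bigO_add; [apply bigO_scal, bigO_v|apply bigO_zero]. }
  assert (G : forall F al be, linear_part F al be ->
    bigO 1 2 (fun u v => F (u + q2 * v + phi u) (q1 * v + 0)
                - (al * (u + q2 * v + phi u) + be * (q1 * v + 0)))).
  { intros F al be [AF OF].
    apply (bigO_comp 1 2 (fun x y => F x y - (al * x + be * y))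
             (fun u v => u + q2 * v + phi u) (fun u v => q1 * v + 0)); auto. }
  split.
  - apply (bigO_ext 1 2 (fun u v =>
      t0 * (X (u + q2 * v + phi u) (q1 * v + 0)
                - (a * (u + q2 * v + phi u) + b * (q1 * v + 0)))
      + t0 * a * phi u - dphi u * (gam * u + (-1) * v))).
    + apply bigO_sub; [apply bigO_add|].
      * apply bigO_scal, G, LX.
      * apply (bigO_scal 1 2 (t0 * a) (fun u _ => phi u)); auto.
      * apply (bigO_mul 1 1 1 (fun u _ => dphi u)); auto. apply bigO_linear.
    + intros u v. unfold field_defect.
      assert (E : t0 * (a * (u + q2 * v) + b * (q1 * v)) = (gam * u - v) + q2 * (u + gam * v)).
      { transitivity (t0 * a * u + t0 * (a * q2 + b * q1) * v); [ring|]. rewrite L1, L2. ring. }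
      transitivity (t0 * X (u + q2 * v + phi u) (q1 * v + 0)
        - t0 * (a * (u + q2 * v) + b * (q1 * v)) - dphi u * (gam * u - v)).
      * rewrite E. ring.
      * ring.
  - apply (bigO_ext 1 2 (fun u v =>
      t0 * (Y (u + q2 * v + phi u) (q1 * v + 0)
                - (c * (u + q2 * v + phi u) + d * (q1 * v + 0)))
      + t0 * c * phi u)).
    + apply bigO_add.
      * apply bigO_scal, G, LY.
      * apply (bigO_scal 1 2 (t0 * c) (fun u _ => phi u)); auto.
    + intros u v. unfold field_defect.
      assert (E : t0 * (c * (u + q2 * v) + d * (q1 * v)) = q1 * (u + gam * v)).
      { transitivity (t0 * c * u + t0 * (c * q2 + d * q1) * v); [ring|]. rewrite L4, L3. ring. }
      transitivity (t0 * Y (u + q2 * v + phi u) (q1 * v + 0)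
        - t0 * (c * (u + q2 * v) + d * (q1 * v))).
      * rewrite E. ring.
      * ring.
Qed.

(** In the coordinates in which the linear part is [(gam, -1; 1, gam)], the
    increments of the two defects are the two sides of the homological equation. *)
Lemma focus_step X Y a b c d t0 q1 q2 gam phi tau P Pu Pv S Su Sv g n :
  (1 <= n)%nat -> linear_part X a b -> linear_part Y c d ->
  linearized a b c d t0 q1 q2 gam -> q1 <> 0 -> t0 <> 0 ->
  focus_state X Y t0 q1 q2 gam phi tau P Pu Pv S Su Sv g (n + 1) ->
  exists tau' P' Pu' Pv' S' Su' Sv' s,
    focus_state X Y t0 q1 q2 gam phi tau' P' Pu' Pv' S' Su' Sv'
      (fun v => g v + s * v ^ n) (n + 2).
Proof.
  intros Hn LX LY [L1 [L2 [L3 L4]]] Hq1 Ht0 HS.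
  destruct (focus_state_analytic _ _ _ _ _ _ _ _ _ _ _ _ _ _ _ _ (proj1 LX) (proj1 LY) HS)
    as [A1 A2].
  destruct HS as [At [Ot [PP [PS [TP [TS [OP [OS [OPu [OPv [OSu [OSv [Ag [Og [O1 O2]]]]]]]]]]]]]]].
  destruct (taylor_step 1 (n + 1) _ ltac:(lia) A1 O1) as [R1 [R1u [R1v [WR1 OR1]]]].
  destruct (taylor_step 1 (n + 1) _ ltac:(lia) A2 O2) as [R2 [R2u [R2v [WR2 OR2]]]].
  replace (Datatypes.S (n + 1)) with (n + 2)%nat in OR1, OR2 by lia.
  replace (n + 1)%nat with (Datatypes.S n) in WR1, WR2 by lia.
  (* the columns [(1,0)] and [(q2,q1)] of the linear change give the second argument
     [(R1 - (q2/q1) R2, R2/q1)] *)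
  destruct (focus_homological gam n (fun u v => R1 u v + (- (q2 / q1)) * R2 u v)
              (fun u v => / q1 * R2 u v) Hn)
    as [s [e1 [e1u [e1v [e2 [e2u [e2v [T [W1 [W2 [QT [F1 [F2 [Z1 [Z2 E]]]]]]]]]]]]]]].
  { apply qhom_add; [|apply qhom_scal]; eexists _, _; eauto. }
  { apply qhom_scal. eexists _, _; eauto. }
  destruct QT as [Tu [Tv WT]].
  assert (V1 := wp_add _ _ _ _ _ _ _ _ W1 (wpoly_scal _ _ q2 _ _ _ W2)).
  assert (V2 := wpoly_scal _ _ q1 _ _ _ W2).
  assert (F1' : flat (fun u v => e1 u v + q2 * e2 u v)) by (apply flat_add; [|apply flat_scal]; auto).
  assert (F2' : flat (fun u v => q1 * e2 u v)) by (apply flat_scal; auto).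
  set (d1 := fun u v => e1 u v + q2 * e2 u v) in *.
  set (d1u := fun u v => e1u u v + q2 * e2u u v) in *.
  set (d1v := fun u v => e1v u v + q2 * e2v u v) in *.
  set (d2 := fun u v => q1 * e2 u v) in *.
  set (d2u := fun u v => q1 * e2u u v) in *.
  set (d2v := fun u v => q1 * e2v u v) in *.
  assert (Od1 := wpoly_bigO _ _ _ _ _ V1). assert (Od2 := wpoly_bigO _ _ _ _ _ V2).
  assert (Od1u := wpoly_bigO_u _ _ _ _ _ V1). assert (Od2u := wpoly_bigO_u _ _ _ _ _ V2).
  assert (Od1v := wpoly_bigO_v _ _ _ _ _ V1). assert (Od2v := wpoly_bigO_v _ _ _ _ _ V2).
  replace (Datatypes.S n) with (n + 1)%nat in Od1, Od2 by lia.
  replace (Datatypes.S n - 1)%nat with n in Od1u, Od2u, Od1v, Od2v by lia.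
  assert (OT : bigO 1 n (fun u v => t0 * T u v)).
  { apply bigO_scal. apply (wpoly_bigO _ _ _ _ _ WT). }
  assert (I1 := field_defect_increment X a b tau t0 q1 q2 P S d1 d2 (fun u v => t0 * T u v)
     1 q2 Pu Pv d1u d1v g gam s n Hn LX OP OS Od1 Od2 OT Ot OPu OPv Od1u Od1v Og).
  assert (I2 := field_defect_increment Y c d tau t0 q1 q2 P S d1 d2 (fun u v => t0 * T u v)
     0 q1 Su Sv d2u d2v g gam s n Hn LY OP OS Od1 Od2 OT Ot OSu OSv Od2u Od2v Og).
  exists (fun u v => tau u v + t0 * T u v),
    (fun u v => P u v + d1 u v), (fun u v => Pu u v + d1u u v), (fun u v => Pv u v + d1v u v),
    (fun u v => S u v + d2 u v), (fun u v => Su u v + d2u u v), (fun u v => Sv u v + d2v u v), s.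
  split; [apply analytic_add; auto; apply analytic_scal; apply (wpoly_analytic _ _ _ _ _ WT)|].
  split.
  { apply (bigO_ext 1 1 (fun u v => (tau u v - t0) + t0 * T u v)); [|intros; ring].
    apply bigO_add; auto. apply (bigO_weaken 1 n); auto. }
  split; [apply perturb_add; auto; eapply wpoly_perturb; eauto|].
  split; [apply perturb_add; auto; eapply wpoly_perturb; eauto|].
  split; [intros u; rewrite TP; unfold d1; rewrite Z1, Z2; ring|].
  split; [intros u; rewrite TS; unfold d2; rewrite Z2; ring|].
  split; [apply bigO_add; auto; apply (bigO_weaken 1 (n + 1)); [auto|lia]|].
  split; [apply bigO_add; auto; apply (bigO_weaken 1 (n + 1)); [auto|lia]|].
  split; [apply bigO_add; auto; apply (bigO_weaken 1 n); auto|].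
  split; [apply bigO_add; auto; apply (bigO_weaken 1 n); auto|].
  split; [apply bigO_add; auto; apply (bigO_weaken 1 n); auto|].
  split; [apply bigO_add; auto; apply (bigO_weaken 1 n); auto|].
  split.
  { apply (analytic_add (fun _ v => g v)); auto.
    apply (analytic_scal s (fun _ v => v ^ n)), (analytic_pow (fun _ v => v)), analytic_y. }
  split.
  { apply (bigO_ext 1 1 (fun u v => (g v - gam) + s * v ^ n)); [|intros; ring].
    apply bigO_add; auto. apply bigO_scal. apply (bigO_weaken 1 (n * 1)); [|lia].
    apply (bigO_pow 1 1), bigO_v. }
  split.
  - eapply bigO_ext; [apply bigO_add; [exact I1|exact OR1]|]. intros u v. cbv beta.
    destruct (E u v) as [G1 G2].
    assert (K : t0 * (a * d1 u v + b * d2 u v) + t0 * T u v * (a * (u + q2 * v) + b * (q1 * v))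
       - (d1u u v * (gam * u - v) + d1v u v * (u + gam * v)) - s * v ^ n * (1 * u + q2 * v)
       = - R1 u v).
    { replace (R1 u v) with ((R1 u v + - (q2 / q1) * R2 u v) + q2 * (/ q1 * R2 u v))
        by (field; auto).
      rewrite <- G1, <- G2. unfold along, d1, d2, d1u, d1v.
      transitivity (t0 * a * e1 u v + t0 * (a * q2 + b * q1) * e2 u v
        + T u v * (t0 * a * u + t0 * (a * q2 + b * q1) * v)
        - ((e1u u v + q2 * e2u u v) * (gam * u - v) + (e1v u v + q2 * e2v u v) * (u + gam * v))
        - s * v ^ n * (1 * u + q2 * v)); [ring|].
      rewrite L1, L2. ring. }
    rewrite K. ring.
  - eapply bigO_ext; [apply bigO_add; [exact I2|exact OR2]|]. intros u v. cbv beta.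
    destruct (E u v) as [G1 G2].
    assert (K : t0 * (c * d1 u v + d * d2 u v) + t0 * T u v * (c * (u + q2 * v) + d * (q1 * v))
       - (d2u u v * (gam * u - v) + d2v u v * (u + gam * v)) - s * v ^ n * (0 * u + q1 * v)
       = - R2 u v).
    { replace (R2 u v) with (q1 * (/ q1 * R2 u v)) by (field; auto).
      rewrite <- G2. unfold along, d1, d2, d2u, d2v.
      transitivity (t0 * c * e1 u v + t0 * (c * q2 + d * q1) * e2 u v
        + T u v * (t0 * c * u + t0 * (c * q2 + d * q1) * v)
        - ((q1 * e2u u v) * (gam * u - v) + (q1 * e2v u v) * (u + gam * v))
        - s * v ^ n * (0 * u + q1 * v)); [ring|].
      rewrite L4, L3. ring. }
    rewrite K. ring.
Qed.

Definition gamma_rate (N : nat) (gamma : nat -> R) (v : R) : R :=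
  gamma 1%nat + sum_n_m (fun i => gamma (i + 1)%nat * v ^ i) 1 N.

Lemma focus_normalization X Y a b c d t0 q1 q2 gam phi dphi N :
  linear_part X a b -> linear_part Y c d ->
  linearized a b c d t0 q1 q2 gam -> q1 <> 0 -> t0 <> 0 -> trace phi dphi ->
  exists gamma tau P Pu Pv S Su Sv,
    focus_state X Y t0 q1 q2 gam phi tau P Pu Pv S Su Sv (gamma_rate N gamma) (N + 2).
Proof.
  intros LX LY HL Hq1 Ht0 Tr.
  induction N as [|N [gamma [tau [P [Pu [Pv [S [Su [Sv HS]]]]]]]]].
  - exists (fun _ => gam).
    replace (gamma_rate 0 (fun _ => gam)) with (fun _ : R => gam).
    + do 7 eexists. apply (focus_start X Y a b c d t0 q1 q2 gam phi dphi); auto.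
    + apply functional_extensionality. intros v. unfold gamma_rate.
      rewrite sum_n_m_zero by lia. unfold zero; simpl. ring.
  - replace (N + 2)%nat with (Datatypes.S N + 1)%nat in HS by lia.
    destruct (focus_step _ _ _ _ _ _ _ _ _ _ _ _ _ _ _ _ _ _ _ (Datatypes.S N)
       (le_n_S _ _ (Nat.le_0_l N)) LX LY HL Hq1 Ht0 HS)
      as [tau' [P' [Pu' [Pv' [S' [Su' [Sv' [s HS']]]]]]]].
    exists (fun i => if Nat.eqb i (N + 2) then s else gamma i), tau', P', Pu', Pv', S', Su', Sv'.
    replace (gamma_rate (Datatypes.S N) _)
      with (fun v => gamma_rate N gamma v + s * v ^ Datatypes.S N); auto.
    apply functional_extensionality. intros v. unfold gamma_rate.
    rewrite sum_n_Sm by lia.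
    rewrite (sum_n_m_ext_loc (fun i => (if Nat.eqb (i + 1) (N + 2) then s
               else gamma (i + 1)%nat) * v ^ i) (fun i => gamma (i + 1)%nat * v ^ i) 1 N).
    + replace (Datatypes.S N + 1)%nat with (N + 2)%nat by lia. rewrite Nat.eqb_refl.
      destruct (Nat.eqb_spec 1 (N + 2)); [lia|].
      unfold plus; simpl. ring.
    + intros i Hi. destruct (Nat.eqb_spec (i + 1) (N + 2)); [lia|reflexivity].
Qed.

(** [tau * Z(h) = Dh * W + defect], so that pulling back by [Dh] gives the target
    [W] plus [Dh^-1] applied to the defects. *)
Lemma focus_state_conjugates X Y t0 q1 q2 gam phi tau P Pu Pv S Su Sv N gamma :
  analytic X -> analytic Y -> 0 < q1 -> 0 < t0 ->
  focus_state X Y t0 q1 q2 gam phi tau P Pu Pv S Su Sv (gamma_rate N gamma) (N + 2) ->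
  exists G, homogeneous_remainder (N + 2) G /\ admissible_scaling tau /\
    good_branch (Branch q1 q2 P S) /\
    conjugates (Branch q1 q2 P S) tau X Y (focus_form N gamma G).
Proof.
  intros AX AY Hq1 Ht0 HS.
  destruct (focus_state_analytic _ _ _ _ _ _ _ _ _ _ _ _ _ _ _ _ AX AY HS) as [A1 A2].
  destruct HS as [At [Ot [PP [PS [TP [TS [OP [OS [OPu [OPv [OSu [OSv [Ag [Og [O1 O2]]]]]]]]]]]]]]].
  set (g := gamma_rate N gamma) in *.
  set (D1 := field_defect tau X (fun u v => u + q2 * v + P u v) (fun u v => q1 * v + S u v)
              1 q2 Pu Pv g) in *.
  set (D2 := field_defect tau Y (fun u v => u + q2 * v + P u v) (fun u v => q1 * v + S u v)
              0 q1 Su Sv g) in *.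
  assert (Cadd : forall w F, analytic F -> analytic (fun u v => w + F u v)).
  { intros w F. apply (analytic_add (fun _ _ => w)), analytic_const. }
  assert (Aa := Cadd 1 Pu (proj1 (proj2 PP))). assert (Ab := Cadd q2 Pv (proj1 (proj2 (proj2 PP)))).
  assert (Ac := proj1 (proj2 PS)). assert (Ad := Cadd q1 Sv (proj1 (proj2 (proj2 PS)))).
  set (det := fun u v => (1 + Pu u v) * (q1 + Sv u v) - (q2 + Pv u v) * Su u v).
  assert (Adet : analytic det) by (apply analytic_sub; apply analytic_mul; auto).
  assert (det0 : det 0 0 = q1).
  { unfold det. rewrite (bigO_at_0 1 _ OPu), (bigO_at_0 1 _ OPv), (bigO_at_0 1 _ OSu),
      (bigO_at_0 1 _ OSv). ring. }
  set (G := fun u v => (((q1 + Sv u v) * D1 u v - (q2 + Pv u v) * D2 u v) / det u v,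
                        ((1 + Pu u v) * D2 u v - Su u v * D1 u v) / det u v)).
  assert (Hdet : det 0 0 <> 0) by (rewrite det0; lra).
  exists G. split; [|split; [|split]].
  - assert (Ai := analytic_inv det Adet Hdet).
    assert (Oi := bigO_analytic 1 _ (Nat.le_refl 1) Ai).
    assert (Om : forall F H, analytic F -> bigO 1 (N + 2) H -> bigO 1 (N + 2) (fun u v => F u v * H u v)).
    { intros F H AF OH. apply (bigO_mul 1 0 (N + 2)); auto. apply bigO_analytic; auto. }
    assert (Od : forall H, bigO 1 (N + 2) H -> bigO 1 (N + 2) (fun u v => H u v / det u v)).
    { intros H OH. replace (N + 2)%nat with (N + 2 + 0)%nat by lia. apply bigO_mul; auto. }
    apply homogeneous_remainder_of_order.
    + apply (analytic_mul (fun u v => (q1 + Sv u v) * D1 u v - (q2 + Pv u v) * D2 u v)); auto.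
      apply analytic_sub; apply analytic_mul; auto.
    + apply (analytic_mul (fun u v => (1 + Pu u v) * D2 u v - Su u v * D1 u v)); auto.
      apply analytic_sub; apply analytic_mul; auto.
    + apply (Od (fun u v => (q1 + Sv u v) * D1 u v - (q2 + Pv u v) * D2 u v)).
      apply bigO_sub; [apply (Om (fun u v => q1 + Sv u v))|apply (Om (fun u v => q2 + Pv u v))]; auto.
    + apply (Od (fun u v => (1 + Pu u v) * D2 u v - Su u v * D1 u v)).
      apply bigO_sub; [apply (Om (fun u v => 1 + Pu u v))|apply (Om Su)]; auto.
  - split; auto. apply analytic_near; auto.
    assert (E := bigO_at_0 1 _ Ot). cbv beta in E. lra.
  - split; [exact Hq1|]. split; [apply PP|]. split; [apply PS|]. split; [apply PP|].
    split; [apply PS|exact TS].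
  - generalize (analytic_near_neq det Adet Hdet).
    apply locally_2d_impl, locally_2d_forall. intros u v Hd.
    unfold transformed_field.
    destruct (derive_branch q1 q2 P Pu Pv S Su Sv u v PP PS) as [E1 [E2 [E3 E4]]].
    rewrite E1, E2, E3, E4. unfold focus_form.
    assert (Es : forall x, sum_n_m (fun i => gamma (i + 1)%nat * v ^ i * x) 1 N =
                           sum_n_m (fun i => gamma (i + 1)%nat * v ^ i) 1 N * x).
    { intros x. exact (sum_n_m_mult_r x (fun i => gamma (i + 1)%nat * v ^ i) 1 N). }
    rewrite !Es.
    assert (Eg : g v = gamma 1%nat + sum_n_m (fun i => gamma (i + 1)%nat * v ^ i) 1 N) by reflexivity.
    replace (branch_x (Branch q1 q2 P S) u v) with (u + q2 * v + P u v) by reflexivity.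
    replace (branch_y (Branch q1 q2 P S) u v) with (q1 * v + S u v) by reflexivity.
    assert (F1 : tau u v * X (u + q2 * v + P u v) (q1 * v + S u v) =
       D1 u v + ((1 + Pu u v) * (g v * u - v) + (q2 + Pv u v) * (u + g v * v))).
    { unfold D1, field_defect. ring. }
    assert (F2 : tau u v * Y (u + q2 * v + P u v) (q1 * v + S u v) =
       D2 u v + ((0 + Su u v) * (g v * u - v) + (q1 + Sv u v) * (u + g v * v))).
    { unfold D2, field_defect. ring. }
    set (x := X (u + q2 * v + P u v) (q1 * v + S u v)) in *.
    set (y := Y (u + q2 * v + P u v) (q1 * v + S u v)) in *.
    unfold G. cbn [fst snd]. unfold det in *. rewrite Eg in F1, F2.
    f_equal.
    + transitivity (((q1 + Sv u v) * (tau u v * x) - (q2 + Pv u v) * (tau u v * y)) /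
        ((1 + Pu u v) * (q1 + Sv u v) - (q2 + Pv u v) * Su u v)).
      * field. auto.
      * rewrite F1, F2. field. auto.
    + transitivity (((1 + Pu u v) * (tau u v * y) - Su u v * (tau u v * x)) /
        ((1 + Pu u v) * (q1 + Sv u v) - (q2 + Pv u v) * Su u v)).
      * field. auto.
      * rewrite F1, F2. field. auto.
Qed.

(** * Linear part of a focus and conclusion *)

Lemma derive_from_order2 (f : R -> R) a C d : 0 < d ->
  (forall x, Rabs x <= d -> Rabs (f x - a * x) <= C * Rabs x ^ 2) -> Derive f 0 = a.
Proof.
  intros Hd H. apply is_derive_unique, is_derive_Reals. intros eps He.
  assert (f0 : f 0 = 0).
  { assert (Z : Rabs 0 <= d) by (rewrite Rabs_R0; lra).
    specialize (H 0 Z). rewrite Rabs_R0, Rmult_0_r, Rminus_0_r in H.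
    apply Rabs_eq_0. pose proof (Rabs_pos (f 0)). simpl in H. lra. }
  assert (HC : 0 <= C).
  { assert (Rabs d <= d) as Hdd by (rewrite Rabs_pos_eq; lra).
    specialize (H d Hdd). pose proof (Rabs_pos (f d - a * d)).
    rewrite (Rabs_pos_eq d) in H by lra. assert (0 < d ^ 2) by nra. nra. }
  destruct (small_radius d eps C Hd He HC) as [e [[Hpos Hed] Hec]].
  exists (mkposreal e Hpos). simpl. intros h Hh0 Hh.
  assert (Hp := Rabs_pos_lt _ Hh0).
  rewrite Rplus_0_l, f0, Rminus_0_r.
  replace (f h / h - a) with ((f h - a * h) / h) by (field; auto).
  unfold Rdiv. rewrite Rabs_mult, Rabs_inv. specialize (H h ltac:(lra)).
  apply Rle_lt_trans with (C * Rabs h ^ 2 * / Rabs h).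
  - apply Rmult_le_compat_r; auto. left. apply Rinv_0_lt_compat; auto.
  - replace (C * Rabs h ^ 2 * / Rabs h) with (C * Rabs h) by (field; lra). nra.
Qed.

Lemma wpoly_degree1 f fu fv : wpoly 1 1 f fu fv -> forall u v, f u v = f 1 0 * u + f 0 1 * v.
Proof.
  intros H. remember 1%nat as k eqn:Ek in H at 2.
  induction H as [c i j k Hk|k f fu fv g gu gv _ IHf _ IHg]; intros u v.
  - subst k. destruct i as [|[|i]]; [|replace j with 0%nat by lia|lia].
    + replace j with 1%nat by lia. simpl. ring.
    + simpl. ring.
  - rewrite IHf, IHg by auto. ring.
Qed.

Lemma linear_part_derive X : analytic X -> X 0 0 = 0 ->
  linear_part X (Derive (fun x => X x 0) 0) (Derive (fun y => X 0 y) 0).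
Proof.
  intros AX X0.
  destruct (taylor_step 1 1 X ltac:(lia) AX (analytic_bigO1 1 X (Nat.le_refl 1) AX X0))
    as [P [Pu [Pv [W O]]]].
  assert (E := wpoly_degree1 _ _ _ W).
  assert (HO := O). destruct HO as [C [d [HC [Hd H]]]].
  assert (H' : forall x y, Rabs x <= d -> Rabs y <= d -> forall r, 0 < r -> Rabs x <= r ->
            Rabs y <= r -> r <= d -> Rabs (X x y - P x y) <= C * r ^ 2).
  { intros x y _ _ r Hr Hx Hy Hrd. apply H; auto. rewrite pow_1. auto. }
  assert (P00 : P 0 0 = 0) by (rewrite E; ring).
  assert (Z : forall r, 0 < r -> Rabs 0 <= r) by (intros; rewrite Rabs_R0; lra).
  assert (D1 : Derive (fun x => X x 0) 0 = P 1 0).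
  { apply (derive_from_order2 _ _ C d); [lra|]. intros x Hx.
    replace (P 1 0 * x) with (P x 0) by (rewrite (E x 0); ring).
    destruct (Req_dec x 0) as [->|N].
    - rewrite X0, P00, Rminus_0_r, Rabs_R0. simpl. lra.
    - assert (Hp := Rabs_pos_lt _ N). apply H'; auto; try lra; apply Z; lra. }
  assert (D2 : Derive (fun y => X 0 y) 0 = P 0 1).
  { apply (derive_from_order2 _ _ C d); [lra|]. intros x Hx.
    replace (P 0 1 * x) with (P 0 x) by (rewrite (E 0 x); ring).
    destruct (Req_dec x 0) as [->|N].
    - rewrite X0, P00, Rminus_0_r, Rabs_R0. simpl. lra.
    - assert (Hp := Rabs_pos_lt _ N). apply H'; auto; try lra; apply Z; lra. }
  rewrite D1, D2. split; auto. eapply bigO_ext; [exact O|]. intros x y. simpl.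
  rewrite <- E. reflexivity.
Qed.

(** A nonreal eigenvalue satisfies the characteristic equation, whose real and
    imaginary parts give the discriminant. *)
Lemma eigenvalue_discriminant a b c d al be : be <> 0 -> eigenvalue2 a b c d (al, be) ->
  (a - d) ^ 2 + 4 * b * c = - 4 * be ^ 2.
Proof.
  intros Hbe [[v1 v2] [[w1 w2] [Hne [E1 E2]]]].
  unfold Cmult, Cplus, RtoC in E1, E2; simpl in E1, E2.
  injection E1 as E1r E1i. injection E2 as E2r E2i.
  (* [p + i q = (mu - a) (mu - d) - b c] kills both components of the eigenvector *)
  set (p := (al - a) * (al - d) - be ^ 2 - b * c). set (q := be * (2 * al - a - d)).
  assert (z1 : (al - a) * v1 - be * v2 - b * w1 = 0) by lra.
  assert (z2 : (al - a) * v2 + be * v1 - b * w2 = 0) by lra.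
  assert (z3 : (al - d) * w1 - be * w2 - c * v1 = 0) by lra.
  assert (z4 : (al - d) * w2 + be * w1 - c * v2 = 0) by lra.
  assert (V1 : p * v1 - q * v2 = 0).
  { transitivity ((al - d) * ((al - a) * v1 - be * v2 - b * w1)
      - be * ((al - a) * v2 + be * v1 - b * w2) + b * ((al - d) * w1 - be * w2 - c * v1)).
    - unfold p, q; ring.
    - rewrite z1, z2, z3. ring. }
  assert (V2 : p * v2 + q * v1 = 0).
  { transitivity ((al - d) * ((al - a) * v2 + be * v1 - b * w2)
      + be * ((al - a) * v1 - be * v2 - b * w1) + b * ((al - d) * w2 + be * w1 - c * v2)).
    - unfold p, q; ring.
    - rewrite z1, z2, z4. ring. }
  assert (W1 : p * w1 - q * w2 = 0).
  { transitivity ((al - a) * ((al - d) * w1 - be * w2 - c * v1)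
      - be * ((al - d) * w2 + be * w1 - c * v2) + c * ((al - a) * v1 - be * v2 - b * w1)).
    - unfold p, q; ring.
    - rewrite z1, z3, z4. ring. }
  assert (W2 : p * w2 + q * w1 = 0).
  { transitivity ((al - a) * ((al - d) * w2 + be * w1 - c * v2)
      + be * ((al - d) * w1 - be * w2 - c * v1) + c * ((al - a) * v2 + be * v1 - b * w2)).
    - unfold p, q; ring.
    - rewrite z2, z3, z4. ring. }
  assert (Hs : (p ^ 2 + q ^ 2) * (v1 ^ 2 + v2 ^ 2 + w1 ^ 2 + w2 ^ 2) = 0).
  { transitivity ((p * v1 - q * v2) ^ 2 + (p * v2 + q * v1) ^ 2
      + (p * w1 - q * w2) ^ 2 + (p * w2 + q * w1) ^ 2); [ring|].
    rewrite V1, V2, W1, W2. ring. }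
  assert (Hpq : p ^ 2 + q ^ 2 = 0).
  { apply Rmult_integral in Hs. destruct Hs as [Hs|Hs]; auto. exfalso. apply Hne.
    assert (v1 = 0) by nra. assert (v2 = 0) by nra. assert (w1 = 0) by nra. assert (w2 = 0) by nra.
    subst. reflexivity. }
  assert (p0 : p = 0) by nra. assert (q0 : q = 0) by nra.
  unfold q in q0. apply Rmult_integral in q0. destruct q0 as [q0|q0]; [lra|].
  unfold p in p0. assert (Eal : al = (a + d) / 2) by lra. rewrite Eal in p0. lra.
Qed.

(** The angular speed of a clockwise linear focus is a negative definite form, which
    dominates the higher order terms near O. *)
Lemma clockwise_focus X Y a b c d be : linear_part X a b -> linear_part Y c d -> be <> 0 ->
  (a - d) ^ 2 + 4 * b * c = - 4 * be ^ 2 -> c < 0 ->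
  locally_2d (fun x y => x * Y x y - y * X x y <= 0) 0 0.
Proof.
  intros [AX OX] [AY OY] Hbe Hdisc Hc.
  assert (Hb2 : 0 < be ^ 2) by nra.
  assert (Hb : 0 < b).
  { pose proof (pow2_ge_0 (a - d)). destruct (Rlt_or_le 0 b); auto.
    assert (0 <= b * c) by nra. lra. }
  set (m := be ^ 2 / (b - c)). assert (Hm : 0 < m) by (apply Rdiv_lt_0_compat; lra).
  assert (Em : m * (b - c) = be ^ 2) by (unfold m; field; lra).
  (* [m] bounds the definite form below: its smallest eigenvalue is at least the
     determinant over the trace *)
  assert (Hform : forall x y, c * x ^ 2 + (d - a) * x * y - b * y ^ 2 <= - m * (x ^ 2 + y ^ 2)).
  { intros x y. set (p := - c - m).
    assert (Hp : 0 < p).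
    { apply (Rmult_lt_reg_r (b - c)); [lra|]. rewrite Rmult_0_l.
      unfold p. replace ((- c - m) * (b - c)) with (- c * (b - c) - m * (b - c)) by ring.
      rewrite Em. assert (0 < c ^ 2) by nra. pose proof (pow2_ge_0 (a - d)). lra. }
    assert (E : p * (p * x ^ 2 + (a - d) * x * y + (b - m) * y ^ 2)
      = (p * x + (a - d) / 2 * y) ^ 2 + m ^ 2 * y ^ 2).
    { assert (Ed : p * (b - m) = (a - d) ^ 2 / 4 + m ^ 2).
      { unfold p. replace ((- c - m) * (b - m)) with (- (b * c) - m * (b - c) + m ^ 2) by ring.
        rewrite Em. lra. }
      transitivity (p ^ 2 * x ^ 2 + p * (a - d) * x * y + p * (b - m) * y ^ 2); [ring|].
      rewrite Ed. field. }
    assert (0 <= p * (p * x ^ 2 + (a - d) * x * y + (b - m) * y ^ 2)).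
    { rewrite E. apply Rplus_le_le_0_compat; [apply pow2_ge_0|].
      apply Rmult_le_pos; apply pow2_ge_0. }
    assert (0 <= p * x ^ 2 + (a - d) * x * y + (b - m) * y ^ 2) by nra.
    unfold p in *. lra. }
  assert (O3 : bigO 1 3 (fun x y => x * (Y x y - (c * x + d * y)) - y * (X x y - (a * x + b * y)))).
  { apply bigO_sub.
    - apply (bigO_mul 1 1 2 (fun x _ => x)); auto. apply bigO_u.
    - apply (bigO_mul 1 1 2 (fun _ y => y)); auto. apply bigO_v. }
  destruct O3 as [C [e [HC [He H]]]].
  destruct (small_radius e m C (proj1 He) Hm HC) as [r [[Hr Hre] HrC]].
  apply (locally_square _ r Hr). intros x y Hx Hy.
  set (s := Rmax (Rabs x) (Rabs y)).
  assert (Hsx : Rabs x <= s) by apply Rmax_l. assert (Hsy : Rabs y <= s) by apply Rmax_r.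
  assert (Hsr : s <= r) by (apply Rmax_lub; auto).
  assert (Hs2 : s ^ 2 <= x ^ 2 + y ^ 2).
  { rewrite <- (pow2_abs x), <- (pow2_abs y). unfold s, Rmax.
    destruct (Rle_dec (Rabs x) (Rabs y)); nra. }
  assert (Hs0 : 0 <= s) by (pose proof (Rabs_pos x); lra).
  specialize (Hform x y).
  destruct (Req_dec s 0) as [E|E].
  - assert (Rabs x = 0) by (pose proof (Rabs_pos x); lra).
    assert (Rabs y = 0) by (pose proof (Rabs_pos y); lra).
    assert (x = 0) by (apply Rabs_eq_0; auto). assert (y = 0) by (apply Rabs_eq_0; auto).
    subst x y. lra.
  - assert (H1 := H s x y ltac:(lra) Hsx). rewrite pow_1 in H1. specialize (H1 Hsy).
    apply Rabs_le_between in H1.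
    assert (C * s ^ 3 <= m * (x ^ 2 + y ^ 2)).
    { replace (C * s ^ 3) with (C * s * s ^ 2) by ring.
      apply Rmult_le_compat; try nra. }
    lra.
Qed.

(** The sense of rotation gives [0 < c], hence a linear normalization with [0 < q1];
    the time unit is the imaginary part of the eigenvalue. *)
Lemma focus_normal_form X Y sg N phi dphi : (sg = 1 \/ sg = -1) ->
  (forall eps, 0 < eps -> half_turn sg X Y eps) ->
  analytic X -> analytic Y -> focus_type X Y -> trace phi dphi ->
  exists gamma G h tau, homogeneous_remainder (N + 2) G /\
    good_branch h /\ (forall u, Phi h u 0 = phi u) /\ admissible_scaling tau /\
    conjugates h tau X Y (focus_form N gamma G).
Proof.
  intros Hsg Hturn AX AY [X0 [Y0 HF]] Tr. cbv zeta in HF.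
  destruct HF as [al [be [Hbe [Hev _]]]].
  assert (LX := linear_part_derive X AX X0). assert (LY := linear_part_derive Y AY Y0).
  set (a := Derive (fun x => X x 0) 0) in *. set (b := Derive (fun y => X 0 y) 0) in *.
  set (c := Derive (fun x => Y x 0) 0) in *. set (d := Derive (fun y => Y 0 y) 0) in *.
  assert (Hd := eigenvalue_discriminant a b c d al be Hbe Hev).
  clearbody a b c d.
  assert (Hb2 : 0 < be ^ 2) by nra.
  assert (Hc : 0 < c).
  { destruct (Rtotal_order c 0) as [Hn|[Hz|Hp]]; auto; exfalso.
    - apply (half_turn_angle sg X Y Hsg Hturn).
      apply (clockwise_focus X Y a b c d be); auto.
    - subst c. assert (0 <= (a - d) ^ 2) by apply pow2_ge_0. lra. }
  set (B := Rabs be). assert (HB : 0 < B) by (apply Rabs_pos_lt; auto).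
  assert (EB : B * B = be ^ 2) by (unfold B; rewrite <- (pow2_abs be); ring).
  set (t0 := / B). set (q1 := c / B). set (q2 := (a - d) / (2 * B)). set (gam := (a + d) / (2 * B)).
  assert (HL : linearized a b c d t0 q1 q2 gam).
  { unfold linearized, t0, q1, q2, gam.
    assert (Ebc : b * c = - (B * B) - (a - d) ^ 2 / 4) by (rewrite EB; lra).
    split; [field; lra|]. split; [|split; [field; lra|field; lra]].
    replace (/ B * (a * ((a - d) / (2 * B)) + b * (c / B)))
      with ((a * (a - d) / 2 + b * c) / (B * B)) by (field; lra).
    rewrite Ebc. field. lra. }
  assert (Hq1 : 0 < q1) by (apply Rdiv_lt_0_compat; auto).
  assert (Ht0 : 0 < t0) by (apply Rinv_0_lt_compat; auto).
  destruct (focus_normalization X Y a b c d t0 q1 q2 gam phi dphi N LX LY HL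
              ltac:(lra) ltac:(lra) Tr) as [gamma [tau [P [Pu [Pv [S [Su [Sv HS]]]]]]]].
  destruct (focus_state_conjugates X Y t0 q1 q2 gam phi tau P Pu Pv S Su Sv N gamma AX AY
              Hq1 Ht0 HS) as [G [HG [Ht [Hg HC]]]].
  exists gamma, G, (Branch q1 q2 P S), tau. split; auto. split; auto. split; auto.
  intros u. apply HS.
Qed.

Lemma parabolic_speed sg X Y : (sg = 1 \/ sg = -1) -> analytic X -> X 0 0 <> 0 ->
  (forall eps, 0 < eps -> half_turn sg X Y eps) -> sg * X 0 0 < 0.
Proof.
  intros Hsg AX H0 Hturn. destruct (Rlt_or_le (sg * X 0 0) 0) as [H|H]; auto. exfalso.
  apply (half_turn_speed sg X Y Hsg Hturn).
  assert (Hp : 0 < sg * X 0 0) by (destruct Hsg; subst sg; lra).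
  generalize (analytic_near (fun x y => sg * X x y) (analytic_scal sg X AX) Hp).
  apply locally_2d_impl, locally_2d_forall. intros; lra.
Qed.

Theorem theorem1p1 (Xp Yp Xm Ym : R -> R -> R)
  (hXp : analytic Xp) (hYp : analytic Yp)
  (hXm : analytic Xm) (hYm : analytic Ym)
  (hmono : monodromic Xp Yp Xm Ym)
  (hccw : rotates_counterclockwise Xp Yp Xm Ym)
  (N : nat) (hN : (1 <= N)%nat) :
  (FF_type Xp Yp Xm Ym ->
     exists (gammap gammam : nat -> R) (Gp Gm : R -> R -> R * R),
       homogeneous_remainder (N + 2) Gp /\
       homogeneous_remainder (N + 2) Gm /\
       transformable_into Xp Yp Xm Ym
         (focus_form N gammap Gp) (focus_form N gammam Gm)) /\
  (FP_type Xp Yp Xm Ym ->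
     exists (gammap : nat -> R) (lm : nat) (Gp Fm : R -> R -> R * R),
       (1 <= lm)%nat /\
       homogeneous_remainder (N + 2) Gp /\
       quasi_homogeneous_remainder lm N Fm /\
       transformable_into Xp Yp Xm Ym
         (focus_form N gammap Gp) (lower_parabolic_form lm Fm)) /\
  (PP_type Xp Yp Xm Ym ->
     exists (sigmap : nat -> R) (lp lm : nat) (Fp Fm : R -> R -> R * R),
       (1 <= lp)%nat /\ (1 <= lm)%nat /\
       quasi_homogeneous_remainder lp N Fp /\
       quasi_homogeneous_remainder lm N Fm /\
       transformable_into Xp Yp Xm Ym
         (upper_parabolic_form N lp sigmap Fp) (lower_parabolic_form lm Fm)).
Proof.
  assert (Tp : forall eps, 0 < eps -> half_turn 1 Xp Yp eps)
    by (intros; apply (half_turns Xp Yp Xm Ym); auto).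
  assert (Tm : forall eps, 0 < eps -> half_turn (-1) Xm Ym eps)
    by (intros; apply (half_turns Xp Yp Xm Ym); auto).
  assert (Lower : lower_parabolic_type Xm Ym -> 0 < Xm 0 0).
  { intros [l [[_ [H0 _]] _]].
    assert (H := parabolic_speed (-1) Xm Ym (or_intror eq_refl) hXm H0 Tm). lra. }
  split; [|split].
  - intros [Fp Fm].
    destruct (focus_normal_form Xp Yp 1 N _ _ (or_introl eq_refl) Tp hXp hYp Fp trace_zero)
      as [gp [Gp [hp [tp [HGp [Hhp [Tr1 [Htp Cp]]]]]]]].
    destruct (focus_normal_form Xm Ym (-1) N _ _ (or_intror eq_refl) Tm hXm hYm Fm trace_zero)
      as [gm [Gm [hm [tm [HGm [Hhm [Tr2 [Htm Cm]]]]]]]].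
    exists gp, gm, Gp, Gm. split; auto. split; auto.
    apply (glue_transformable _ _ _ _ _ _ hp hm tp tm); auto.
    intros u. rewrite Tr1, Tr2. reflexivity.
  - intros [Fp Pm].
    destruct (lower_parabolic_normal_form Xm Ym N hXm hYm Pm (Lower Pm))
      as [phi [dphi [l [hm [tm [Fm [Tr [Hl [HFm [Hhm [Tr2 [Htm Cm]]]]]]]]]]]].
    destruct (focus_normal_form Xp Yp 1 N _ _ (or_introl eq_refl) Tp hXp hYp Fp Tr)
      as [gp [Gp [hp [tp [HGp [Hhp [Tr1 [Htp Cp]]]]]]]].
    exists gp, l, Gp, Fm. split; auto. split; auto. split; auto.
    apply (glue_transformable _ _ _ _ _ _ hp hm tp tm); auto.
    intros u. rewrite Tr1, Tr2. reflexivity.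
  - intros [Pp Pm].
    destruct (lower_parabolic_normal_form Xm Ym N hXm hYm Pm (Lower Pm))
      as [phi [dphi [l [hm [tm [Fm [Tr [Hl [HFm [Hhm [Tr2 [Htm Cm]]]]]]]]]]]].
    assert (Hup : Xp 0 0 < 0).
    { destruct Pp as [l' [[_ [H0 _]] _]].
      assert (H := parabolic_speed 1 Xp Yp (or_introl eq_refl) hXp H0 Tp). lra. }
    destruct (upper_parabolic_normal_form Xp Yp N phi dphi hXp hYp Pp Hup Tr)
      as [sigma [l' [hp [tp [Fp [Hl' [HFp [Hhp [Tr1 [Htp Cp]]]]]]]]]].
    exists sigma, l', l, Fp, Fm. split; auto. split; auto. split; auto. split; auto.
    apply (glue_transformable _ _ _ _ _ _ hp hm tp tm); auto.
    intros u. rewrite Tr1, Tr2. reflexivity.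
Qed.
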